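(* Let $(\mathcal A,\psi,S,(\mathcal A_I)_{I\in\mathcal I})$ be an $\mathcal A_0$-expected continuous Bernoulli shift. Let $\mathscr C_0^0(\mathcal A,\cdot)$ be the set of its $\|\cdot\|_0$-continuous unitary cocycles. Then there exists a bijective correspondence between $\mathscr C_0^0(\mathcal A,\cdot)$ and the set of additive cocycles $\mathrm{Ln}\bigl(\mathscr C_0^0(\mathcal A,\cdot)\bigr)\subset\mathscr C_0^0(\mathcal E,+)$.
   Context: Probability spaces. A probability space $(\mathcal A,\psi)$ is a von Neumann algebra $\mathcal A$ with separable predual and a faithful normal state $\psi$. A subalgebra of $(\mathcal A,\psi)$ is a von Neumann subalgebra $\mathcal B\subseteq\mathcal A$ for which the (unique) $\psi$-preserving conditional expectation $E_{\mathcal B}$ onto $\mathcal B$ exists. $\mathrm{Aut}(\mathcal A,\psi)$: $\psi$-preserving $*$-automorphisms. An $\mathcal A_0$-expected probability space has a distinguished subalgebra $\mathcal A_0$; $E_0$ is the $\psi$-preserving conditional expectation onto $\mathcal A_0$. Subalgebras $\mathcal B,\mathcal C\supseteq\mathcal A_0$ are $\mathcal A_0$-independent if $E_0(xy)=E_0(x)E_0(y)$ for $x\in\mathcal B$, $y\in\mathcal C$. Continuous Bernoulli shifts. $\mathcal I$ is the set of all intervals $I\subseteq\mathbb R$ (possibly unbounded or degenerate to a point) and the empty set. A filtration is a family $(\mathcal A_I)_{I\in\mathcal I}$ of subalgebras of $(\mathcal A,\psi)$ with $\mathcal A_I\subseteq\mathcal A_J$ for $I\subseteq J$; it is minimal if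 the $\mathcal A_I$ with $I$ bounded generate $\mathcal A$. An $\mathcal A_0$-expected continuous Bernoulli shift $(\mathcal A,\psi,S,(\mathcal A_I)_{I\in\mathcal I})$ consists of an $\mathcal A_0$-expected probability space, a pointwise weak*-continuous group $S=(S_t)_{t\in\mathbb R}\subset\mathrm{Aut}(\mathcal A,\psi)$ and a minimal filtration such that (i) $\mathcal A_0$ is the fixed point algebra of $S$; (ii) $S_t\mathcal A_I=\mathcal A_{I+t}$; (iii) $\mathcal A_I,\mathcal A_J$ are $\mathcal A_0$-independent whenever $I\cap J=\emptyset$ (this then also holds when only the interiors of $I$ and $J$ are disjoint). GNS version. $\mathcal A$ acts on its GNS Hilbert space $\mathcal H_\psi$ with cyclic separating vector $\Omega$; $e_0$ is the orthogonal projection onto $\mathcal H_0=\overline{\mathcal A_0\Omega}$. $\mathcal E$ is the closure of $\mathcal Ae_0$ in the strong operator topology of $\mathcal B(\mathcal H_\psi)$, with $\mathcal A_0$-valued inner product $\langle x|y\rangle_0=x^*y$, where $\mathcal A_0e_0$ is identified with $\mathcal A_0$; so $\langle xe_0|ye_0\rangle_0=E_0(x^*y)$ for $x,y\in\mathcal A$. Put $|x|_0=\langle x|x\rangle_0^{1/2}$, $\|x\|_0=\||x|_0\|$. $\mathcal A$ is regarded as a subspace of $\mathcal E$ via $x\mapsto xe_0$. $\mathcal E_I$ is the strong closure of $\mathcal A_Ie_0$. $S_t$ and $E_0$ extend to $\mathcal E$ (same symbols): if $\overline T$ is the operator on $\mathcal H_\psi$ with $\overline Tx\Omega=T(x)\Omega$,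 the extension is $x\mapsto\overline Tx$; $E_0x=\langle\mathbf 1|x\rangle_0$. Cocycles. A unitary cocycle is a family $u=(u_t)_{t\ge0}$ of unitaries in $\mathcal A$ with $t\mapsto u_t$ weak*-continuous, $u_t\in\mathcal A_{[0,t]}$ and $u_{s+t}=S_t(u_s)u_t$ for all $s,t\ge0$. It is $\|\cdot\|_0$-continuous if $t\mapsto u_t\in\mathcal E$ is continuous for $\|\cdot\|_0$. An additive cocycle is a $\|\cdot\|_0$-continuous family $b=(b_t)_{t\ge0}\subset\mathcal E$ with $b_t\in\mathcal E_{[0,t]}$ and $b_{t+s}=b_t+S_tb_s$ for all $s,t\ge0$. $\mathscr C_0^0(\mathcal E,+)$ is the set of additive cocycles $b$ satisfying $\langle b_t-E_0b_t|b_t-E_0b_t\rangle_0+E_0b_t+(E_0b_t)^*=0$ for all $t\ge0$. The map $\mathrm{Ln}$ sends a $\|\cdot\|_0$-continuous unitary cocycle $u$ (viewed in $\mathcal E$) to the additive cocycle $\mathrm{Ln}(u)_t=\|\cdot\|_0\text{-}\lim_{Z\in\mathcal Z(t)}\sum_iS_{t_i}(u_{t_{i+1}-t_i}-\mathbf 1)$, where $\mathcal Z(t)$ is a net of finite partitions $Z=\{0=t_0<\dots<t_n=t\}$ of $[0,t]$ ordered by inclusion with mesh tending to zero; the limit exists. *)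

(* Defs.v *)
From HB Require Import structures.
From mathcomp Require Import all_boot all_order all_algebra.
From mathcomp Require Import sesquilinear complex.
From mathcomp Require Import all_classical all_reals all_analysis.

Set Implicit Arguments.
Unset Strict Implicit.
Unset Printing Implicit Defensive.

Import Order.TTheory GRing.Theory Num.Theory.
Import numFieldNormedType.Exports.

Local Open Scope classical_set_scope.
Local Open Scope ring_scope.
Local Open Scope complex_scope.

(* The half-line [0, +oo[ with the topology induced by R. *)
Definition halfline (R : realType) : topologicalType :=
  initial_topology (fun t : {nonneg R} => t%:num).

(* Forms of type {dot _ for _} are linear in the first argument and conjugate
   linear in the second one. *)
Record hilbertType (R : realType) := Hilbert {
  hcarrier :> completeNormedModType R[i];
  hdot : {dot hcarrier for Num.conj};
  hdotE : forall x : hcarrier, hdot x x = `|x| ^+ 2 }.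

Section Operators.
Context {R : realType} (H : hilbertType R).

Definition op : Type := H -> H.

Implicit Types (T p : op) (M : set op).

Definition BH : set op := [set T | linear T /\ continuous T].

Definition is_adj T T' := forall x y : H, hdot H (T x) y = hdot H x (T' y).

Definition adj T : op := xget (0 : H -> H) [set T' | is_adj T T'].

Definition pos_op T := forall x : H, 0 <= hdot H (T x) x.

Definition opnorm T : R :=
  sup [set complex.Re `|T x| | x in [set x : H | `|x| <= 1]].

Definition unitary_op T := adj T \o T = idfun /\ T \o adj T = idfun.

(* Pointwise convergence on H is convergence in the strong operator
   topology. *)
Definition sot_closure M : set op :=
  BH `&` closure (M : set {ptws H -> H}).

Definition commutant M : set op :=
  [set T | BH T /\ forall T', M T' -> T \o T' = T' \o T].

Definition is_vN M :=
  [/\ M `<=` BH, (forall T, M T -> M (adj T)) & commutant (commutant M) = M].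

Definition is_proj (K : set H) p :=
  [/\ BH p, p \o p = p, is_adj p p & range p = K].

Definition square_summable (xi : H^nat) :=
  cvgn (series (fun n => `|xi n| ^+ 2)).

(* The predual of a von Neumann algebra M: its normal functionals
   x |-> \sum_n <x xi_n, eta_n>.  Only the values on M are relevant. *)
Definition predual M : set (op -> R[i]) :=
  [set phi | exists xi eta : H^nat,
    [/\ square_summable xi, square_summable eta & forall x, M x ->
      series (fun n => hdot H (x (xi n)) (eta n)) @ \oo --> (phi x : R[i]^o)]].

(* Separability of the predual for the norm of functionals on M. *)
Definition separable_predual M :=
  exists phi : nat -> op -> R[i], (forall n, predual M (phi n)) /\
    forall f, predual M f -> forall e : R[i], 0 < e ->
      exists n, forall x, M x -> opnorm x <= 1 -> `|f x - phi n x| <= e.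

Definition weakstar_continuous M (X : topologicalType) (f : X -> op) :=
  forall phi, predual M phi -> continuous (fun t => phi (f t) : R[i]^o).

End Operators.

(* A von Neumann algebra with a faithful normal state is identified with its
   GNS representation: the algebra acts on the Hilbert space of the state, and
   the state is the vector state psi of a cyclic separating unit vector. *)
Record prob_space (R : realType) := ProbSpace {
  gns :> hilbertType R;
  alg : set (op gns);
  Omega : gns;
  alg_vN : is_vN alg;
  alg_sep : separable_predual alg;
  Omega_unit : `|Omega| = 1;
  Omega_cyclic : closure [set x Omega | x in alg] = setT;
  Omega_separating : forall x, alg x -> x Omega = 0 -> x = (0 : gns -> gns) }.

Section ProbSpaceTheory.
Context {R : realType} (P : prob_space R).
Local Notation A := (@alg R P).

Definition psi (x : op P) : R[i] := hdot P (x (Omega P)) (Omega P).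

Definition linear_on_alg (f : op P -> op P) :=
  forall (c : R[i]) (x y : P -> P), A x -> A y ->
    f (c *: x + y) = c *: (f x : P -> P) + (f y : P -> P).

Definition is_condexp (B : set (op P)) (E : op P -> op P) :=
  [/\ [/\ forall x, A x -> B (E x),
          forall y, B y -> E y = y &
          linear_on_alg E],
      forall x, A x -> pos_op x -> pos_op (E x),
      forall b x c, B b -> A x -> B c -> E (b \o x \o c) = b \o E x \o c &
      forall x, A x -> psi (E x) = psi x].

Definition is_subalg (B : set (op P)) :=
  [/\ is_vN B, B `<=` A & exists E, is_condexp B E].

Definition is_aut (f : op P -> op P) :=
  [/\ set_bij A A f,
      linear_on_alg f,
      forall x y, A x -> A y -> f (x \o y) = f x \o f y,
      forall x, A x -> f (adj x) = adj (f x) &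
      forall x, A x -> psi (f x) = psi x].

End ProbSpaceTheory.

Record expected_space (R : realType) := ExpectedSpace {
  eps_space :> prob_space R;
  A0 : set (op eps_space);
  E0 : op eps_space -> op eps_space;
  A0_subalg : is_subalg A0;
  E0_condexp : is_condexp A0 E0 }.

Definition independent (R : realType) (P : expected_space R)
    (B C : set (op P)) :=
  [/\ @A0 R P `<=` B, @A0 R P `<=` C &
      forall x y, B x -> C y -> E0 (x \o y) = E0 x \o E0 y].

(* Intervals are convex subsets of R: the empty set, points and unbounded
   intervals are included; filt is irrelevant on other sets. *)
Record bernoulli_shift (R : realType) := BernoulliShift {
  bs_space :> expected_space R;
  flow : R -> op bs_space -> op bs_space;
  filt : set R -> set (op bs_space);
  flow_aut : forall t, is_aut (flow t);
  flow0 : forall x, alg x -> flow 0 x = x;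
  flowD : forall s t x, alg x -> flow (s + t) x = flow s (flow t x);
  flow_cont : forall x, alg x ->
    weakstar_continuous (@alg R bs_space) (fun t : R => flow t x);
  filt_subalg : forall I, is_interval I -> is_subalg (filt I);
  filt_mono : forall I J, is_interval I -> is_interval J ->
    I `<=` J -> filt I `<=` filt J;
  filt_minimal :
    smallest (@is_vN R bs_space)
      (\bigcup_(I in [set I | is_interval I /\ bounded_set (I : set R^o)]) filt I)
    = @alg R bs_space;
  flow_fixed :
    @A0 R bs_space = [set x | alg x /\ forall t, flow t x = x];
  flow_filt : forall t I, is_interval I ->
    flow t @` filt I = filt [set r + t | r in I];
  filt_indep : forall I J, is_interval I -> is_interval J ->
    I `&` J = set0 -> independent (filt I) (filt J) }.

Section BernoulliTheory.
Context {R : realType} (B : bernoulli_shift R).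
Local Notation A := (@alg R B).
Local Notation A0 := (@A0 R B).

Definition e0 : op B :=
  xget (0 : B -> B) (is_proj (closure [set x (Omega B) | x in A0])).

Definition emb (x : op B) : op B := x \o e0.

Definition emod : set (op B) := sot_closure (emb @` A).
Definition emod_at (I : set R) : set (op B) := sot_closure (emb @` filt I).

(* A_0 is identified with A_0 e_0: the A_0-valued inner product, its square
   root and E_0 take their values in A_0 e_0, as operators on the whole
   space. *)
Definition ip0 (x y : op B) : op B := adj x \o y.

Definition abs0 (x : op B) : op B :=
  xget (0 : B -> B) [set p | [/\ BH p, pos_op p & p \o p = ip0 x x]].

Definition norm0 (x : op B) : R := opnorm (abs0 x).

Definition gns_ext (f : op B -> op B) : op B :=
  xget (0 : B -> B)
    [set V | BH V /\ forall x, A x -> V (x (Omega B)) = f x (Omega B)].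

Definition flowE (t : R) (x : op B) : op B := gns_ext (flow t) \o x.

(* The unit of A, seen in E, is e_0. *)
Definition E0E (x : op B) : op B := ip0 (emb idfun) x.

Definition norm0_continuous (b : {nonneg R} -> B -> B) :=
  forall t : halfline R, norm0 (b s - b t) @[s --> t] --> (0 : R).

Definition unitary_cocycle (u : {nonneg R} -> B -> B) :=
  [/\ forall t, A (u t) /\ unitary_op (u t : op B),
      weakstar_continuous A (u : halfline R -> op B),
      forall t, filt [set` `[0, t%:num]] (u t) &
      forall s t, u (s%:num + t%:num)%:nng = flow t%:num (u s) \o u t].

Definition C00_mul : set ({nonneg R} -> B -> B) :=
  [set u | unitary_cocycle u /\ norm0_continuous (fun t => emb (u t))].

Definition additive_cocycle (b : {nonneg R} -> B -> B) :=
  [/\ norm0_continuous b,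
      forall t, emod_at [set` `[0, t%:num]] (b t) &
      forall s t, b (t%:num + s%:num)%:nng = b t + flowE t%:num (b s)].

Definition C00_add : set ({nonneg R} -> B -> B) :=
  [set b | additive_cocycle b /\
    forall t, ip0 (b t - E0E (b t)) (b t - E0E (b t))
              + E0E (b t) + adj (E0E (b t)) = (0 : B -> B)].

(* A partition 0 = t_0 < ... < t_n = t is encoded by the sequence
   Z = [:: t_1; ...; t_n], so that p runs through the pairs
   (t_i, t_{i+1}).  The absolute value only serves to view t_{i+1} - t_i as a
   nonnegative real. *)
Definition Ln_sum (u : {nonneg R} -> B -> B) (Z : seq R) : B -> B :=
  \sum_(p <- zip (0 :: Z) Z)
    flowE p.1 (emb (u (`|p.2 - p.1|)%:nng - idfun)).

(* Convergence along the net of all finite partitions of [0, t] ordered by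
   inclusion; along this net the mesh tends to zero. *)
Definition is_Ln (u : {nonneg R} -> B -> B) (t : {nonneg R}) (x : B -> B) :=
  emod x /\ forall e : R, 0 < e ->
    exists2 Z0, itv_partition 0 t%:num Z0 &
      forall Z, itv_partition 0 t%:num Z -> {subset Z0 <= Z} ->
        norm0 (Ln_sum u Z - x) < e.

Definition Ln (u : {nonneg R} -> B -> B) (t : {nonneg R}) : B -> B :=
  xget (0 : B -> B) (is_Ln u t).

End BernoulliTheory.

Arguments C00_mul {R} B.
Arguments C00_add {R} B.
Arguments Ln {R} B u t.

(* Main.v *)
From HB Require Import structures.
From mathcomp Require Import all_boot all_order all_algebra.
From mathcomp Require Import sesquilinear complex.
From mathcomp Require Import all_classical all_reals all_analysis.
From mathcomp Require Import ring lra.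
Require Import Defs.

Set Implicit Arguments.
Unset Strict Implicit.
Unset Printing Implicit Defensive.

Import Order.TTheory GRing.Theory Num.Theory.
Import numFieldNormedType.Exports.

Local Open Scope classical_set_scope.
Local Open Scope ring_scope.
Local Open Scope complex_scope.

(** Vectors [a Omega] with [a] in [A0] carry all the information: there the
projection [e0] acts as the conditional expectation ([e0_E0]), the norm
given by the [A0]-valued inner product is the operator norm ([norm0E]), and
independence reads
<<
  <m x Omega, y Omega> = <E0(m) x Omega, y Omega>
>>
when [m] belongs to an interval to the right of the interval of [x] and [y],
even if the two share an end point ([touching_dot]).

For a unitary cocycle [u], independence turns the cocycle identity into the
semigroup law for the means [E0(u_t)].  A norm continuous contraction semigroup
is Lipschitz at 0, so that [|E0(u_t) - 1| <= C t] ([mean_rate]); unitarity then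
gives [|(u_t - 1) xi|^2 <= 2 C t |xi|^2] for [xi] in [A0 Omega] ([incr_bound]).

When a partition is refined, the cocycle identity telescopes and the two sums
differ by a sum of products [x_j y_j], where [x_j] is the increment over a fine
interval and [y_j] is the increment from the preceding coarse point up to that
interval.  The increment [x_j] splits into its mean, of the order of the length
of the fine interval, and a martingale difference; [y_j] is of the order of the
square root of the mesh.  Orthogonality of martingale differences bounds the
whole by the square root of the mesh ([refinement_difference]).  Hence the sums
converge, and the limit is local, additive and continuous.  For the quadratic
identity, unitarity of [u_k] gives
[|(u_k - 1) xi|^2 = - 2 Re <(E0(u_k) - 1) xi, xi>], and adding these equalities
over a partition gives the identity for the sums up to an error of the order of
the mesh ([incr_sum_quad]).

For injectivity, let [u] and [v] have the same limit [b].  The partition of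
[[0, h]] into a single interval shows that [u_h - 1] and [v_h - 1] agree with
[b_h] up to [O(h)] and, after compression by [e0], up to [O(h^(3/2))].  It
follows that [c_h = E0(u_h^* v_h)] is [1 + O(h^(3/2))].  By independence
[c_(s+t) - c_t] is at most [c_s - 1] in norm, so cutting [[0, t]] into [n] equal
pieces gives [c_t = 1 + O(n^(-1/2))] on [Omega].  Thus [c_t Omega = Omega],
which forces [u_t Omega = v_t Omega] and, [Omega] being separating, [u_t = v_t]
([cocycle_inj]). *)

(** * Real inner products on a Hilbert space *)

Section RealHilbert.
Context {R : realType} {H : hilbertType R}.
Implicit Types (x y z : H) (a : R).

(** The norm and the inner product have values in [R[i]], which is only partially
ordered; their real parts lie in the ordered field [R]. *)
Definition rn x : R := complex.Re `|x|.
Definition rd x y : R := complex.Re (hdot H x y).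

Lemma rnE x : (rn x)%:C = `|x|.
Proof. by rewrite /rn RRe_real// ger0_real. Qed.

Lemma rn_ge0 x : 0 <= rn x.
Proof. by rewrite -ler0c rnE. Qed.

Lemma hdotC x y : hdot H x y = (hdot H y x)^*.
Proof.
have /= -> := @hermC _ _ _ _ (hdot H) x y.
by rewrite expr0 mul1r.
Qed.

Lemma rdC x y : rd x y = rd y x.
Proof. by rewrite /rd hdotC; case: (hdot H y x). Qed.

Lemma rdDl x y z : rd (x + y) z = rd x z + rd y z.
Proof. by rewrite /rd linearDl raddfD. Qed.

Lemma rdZl a x z : rd (a%:C *: x) z = a * rd x z.
Proof. by rewrite /rd linearZl_LR /=; case: (hdot H x z) => p q /=;
  rewrite mul0r subr0. Qed.

Lemma rn_sq x : rn x ^+ 2 = rd x x.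
Proof. by rewrite /rd hdotE -rnE -rmorphXn. Qed.

(** It follows that identities between operators can be tested on real parts. *)
Lemma hdot_rd x y : hdot H x y = rd x y +i* rd x ('i%C *: y).
Proof.
rewrite /rd (linearZr_LR (hdot H)) /=.
case: (hdot H x y) => p q /=; congr (_ +i* _).
by rewrite /=; lra.
Qed.

Lemma closureP_rn (D : set H) x :
  closure D x <-> forall e : R, 0 < e -> exists2 y, D y & rn (x - y) < e.
Proof.
split=> [Dx e e0|Dx B].
  have /Dx[y [Dy]] : nbhs x (ball x e%:C) by apply: nbhsx_ballx; rewrite ltcR.
  by rewrite -ball_normE /= -rnE ltcR => ?; exists y.
rewrite -nbhs_ballE => -[e /= e0 xB].
have er : e = (complex.Re e)%:C by rewrite RRe_real// gtr0_real.
have [|y Dy xy] := Dx (complex.Re e); first by rewrite -ltcR -er.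
by exists y; split => //; apply: xB; rewrite -ball_normE /= -rnE er ltcR.
Qed.

Lemma rn_complete (f : nat -> H) :
  (forall e : R, 0 < e -> exists N, forall n m, (N <= n)%N -> (N <= m)%N ->
     rn (f n - f m) < e) ->
  exists l, forall e : R, 0 < e -> exists N, forall n, (N <= n)%N -> rn (f n - l) < e.
Proof.
move=> fC.
have /cauchy_cvgP fl : cauchy (f n @[n --> \oo]).
  apply/cauchy_ballP => e e0.
  have er : e = (complex.Re e)%:C by rewrite RRe_real// gtr0_real.
  have [|N HN] := fC (complex.Re e); first by rewrite -ltcR -er.
  exists (f @` [set n | (N <= n)%N], f @` [set n | (N <= n)%N]).
    by split; exists N => // n /= Nn; exists n.
  move=> [_ _] [[n /= Nn <-] [m /= Nm <-]].
  by rewrite -ball_normE /= -rnE er ltcR HN.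
exists (lim (f n @[n --> \oo])) => e e0.
have /cvgrPdist_lt/(_ e%:C) := fl.
case; first by rewrite ltcR.
move=> N _ HN; exists N => n /HN /=.
by rewrite distrC -rnE ltcR.
Qed.

Lemma rdNl x y : rd (- x) y = - rd x y.
Proof. by rewrite /rd linearNl raddfN. Qed.
Lemma rdBl x y z : rd (x - y) z = rd x z - rd y z.
Proof. by rewrite rdDl rdNl. Qed.
Lemma rdDr x y z : rd z (x + y) = rd z x + rd z y.
Proof. by rewrite rdC rdDl !(rdC _ z). Qed.
Lemma rdNr x y : rd x (- y) = - rd x y.
Proof. by rewrite rdC rdNl rdC. Qed.
Lemma rdBr x y z : rd z (x - y) = rd z x - rd z y.
Proof. by rewrite rdDr rdNr. Qed.
Lemma rdZr a x z : rd z (a%:C *: x) = a * rd z x.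
Proof. by rewrite rdC rdZl rdC. Qed.
Lemma rd0l x : rd 0 x = 0.
Proof. by rewrite /rd linear0l. Qed.
Lemma rd0r x : rd x 0 = 0.
Proof. by rewrite rdC rd0l. Qed.

Definition rdE := (rdDl, rdDr, rdBl, rdBr, rdNl, rdNr, rdZl, rdZr, rd0l, rd0r).

Lemma rd_il x y : rd ('i%C *: x) y = - rd x ('i%C *: y).
Proof.
rewrite /rd (linearZr_LR (hdot H)) (linearZl_LR (hdot H)) /=.
by case: (hdot H x y) => p q /=; lra.
Qed.

Lemma rn0_eq x : rn x = 0 -> x = 0.
Proof. by move=> x0; apply/normr0_eq0; rewrite -rnE x0. Qed.

Lemma rn0 : rn (0 : H) = 0.
Proof. by rewrite /rn normr0. Qed.

Lemma rd_inj x y : (forall z, rd x z = rd y z) -> x = y.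
Proof.
move=> xy; apply/eqP; rewrite -subr_eq0; apply/eqP/rn0_eq/eqP.
by rewrite -sqrf_eq0 rn_sq {1}rdBl xy subrr.
Qed.

Lemma rnD x y : rn (x + y) <= rn x + rn y.
Proof. by rewrite -lecR rmorphD /= !rnE ler_normD. Qed.

Lemma rnN x : rn (- x) = rn x.
Proof. by rewrite /rn normrN. Qed.

Lemma rn_distC x y : rn (x - y) = rn (y - x).
Proof. by rewrite -rnN opprB. Qed.

Lemma rnB_le x y : rn (x - y) <= rn x + rn y.
Proof. by rewrite -(rnN y) rnD. Qed.

Lemma rn_trid x y z : rn (x - z) <= rn (x - y) + rn (y - z).
Proof. by rewrite (le_trans _ (rnD _ _))// addrA subrK. Qed.

Lemma rnZ (c : R[i]) x : rn (c *: x) = complex.Re `|c| * rn x.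
Proof.
rewrite /rn normrZ -(rnE x).
have -> : `|c| = (complex.Re `|c|)%:C by rewrite RRe_real// ger0_real.
by rewrite -rmorphM.
Qed.

Lemma Re_norm_ge0 (c : R[i]) : 0 <= complex.Re `|c|.
Proof. by rewrite -ler0c RRe_real// ger0_real. Qed.

Lemma rnZr a x : rn (a%:C *: x) = `|a| * rn x.
Proof. by rewrite rnZ normc_def /= expr0n addr0 sqrtr_sqr. Qed.

Lemma rn_sqD x y : rn (x + y) ^+ 2 = rn x ^+ 2 + 2 * rd x y + rn y ^+ 2.
Proof. by rewrite !rn_sq !rdE (rdC y x); lra. Qed.

Lemma rn_sqB x y : rn (x - y) ^+ 2 = rn x ^+ 2 - 2 * rd x y + rn y ^+ 2.
Proof. by rewrite !rn_sq !rdE (rdC y x); lra. Qed.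

Lemma rd_le x y : rd x y <= rn x * rn y.
Proof.
have [/eqP/rn0_eq ->|x0] := boolP (rn x == 0).
  by rewrite rd0l mulr_ge0// rn_ge0.
have [/eqP/rn0_eq ->|y0] := boolP (rn y == 0).
  by rewrite rd0r mulr_ge0// rn_ge0.
have p : 0 < rn x * rn y.
  by rewrite mulr_gt0// lt_neqAle eq_sym ?x0 ?y0 rn_ge0.
have := sqr_ge0 (rn ((rn y)%:C *: x - (rn x)%:C *: y)).
rewrite rn_sqB !rnZr !rdE !ger0_norm ?rn_ge0// => h.
rewrite -(ler_pM2l p); nra.
Qed.

Lemma rd_ge x y : - (rn x * rn y) <= rd x y.
Proof. by rewrite lerNl -rdNl (le_trans (rd_le _ _))// rnN. Qed.

Lemma rd_abs x y : `|rd x y| <= rn x * rn y.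
Proof. by rewrite ler_norml rd_ge rd_le. Qed.

Lemma rn_le_rd x C : (0 <= C) -> (forall y, rd x y <= C * rn y) -> rn x <= C.
Proof.
move=> C0 /(_ x); rewrite -rn_sq expr2 => h.
have [x0|] := ltP 0 (rn x); first by rewrite -(ler_pM2r x0).
by move/le_trans; apply.
Qed.

Lemma le_eps (p q : R) : (forall e : R, 0 < e -> p <= q + e) -> p <= q.
Proof. by move=> h; apply/ler_addgt0Pr. Qed.

Lemma rn_eps x : (forall e : R, 0 < e -> rn x <= e) -> x = 0.
Proof.
move=> h; apply: rn0_eq; apply/eqP; rewrite eq_le rn_ge0 andbT.
by apply: le_eps => e /h; rewrite add0r.
Qed.

Lemma inv_small (e : R) : 0 < e -> exists N, forall n, (N <= n)%N -> n.+1%:R^-1 < e :> R.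
Proof.
move=> e0; exists (Num.truncn e^-1).+1 => n Nn.
rewrite invf_plt ?posrE//.
have := truncnS_gt e^-1 => /lt_le_trans; apply.
by rewrite ler_nat (leq_trans Nn).
Qed.

Implicit Types T : op H.

Lemma linD T : linear T -> forall x y, T (x + y) = T x + T y.
Proof. by move=> l x y; have := l 1 x y; rewrite !scale1r. Qed.
Lemma lin0 T : linear T -> T 0 = 0.
Proof. by move=> l; have := l (-1) 0 0; rewrite !scaleN1r oppr0 addr0 addNr. Qed.
Lemma linZ T : linear T -> forall (c : R[i]) x, T (c *: x) = c *: T x.
Proof. by move=> l c x; have := l c x 0; rewrite (lin0 l) !addr0. Qed.
Lemma linN T : linear T -> forall x, T (- x) = - T x.
Proof. by move=> l x; rewrite -scaleN1r (linZ l) scaleN1r. Qed.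
Lemma linB T : linear T -> forall x y, T (x - y) = T x - T y.
Proof. by move=> l x y; rewrite (linD l) (linN l). Qed.

Definition bounded_by (C : R) T := forall x, rn (T x) <= C * rn x.

(** Continuity at 0 gives a ball that is mapped into the unit ball; homogeneity
turns it into a bound. *)
Lemma BHP T : BH T <-> linear T /\ exists2 C, 0 <= C & bounded_by C T.
Proof.
split=> [[l c]|[l [C C0 CT]]]; split=> //.
  have /cvgrPdist_lt/(_ 1 ltr01) : T x @[x --> 0] --> T 0 by exact: c.
  rewrite (lin0 l) /= => /nbhs_ballP[e /= e0].
  have er : e = (complex.Re e)%:C by rewrite RRe_real// gtr0_real.
  set d := complex.Re e in er; rewrite er ltcR in e0 * => dT.
  have {}dT x : rn x < d -> rn (T x) < 1.
    move=> xd; have /dT : ball (0 : H) d%:C x.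
      by rewrite -ball_normE /= sub0r normrN -rnE ltcR.
    by rewrite /= sub0r normrN -rnE -[1]/(1%:C) ltcR.
  exists (2 / d); first by rewrite divr_ge0// ltW.
  move=> x; have [/eqP/rn0_eq ->|x0] := boolP (rn x == 0).
    by rewrite (lin0 l) rn0 mulr0.
  have xp : 0 < rn x by rewrite lt_neqAle eq_sym x0 rn_ge0.
  (* Rescale [x] to the norm [d / 2]. *)
  have k0 : 0 < d / (2 * rn x) by rewrite divr_gt0 ?mulr_gt0.
  have /dT : rn ((d / (2 * rn x))%:C *: x) < d.
    rewrite rnZr gtr0_norm//.
    have -> : d / (2 * rn x) * rn x = d / 2 by field.
    by rewrite ltr_pdivrMr// ltr_pMr// ltr1n.
  rewrite (linZ l) rnZr gtr0_norm// mulrC -ltr_pdivlMr// mul1r invfM.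
  by rewrite invrK => /ltW/le_trans; apply; rewrite mulrC -!mulrA (mulrC (rn x)) mulrA.
move=> x; apply/cvgrPdist_lt => e e0.
have er : e = (complex.Re e)%:C by rewrite RRe_real// gtr0_real.
rewrite er ltcR in e0.
have C1 : 0 < C + 1 by rewrite ltr_wpDl.
near=> y.
rewrite -(linB l) -rnE er ltcR (le_lt_trans (CT _))//.
have : rn (x - y) < complex.Re e / (C + 1).
  rewrite -ltcR rnE; near: y; apply: (@cvgr_dist_lt _ _ _ _ _ id) => //.
  by rewrite ltcR divr_gt0.
rewrite ltr_pdivlMr// mulrC => /(le_lt_trans _); apply.
by rewrite ler_wpM2r ?rn_ge0// lerDl.
Unshelve. all: by end_near. Qed.

End RealHilbert.

(** * Riesz representation, projections and adjoints *)

Section Representer.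
Context {R : realType} {H : hilbertType R}.
Implicit Types (x y z k : H) (K : set H) (T : op H).

(** The representing vector minimizes [|x|^2 - 2 f(x)] over [K]: the
parallelogram law makes minimizing sequences Cauchy, and a variation in the
direction [k] gives the equation.  The functional [rd _ x] yields the projection
onto [K], and [rd (T _) y] the adjoint of [T]. *)
Lemma riesz_real K (f : H -> R) (C : R) :
  K 0 -> (forall a x y, K x -> K y -> K (a%:C *: x + y)) -> closure K `<=` K ->
  (forall x y, f (x + y) = f x + f y) -> (forall a x, f (a%:C *: x) = a * f x) ->
  0 <= C -> (forall x, f x <= C * rn x) ->
  exists2 z, K z & forall k, K k -> f k = rd k z.
Proof.
move=> K0 KP Kc fD fZ C0 fC.
pose J x := rn x ^+ 2 - 2 * f x.
have Jge x : - (C ^+ 2) <= J x.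
  have := fC x; have := sqr_ge0 (rn x - C); rewrite /J; nra.
pose m := inf [set J x | x in K].
have hI : has_inf [set J x | x in K].
  split; first by exists (J 0), 0.
  by exists (- (C ^+ 2)) => _ [x Kx <-].
have mJ x : K x -> m <= J x.
  by move=> Kx; apply: (ge_inf hI.2); exists x.
have /choice[s sP] n : exists x, K x /\ J x < m + n.+1%:R^-1.
  have [|_ [x Kx <-] xm] := inf_adherent _ hI (eps := n.+1%:R^-1).
    by rewrite invr_gt0.
  by exists x.
(* The functional [J] is at least [m] at the midpoint of [x] and [y]. *)
have par x y e : K x -> K y -> J x < m + e -> J y < m + e ->
    rn (x - y) ^+ 2 <= 4 * e.
  move=> Kx Ky Jx Jy.
  have Kw : K ((1/2)%:C *: x + (1/2)%:C *: y).
    by apply: (KP) => //; rewrite -[_ *: y]addr0; apply: KP.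
  have := mJ _ Kw; rewrite rn_sqB /J in Jx Jy *.
  rewrite rn_sqD !rnZr !rdE !fD !fZ [`|1 / 2|]ger0_norm//; nra.
have [z zP] : exists z, forall e : R, 0 < e ->
    exists N, forall n, (N <= n)%N -> rn (s n - z) < e.
  apply: rn_complete => e e0.
  have [|N HN] := @inv_small R (e ^+ 2 / 8); first by rewrite divr_gt0// exprn_gt0.
  exists N => n p /HN nN /HN pN.
  have [[Kn Jn] [Kp Jp]] := (sP n, sP p).
  have h : rn (s n - s p) ^+ 2 <= 4 * (e ^+ 2 / 8).
    by apply: par => //; [apply: lt_trans Jn _|apply: lt_trans Jp _]; rewrite ltrD2l.
  rewrite -(@ltr_pXn2r _ 2%N)// ?nnegrE ?rn_ge0 ?ltW//.
  by apply: (le_lt_trans h); have := exprn_gt0 2 e0; nra.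
have Kz : K z.
  apply/Kc/closureP_rn => e /zP[N /(_ N (leqnn _)) h].
  by exists (s N); [case: (sP N)|rewrite rn_distC].
exists z => // k Kk.
suff D0 t : 0 <= 2 * t * (rd k z - f k) + t ^+ 2 * rn k ^+ 2.
  set D := rd k z - f k in D0.
  suff /eqP : D = 0 by rewrite subr_eq0 => /eqP.
  (* At this [t] the polynomial is negative unless [D = 0]. *)
  have := D0 (- D / (rn k ^+ 2 + 1)).
  set N := rn k ^+ 2.
  have N1 : 0 < N + 1 by rewrite ltr_wpDl// exprn_ge0// rn_ge0.
  have N0 : 0 <= N by rewrite exprn_ge0// rn_ge0.
  have -> : 2 * (- D / (N + 1)) * D + (- D / (N + 1)) ^+ 2 * N
     = - (D ^+ 2 * (N + 2) / (N + 1) ^+ 2) by field; rewrite lt0r_neq0.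
  rewrite oppr_ge0 pmulr_lle0 ?invr_gt0 ?exprn_gt0//.
  rewrite pmulr_lle0 ?ltr_wpDl// => h.
  by apply/eqP; rewrite -sqrf_eq0 eq_le h sqr_ge0.
apply: le_eps => e e0.
have e1 : 0 < e / 2 / (`|t| * rn k + 1) / 2.
  by rewrite !divr_gt0// ltr_wpDl// mulr_ge0// rn_ge0.
have [N1 h1] := zP _ e1.
have [|N2 h2] := @inv_small R (e / 2); first by rewrite divr_gt0.
pose n := maxn N1 N2.
have {}h1 := h1 n (leq_maxl _ _); have {}h2 := h2 n (leq_maxr _ _).
have [Kn Jn] := sP n.
have := mJ _ (KP t _ _ Kk Kn); move: Jn; rewrite /J rn_sqD rnZr !rdE fD fZ.
rewrite exprMn real_normK ?num_real// => Jn Jk.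
have b : 2 * t * (rd k (s n) - rd k z) <= e / 2.
  rewrite -rdBr; apply: le_trans (ler_norm _) _.
  rewrite !normrM [`|2|]ger0_norm//.
  have T0 := normr_ge0 t; have k0 := rn_ge0 k; have s0 := rn_ge0 (s n - z).
  have h3 := rd_abs k (s n - z).
  have P1 : 0 < `|t| * rn k + 1 by rewrite ltr_wpDl// mulr_ge0.
  move: h1; rewrite ltr_pdivlMr// ltr_pdivlMr// => h1.
  have h4 : `|t| * `|rd k (s n - z)| <= `|t| * (rn k * rn (s n - z)).
    by rewrite ler_wpM2l.
  nra.
rewrite !mulrBr -!mulrA in b *.
move: (rd k (s n)) (rd k z) (f k) (rn k ^+2) (rn (s n) ^+2) (f (s n)) (n.+1%:R^-1) h2
  Jn b Jk => a1 a2 a3 a4 a5 a6 a7.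
clear -e0.
lra.
Qed.

Definition closed_subspace K :=
  [/\ K 0, forall c x y, K x -> K y -> K (c *: x + y) & closure K `<=` K].

Lemma rdZc (c : R[i]) x y : rd (c *: x) y = rd x (c^*%C *: y).
Proof.
rewrite /rd (linearZr_LR (hdot H)) (linearZl_LR (hdot H)) /=.
by case: c => a b; case: (hdot H x y) => p q /=; lra.
Qed.

(** Linearity of [T] moves the factor [i] from one side to the other, which
settles the imaginary part. *)
Lemma is_adj_rd T T' : linear T ->
  (forall x y, rd (T x) y = rd x (T' y)) -> is_adj T T'.
Proof.
move=> l h x y; rewrite !hdot_rd h; congr (_ +i* _).
by rewrite -[LHS]opprK -rd_il -(linZ l) h rd_il opprK.
Qed.

Lemma is_adjP T T' : is_adj T T' -> forall x y, rd (T x) y = rd x (T' y).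
Proof. by move=> h x y; rewrite /rd h. Qed.

Lemma projection K : closed_subspace K -> exists p, is_proj K p.
Proof.
move=> [K0 KP Kc].
have /choice[p pP] x : exists y, K y /\ forall k, K k -> rd k x = rd k y.
  have [| | | | |y] := @riesz_real K (fun k => rd k x) (rn x) K0 _ Kc.
  - by move=> *; apply: KP.
  - by move=> *; rewrite rdE.
  - by move=> *; rewrite rdE.
  - exact: rn_ge0.
  - by move=> y; rewrite mulrC rd_le.
  - by move=> Ky h; exists y.
have Kp x : K (p x) by case: (pP x).
have pr x k : K k -> rd k x = rd k (p x) by case: (pP x) => _; apply.
have KB x y : K x -> K y -> K (x - y).
  by move=> Kx Ky; rewrite -scaleN1r addrC; apply: KP.
have pu x y : K y -> (forall k, K k -> rd k x = rd k y) -> p x = y.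
  move=> Ky h; apply/eqP; rewrite -subr_eq0; apply/eqP/rn0_eq/eqP.
  rewrite -sqrf_eq0 rn_sq rdBr -pr ?h ?subrr//; exact: KB.
have pl : linear p.
  move=> c x y; apply: pu; first exact: KP.
  move=> k Kk; rewrite !rdDr -(conjcK c) -!rdZc -!pr//.
  by rewrite -[_ *: k]addr0; apply: KP.
have pK y : K y -> p y = y by move=> Ky; apply: pu.
have padj x y : rd (p x) y = rd x (p y).
  by rewrite (pr y)// [in RHS]rdC [in RHS](pr x)// rdC.
exists p; split.
- apply/BHP; split=> //; exists 1 => // x; rewrite mul1r.
  apply: rn_le_rd; first exact: rn_ge0.
  move=> y; rewrite padj (le_trans (rd_le _ _))// ler_wpM2l ?rn_ge0//.
  have := rd_le (p y) y; rewrite [X in X <= _](pr y)// -rn_sq expr2.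
  have [y0|] := ltP 0 (rn (p y)); first by rewrite ler_pM2l.
  by move=> h _; rewrite (le_trans h)// rn_ge0.
- by apply/funext => x /=; rewrite pK.
- exact: is_adj_rd.
- by apply/seteqP; split=> [_ [x _ <-]//|y Ky]; exists y => //; rewrite pK.
Qed.

Lemma adj_unique T T1 T2 : is_adj T T1 -> is_adj T T2 -> T1 = T2.
Proof.
move=> h1 h2; apply/funext => y; apply: rd_inj => x.
by rewrite rdC -(is_adjP h1) (is_adjP h2) rdC.
Qed.

Lemma adj_exists T : BH T -> exists2 T', is_adj T T' & BH T'.
Proof.
move=> /BHP[l [C C0 CT]].
have /choice[T' T'P] y : exists z, forall k, rd (T k) y = rd k z.
  have [| | | | | | |z] := @riesz_real setT (fun k => rd (T k) y) (C * rn y) => //.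
  - by move=> *; rewrite (linD l) rdE.
  - by move=> *; rewrite (linZ l) rdE.
  - by rewrite mulr_ge0// rn_ge0.
  - move=> x; rewrite (le_trans (rd_le _ _))// mulrAC ler_wpM2r ?rn_ge0//.
  - by move=> _ h; exists z => k; rewrite h.
exists T'; first exact: is_adj_rd.
apply/BHP; split.
  move=> c x y; apply/rd_inj => z; rewrite [LHS]rdC [RHS]rdC.
  rewrite -T'P !rdDr -(conjcK c) -!rdZc -(linZ l).
  by rewrite !T'P.
exists C => // x; apply: rn_le_rd; first by rewrite mulr_ge0// rn_ge0.
move=> y; rewrite rdC -T'P (le_trans (rd_le _ _))// mulrAC ler_wpM2r ?rn_ge0//.
Qed.

Lemma adjE T T' : is_adj T T' -> adj T = T'.
Proof.
move=> h; apply: (@adj_unique T) => //.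
by apply: (@xgetPex _ _ [set T' | is_adj T T']); exists T'.
Qed.

Lemma adjP T : BH T -> is_adj T (adj T).
Proof. by move=> /adj_exists[T' h _]; rewrite (adjE h). Qed.

Lemma BH_adj T : BH T -> BH (adj T).
Proof. by move=> /adj_exists[T' h]; rewrite (adjE h). Qed.

Lemma rd_adj T x y : BH T -> rd (T x) y = rd x (adj T y).
Proof. by move=> /adjP/is_adjP. Qed.

Lemma rd_adjr T x y : BH T -> rd x (T y) = rd (adj T x) y.
Proof. by move=> bT; rewrite rdC rd_adj// rdC. Qed.

Lemma BH_linear T : BH T -> linear T. Proof. by case. Qed.

Lemma adj_rd T T' : BH T -> (forall x y, rd (T x) y = rd x (T' y)) -> adj T = T'.
Proof. by move=> /BH_linear l h; apply/adjE/is_adj_rd. Qed.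

Lemma adjK T : BH T -> adj (adj T) = T.
Proof. by move=> bT; apply: adj_rd => [|x y]; [exact: BH_adj|rewrite -rd_adjr]. Qed.

Lemma BH_comp T T' : BH T -> BH T' -> BH (T \o T').
Proof.
move=> /BHP[l [C C0 CT]] /BHP[l' [C' C'0 CT']]; apply/BHP; split.
  by move=> c x y; rewrite /= l' l.
exists (C * C'); first exact: mulr_ge0.
by move=> x /=; rewrite (le_trans (CT _))// -mulrA ler_wpM2l.
Qed.

Lemma adj_comp T T' : BH T -> BH T' -> adj (T \o T') = adj T' \o adj T.
Proof.
move=> bT bT'; apply: adj_rd; first exact: BH_comp.
by move=> x y /=; rewrite !rd_adj.
Qed.

Lemma BH_lc (c : R[i]) T T' : BH T -> BH T' -> BH (c *: (T : H -> H) + T').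
Proof.
move=> /BHP[l [C C0 CT]] /BHP[l' [C' C'0 CT']]; apply/BHP; split.
  move=> d x y; rewrite !fctE l l' !scalerDr !scalerA (mulrC c).
  by rewrite -!addrA; congr (_ + _); rewrite addrCA.
exists (complex.Re `|c| * C + C'); first by rewrite addr_ge0// mulr_ge0// Re_norm_ge0.
move=> x; rewrite !fctE (le_trans (rnD _ _))// mulrDl lerD// rnZ -mulrA.
by rewrite ler_wpM2l// Re_norm_ge0.
Qed.

Lemma BH_id : BH (idfun : op H).
Proof. by apply/BHP; split => //; exists 1 => // x; rewrite mul1r. Qed.

Lemma fun0E x : (0 : H -> H) x = 0. Proof. by []. Qed.

Lemma BH_add T T' : BH T -> BH T' -> BH ((T : H -> H) + T').
Proof. by move=> bT bT'; rewrite -[X in BH (X + _)]scale1r; apply: BH_lc. Qed.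

Lemma BH_sub T T' : BH T -> BH T' -> BH ((T : H -> H) - T').
Proof. by move=> bT bT'; rewrite addrC -scaleN1r; apply: BH_lc. Qed.

End Representer.

(** A linear identity between vectors becomes, when tested against an arbitrary
vector, a linear identity between real numbers. *)
Ltac vec := apply: rd_inj => ?; do 8 rewrite ?rdE 1?rdZc; lra.

(** * Operator norm and polarization *)

Section OperatorNorm.
Context {R : realType} {H : hilbertType R}.
Implicit Types (x y z k : H) (K : set H) (T : op H).

Lemma opnormE T : opnorm T = sup [set rn (T x) | x in [set x | rn x <= 1]].
Proof.
rewrite /opnorm; congr sup; apply/seteqP; split=> _ [x /= x1 <-]; exists x => //=.
  by rewrite -lecR rnE.
by rewrite -rnE -[1]/(1%:C) lecR.
Qed.

Lemma opnorm_le T (C : R) : 0 <= C -> bounded_by C T -> opnorm T <= C.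
Proof.
move=> C0 CT; rewrite opnormE; apply: ge_sup.
  by exists (rn (T 0)), 0 => //=; rewrite rn0.
move=> _ [x /= x1 <-]; rewrite (le_trans (CT x))//.
by rewrite -[leRHS]mulr1 ler_wpM2l.
Qed.

Lemma opnorm_bound T : BH T -> bounded_by (opnorm T) T.
Proof.
move=> /BHP[l [C C0 CT]] x; rewrite opnormE.
have [/eqP/rn0_eq ->|x0] := boolP (rn x == 0).
  by rewrite (lin0 l) rn0 mulr0.
have xp : 0 < rn x by rewrite lt_neqAle eq_sym x0 rn_ge0.
rewrite -ler_pdivrMr//; apply: ub_le_sup.
  exists C => _ [y /= y1 <-]; rewrite (le_trans (CT y))//.
  by rewrite -[leRHS]mulr1 ler_wpM2l.
exists ((rn x)^-1%:C *: x) => /=.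
  by rewrite rnZr ger0_norm ?invr_ge0 ?rn_ge0// mulVf.
by rewrite (linZ l) rnZr ger0_norm ?invr_ge0 ?rn_ge0// mulrC.
Qed.

Lemma opnorm_ge0 T : BH T -> 0 <= opnorm T.
Proof.
move=> bT; have [C C0 CT] : exists2 C, 0 <= C & bounded_by C T by case/BHP: bT.
rewrite opnormE; apply: (@le_trans _ _ (rn (T 0))); first exact: rn_ge0.
apply: ub_le_sup; last by exists 0 => //=; rewrite rn0.
exists C => _ [y /= y1 <-]; rewrite (le_trans (CT y))//.
by rewrite -[leRHS]mulr1 ler_wpM2l.
Qed.

Lemma opnorm_eq T T' : (forall x, rn (T x) = rn (T' x)) -> opnorm T = opnorm T'.
Proof. by move=> h; rewrite !opnormE; congr sup; apply: eq_imagel => x _; rewrite h. Qed.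

Lemma opnorm_eps T : BH T -> (forall e : R, 0 < e -> opnorm T <= e) -> T = 0 :> (H -> H).
Proof.
move=> bT h; apply/funext => x; apply: rn_eps => e e0.
have x1 : 0 < rn x + 1 by rewrite ltr_wpDl// rn_ge0.
rewrite (le_trans (opnorm_bound bT x))//.
rewrite (@le_trans _ _ (e / (rn x + 1) * rn x))//.
  by rewrite ler_wpM2r ?rn_ge0// h// divr_gt0.
by rewrite mulrAC ler_pdivrMr// ler_wpM2l ?lerDl//; exact: ltW.
Qed.

(** Pointwise limits exist by completeness, and they inherit linearity and the
uniform estimate from the sequence. *)
Lemma op_complete (T : nat -> op H) : (forall n, BH (T n)) ->
  (forall e : R, 0 < e -> exists N, forall n m, (N <= n)%N -> (N <= m)%N ->
     bounded_by e ((T n : H -> H) - T m)) ->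
  exists2 L, BH L & forall e : R, 0 < e -> exists N, forall n, (N <= n)%N ->
     bounded_by e ((T n : H -> H) - L).
Proof.
move=> bT TC.
have /choice[L LP] x : exists l, forall e : R, 0 < e ->
    exists N, forall n, (N <= n)%N -> rn (T n x - l) < e.
  apply: rn_complete => e e0.
  have x1 : 0 < rn x + 1 by rewrite ltr_wpDl// rn_ge0.
  have [|N HN] := TC (e / (rn x + 1)); first exact: divr_gt0.
  exists N => n m Nn Nm; rewrite (le_lt_trans (HN _ _ Nn Nm x))//.
  by rewrite mulrAC ltr_pdivrMr// ltr_pM2l// ltrDl.
have Lb (e : R) : 0 < e -> exists N, forall n, (N <= n)%N ->
     bounded_by e ((T n : H -> H) - L).
  move=> e0; have [N HN] := TC e e0; exists N => n Nn x.
  apply: le_eps => d d0; have [M /(_ (maxn M N) (leq_maxl _ _)) HM] := LP x d d0.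
  apply: le_trans (rn_trid _ (T (maxn M N) x) _) _.
  by apply: lerD; [exact: (HN _ _ Nn (leq_maxr _ _) x)|exact: ltW].
exists L => //.
have Ll : linear L.
  move=> c x y; apply/eqP; rewrite -subr_eq0; apply/eqP/rn_eps => e e0.
  pose d := e / (rn (c *: x + y) + (complex.Re `|c| * rn x + rn y) + 1).
  have D0 : 0 < rn (c *: x + y) + (complex.Re `|c| * rn x + rn y) + 1.
    by rewrite ltr_wpDl// !addr_ge0 ?mulr_ge0 ?rn_ge0 ?Re_norm_ge0.
  have d0 : 0 < d by rewrite divr_gt0.
  have [N /(_ N (leqnn _)) HN] := Lb d d0.
  have -> : L (c *: x + y) - (c *: L x + L y) =
    (c *: (T N x - L x) + (T N y - L y)) - (T N (c *: x + y) - L (c *: x + y)).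
    rewrite (BH_linear (bT N)).
    by vec.
  apply: le_trans (rnB_le _ _) _.
  apply: le_trans (lerD (rnD _ _) (HN _)) _.
  rewrite rnZ; have h1 := HN x; have h2 := HN y.
  have h3 : complex.Re `|c| * rn (T N x - L x) <= complex.Re `|c| * (d * rn x).
    by rewrite ler_wpM2l// Re_norm_ge0.
  apply: le_trans (lerD (lerD h3 h2) (lexx _)) _.
  have -> : e = d * (rn (c *: x + y) + (complex.Re `|c| * rn x + rn y) + 1).
    by rewrite /d mulfVK// gt_eqF.
  lra.
apply/BHP; split => //.
have [N /(_ N (leqnn _)) HN] := Lb 1 ltr01.
have [C C0 CT] : exists2 C, 0 <= C & bounded_by C (T N) by case/BHP: (bT N).
exists (C + 1); first by rewrite addr_ge0.
move=> x; have -> : L x = T N x - (T N x - L x) by rewrite opprB addrC subrK.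
by rewrite mulrDl; apply: le_trans (rnB_le _ _) (lerD (CT x) (HN x)).
Qed.

(** Polarization of the vanishing imaginary part of [<T x, x>]. *)
Lemma pos_selfadj T : linear T -> pos_op T -> forall x y, rd (T x) y = rd x (T y).
Proof.
move=> l pT.
have im0 x : rd (T x) ('i%C *: x) = 0.
  by have := ger0_Im (pT x); rewrite hdot_rd.
have pol x y : rd (T x) ('i%C *: y) = rd (T ('i%C *: y)) x.
  have := im0 (x + y); rewrite (linD l) scalerDr !rdE !im0 addr0 add0r.
  move/eqP; rewrite addr_eq0 => /eqP ->.
  by rewrite -rd_il -(linZ l).
move=> x y; have := pol x (- 'i%C *: y).
rewrite scalerA mulrN -expr2 sqr_i opprK scale1r => ->; exact: rdC.
Qed.

Lemma selfadj_pos T : linear T -> (forall x y, rd (T x) y = rd x (T y)) ->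
  (forall x, 0 <= rd (T x) x) -> pos_op T.
Proof.
move=> l sT pT x; rewrite hdot_rd lecE /= pT andbT.
suff : rd (T x) ('i%C *: x) = - rd (T x) ('i%C *: x) by move=> h; apply/eqP; lra.
by rewrite {1}sT (linZ l) rdC rd_il.
Qed.

Lemma quad_form0 T : (forall x y, rd (T x) y = rd x (T y)) -> linear T ->
  (forall x, rd (T x) x = 0) -> T = 0 :> (H -> H).
Proof.
move=> sT l T0; apply/funext => x; apply: rd_inj => y; rewrite fun0E rd0l.
have := T0 (x + y); rewrite (linD l) !rdE !T0 (sT y) (rdC y) => h; lra.
Qed.

End OperatorNorm.

(** * Square roots of positive operators *)

Section SquareRoot.
Context {R : realType} {H : hilbertType R}.
Implicit Types (x y z k : H) (K : set H) (T : op H).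

(** By polarization [4 rd (T x) y] is the difference of the quadratic forms at
[x + y] and [x - y], which the parallelogram law bounds by
[2 q (|x|^2 + |y|^2)]. *)
Lemma selfadj_bound T (q : R) : linear T -> (forall x y, rd (T x) y = rd x (T y)) ->
  (forall x, `|rd (T x) x| <= q * rn x ^+ 2) -> bounded_by q T.
Proof.
move=> l sT qT.
have key x y : 2 * rd (T x) y <= q * (rn x ^+ 2 + rn y ^+ 2).
  have := le_trans (ler_norm _) (qT (x + y)).
  have := qT (x - y); rewrite -normrN => /(le_trans (ler_norm _)).
  rewrite rn_sqB (linB l) !rdE => h1.
  rewrite rn_sqD (linD l) !rdE => h2.
  move: h1 h2; rewrite (sT y) (rdC y) => h1 h2; lra.
move=> x; have [/eqP/rn0_eq ->|x0] := boolP (rn x == 0).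
  by rewrite (lin0 l) rn0 mulr0.
have [/eqP ->|y0] := boolP (rn (T x) == 0).
  have := le_trans (normr_ge0 _) (qT x); rewrite expr2 mulrA.
  by rewrite pmulr_lge0// lt_neqAle eq_sym x0 rn_ge0.
have xp : 0 < rn x by rewrite lt_neqAle eq_sym x0 rn_ge0.
have yp : 0 < rn (T x) by rewrite lt_neqAle eq_sym y0 rn_ge0.
(* The second vector is parallel to [T x] and has the norm of [x]. *)
have := key x ((rn x / rn (T x))%:C *: T x).
rewrite rdZr -rn_sq rnZr ger0_norm ?divr_ge0 ?rn_ge0// mulfVK ?gt_eqF//.
have -> : rn x / rn (T x) * rn (T x) ^+ 2 = rn x * rn (T x) by field.
move=> h; rewrite -(ler_pM2l xp); lra.
Qed.

Section Iteration.
Variables (A : op H).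
Hypotheses (lA : linear A) (sA : forall x y, rd (A x) y = rd x (A y))
  (bA : bounded_by 1 A).

(** The iteration [Y |-> (A + Y^2) / 2].  A fixed point [L] satisfies
[(1 - L)^2 = 1 - A], so that [1 - L] is a square root of [1 - A]. *)
Fixpoint sqrt_iter (n : nat) : op H := if n is m.+1
  then fun x => (1/2 : R)%:C *: (A x + sqrt_iter m (sqrt_iter m x)) else fun=> 0.

(** The iteration for the scalar [A = 1]: its values and its
increments dominate the norms of the operator iterates and of their increments,
and it is increasing and bounded. *)
Fixpoint sqrt_iter_norm (n : nat) : R :=
  if n is m.+1 then (1 + sqrt_iter_norm m ^+ 2) / 2 else 0.

Lemma sqrt_iter_norm_itv n : 0 <= sqrt_iter_norm n <= 1.
Proof. by elim: n => [|n /andP[h0 h1]] /=; apply/andP; split=> //; nra. Qed.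

Lemma sqrt_iter_lin n : linear (sqrt_iter n).
Proof.
elim: n => [|n IH] c x y /=; first by rewrite scaler0 addr0.
rewrite lA !IH; vec.
Qed.

Lemma sqrt_iter_sym n x y : rd (sqrt_iter n x) y = rd x (sqrt_iter n y).
Proof.
elim: n x y => [|n IH] x y /=; first by rewrite !rdE.
by rewrite !rdE sA !IH.
Qed.

Lemma sqrt_iter_bound n : bounded_by (sqrt_iter_norm n) (sqrt_iter n).
Proof.
elim: n => [|n IH] x /=; first by rewrite rn0 mul0r.
rewrite rnZr ger0_norm//; have /andP[q0 q1] := sqrt_iter_norm_itv n.
have h := rnD (A x) (sqrt_iter n (sqrt_iter n x)).
have h1 := bA x; have h2 := IH (sqrt_iter n x).
have h3 : sqrt_iter_norm n * rn (sqrt_iter n x) <= sqrt_iter_norm n *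
  (sqrt_iter_norm n * rn x) by rewrite ler_wpM2l.
lra.
Qed.

(** The decomposition [y^2 - z^2 = y (y - z) + (y - z) z] holds without
commutation. *)
Lemma half_square_diff (y z : op H) (p q d : R) : linear y -> 0 <= p -> 0 <= d ->
  bounded_by p y -> bounded_by q z -> bounded_by d ((y : H -> H) - z) ->
  forall x, rn ((1/2 : R)%:C *: (A x + y (y x)) - (1/2 : R)%:C *: (A x + z (z x)))
    <= d * (p + q) / 2 * rn x.
Proof.
move=> ly p0 d0 py qz dyz x.
have -> : (1/2 : R)%:C *: (A x + y (y x)) - (1/2 : R)%:C *: (A x + z (z x)) =
   (1/2 : R)%:C *: (y (y x - z x) + (y (z x) - z (z x))).
  by rewrite (linB ly); vec.
rewrite rnZr ger0_norm//.
have h := rnD (y (y x - z x)) (y (z x) - z (z x)).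
have h1 : rn (y (y x - z x)) <= p * (d * rn x).
  exact: le_trans (py _) (ler_wpM2l p0 (dyz x)).
have h2 : rn (y (z x) - z (z x)) <= d * (q * rn x).
  exact: le_trans (dyz (z x)) (ler_wpM2l d0 (qz x)).
lra.
Qed.

Lemma sqrt_iter_norm_mono n : sqrt_iter_norm n <= sqrt_iter_norm n.+1.
Proof. by rewrite /=; have /andP[q0 q1] := sqrt_iter_norm_itv n; nra. Qed.

Lemma sqrt_iter_diff n : bounded_by (sqrt_iter_norm n.+1 - sqrt_iter_norm n)
  ((sqrt_iter n.+1 : H -> H) - sqrt_iter n).
Proof.
elim: n => [|n IH] x.
  have := sqrt_iter_bound 1 x; rewrite !fctE subr0.
  by move/le_trans; apply; rewrite ler_wpM2r ?rn_ge0//= subr0.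
have /andP[q0 q1] := sqrt_iter_norm_itv n; have /andP[p0 p1] := sqrt_iter_norm_itv n.+1.
have D0 : 0 <= sqrt_iter_norm n.+1 - sqrt_iter_norm n
  by rewrite subr_ge0 sqrt_iter_norm_mono.
have := half_square_diff (sqrt_iter_lin n.+1) p0 D0 (sqrt_iter_bound n.+1)
  (sqrt_iter_bound n) IH x.
move/le_trans; apply; rewrite ler_wpM2r ?rn_ge0//.
have -> : sqrt_iter_norm n.+2 = (1 + sqrt_iter_norm n.+1 ^+ 2) / 2 by [].
have : sqrt_iter_norm n.+1 = (1 + sqrt_iter_norm n ^+ 2) / 2 by [].
move: (sqrt_iter_norm n.+1) (sqrt_iter_norm n) => a b e; rewrite [X in _ <= _ - X]e.
by rewrite le_eqVlt; apply/orP; left; apply/eqP; field.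
Qed.

Lemma sqrt_iter_diff_add n (k : nat) :
  bounded_by (sqrt_iter_norm (n + k) - sqrt_iter_norm n)
    ((sqrt_iter (n + k) : H -> H) - sqrt_iter n).
Proof.
elim: k => [|k IH] x; first by rewrite addn0 !subrr mul0r fun0E rn0.
rewrite addnS; have h1 := sqrt_iter_diff (n + k) x; have h2 := IH x.
have := le_trans (rn_trid _ _ _) (lerD h1 h2) => /le_trans; apply.
by rewrite -mulrDl addrA subrK.
Qed.

Lemma sqrt_iter_norm_cauchy (e : R) : 0 < e -> exists N, forall n, (N <= n)%N ->
  sqrt_iter_norm n - sqrt_iter_norm N < e.
Proof.
move=> e0; have hS : has_sup [set sqrt_iter_norm n | n in setT].
  split; first by exists (sqrt_iter_norm 0), 0%N.
  by exists 1 => _ [n _ <-]; case/andP: (sqrt_iter_norm_itv n).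
have [_ [N _ <-] h] := sup_adherent e0 hS; exists N => n _.
have : sqrt_iter_norm n <= sup [set sqrt_iter_norm n | n in setT] by apply: ub_le_sup;
  [exact: hS.2|exists n].
lra.
Qed.

Lemma half_square_fixpoint : exists L : op H, [/\ BH L, bounded_by 1 L,
  (forall x y, rd (L x) y = rd x (L y)) &
  forall x, A x + L (L x) = L x + L x].
Proof.
have bY n : BH (sqrt_iter n).
  apply/BHP; split; first exact: sqrt_iter_lin.
  by exists (sqrt_iter_norm n);
    [case/andP: (sqrt_iter_norm_itv n)|exact: sqrt_iter_bound].
have [|L bL LP] := op_complete bY.
  move=> e e0; have [|N HN] := sqrt_iter_norm_cauchy (e := e / 2);
    first by rewrite divr_gt0.
  have h n : (N <= n)%N -> bounded_by (e / 2) ((sqrt_iter n : H -> H) - sqrt_iter N).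
    move=> Nn x; have := sqrt_iter_diff_add N (n - N) x; rewrite subnKC//.
    move/le_trans; apply; rewrite ler_wpM2r ?rn_ge0// ltW//; exact: HN.
  exists N => n m /h Nn /h Nm x.
  apply: le_trans (rn_trid _ (sqrt_iter N x) _) _.
  rewrite (rn_distC (sqrt_iter N x)).
  by apply: le_trans (lerD (Nn x) (Nm x)) _; rewrite -mulrDl -splitr.
have lL := BH_linear bL.
have L1 : bounded_by 1 L.
  move=> x; apply: le_eps => e e0.
  have x1 : 0 < rn x + 1 by rewrite ltr_wpDl// rn_ge0.
  have [|N /(_ N (leqnn _) x) HN] := LP (e / (rn x + 1)); first exact: divr_gt0.
  have -> : L x = sqrt_iter N x - (sqrt_iter N x - L x) by rewrite opprB addrC subrK.
  apply: le_trans (rnB_le _ _) (lerD _ (le_trans HN _)).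
    apply: le_trans (sqrt_iter_bound N x) _; rewrite ler_wpM2r ?rn_ge0//.
    by case/andP: (sqrt_iter_norm_itv N).
  by rewrite mulrAC ler_pdivrMr// ler_wpM2l ?lerDl//; exact: ltW.
exists L; split => // [x y|x].
  apply/eqP; rewrite -subr_eq0 -normr_eq0 eq_le normr_ge0 andbT.
  apply: le_eps => e e0.
  have x1 : 0 < 2 * (rn x * rn y) + 1 by rewrite ltr_wpDl// !mulr_ge0 ?rn_ge0.
  have [|N /(_ N (leqnn _)) HN] := LP (e / (2 * (rn x * rn y) + 1));
    first exact: divr_gt0.
  have -> : rd (L x) y - rd x (L y) =
    rd x (sqrt_iter N y - L y) - rd (sqrt_iter N x - L x) y.
    by rewrite !rdE sqrt_iter_sym; lra.
  apply: le_trans (ler_normB _ _) _.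
  apply: le_trans (lerD (rd_abs _ _) (rd_abs _ _)) _.
  have h1 := ler_wpM2l (rn_ge0 x) (HN y).
  have h2 := ler_wpM2r (rn_ge0 y) (HN x).
  apply: le_trans (lerD h1 h2) _; rewrite add0r.
  rewrite [leRHS](_ : e = e / (2 * (rn x * rn y) + 1) * (2 * (rn x * rn y) + 1));
    last first.
    by rewrite mulfVK// gt_eqF.
  have : 0 <= e / (2 * (rn x * rn y) + 1) by rewrite divr_ge0// ltW.
  move: (e / _) => d d0; nra.
apply/eqP; rewrite -subr_eq0; apply/eqP/rn_eps => e e0.
have x1 : 0 < 4 * rn x + 1 by rewrite ltr_wpDl// !mulr_ge0 ?rn_ge0.
have [|N HN] := LP (e / (4 * rn x + 1)); first exact: divr_gt0.
have d0 : 0 < e / (4 * rn x + 1) by exact: divr_gt0.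
have -> : A x + L (L x) - (L x + L x) =
  2%:C *: (sqrt_iter N.+1 x - L x) - (sqrt_iter N (sqrt_iter N x - L x) +
    (sqrt_iter N (L x) - L (L x))).
  rewrite (linB (sqrt_iter_lin N)) [sqrt_iter N.+1 x]/(_ *: _).
  by vec.
apply: le_trans (rnB_le _ _) _.
have h1 : rn (2%:C *: (sqrt_iter N.+1 x - L x)) <= 2 * (e / (4 * rn x + 1) * rn x).
  by rewrite rnZr ger0_norm// ler_wpM2l//; exact: HN _ (leqnSn N) x.
have h2 : rn (sqrt_iter N (sqrt_iter N x - L x)) <= 1 * (e / (4 * rn x + 1) * rn x).
  have /andP[q0 q1] := sqrt_iter_norm_itv N.
  apply: le_trans (sqrt_iter_bound N _) _.
  apply: le_trans (ler_wpM2l q0 (HN _ (leqnn N) x)) _.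
  by rewrite ler_wpM2r// mulr_ge0 ?rn_ge0// ltW.
have h3 : rn (sqrt_iter N (L x) - L (L x)) <= e / (4 * rn x + 1) * rn x.
  apply: le_trans (HN _ (leqnn N) _) _; apply: (ler_wpM2l (ltW d0)).
  by rewrite -[leRHS]mul1r.
apply: le_trans (lerD h1 (le_trans (rnD _ _) (lerD h2 h3))) _.
rewrite [leRHS](_ : e = e / (4 * rn x + 1) * (4 * rn x + 1)); last first.
  by rewrite mulfVK// gt_eqF.
move: (e / _) d0 => d d0; have := rn_ge0 x; nra.
Qed.

End Iteration.

(** Dividing [T] by an upper bound of its norm makes [1 - T] a contraction, to
which the iteration applies. *)
Lemma sqrt_exists T : BH T -> pos_op T ->
  exists p : op H, [/\ BH p, pos_op p & p \o p = T].
Proof.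
move=> bT pT; have lT := BH_linear bT; have sT := pos_selfadj lT pT.
have [C C0 CT] : exists2 C, 0 <= C & bounded_by C T by case/BHP: bT.
have C1 : 0 < C + 1 by rewrite ltr_wpDl.
have T0 x : 0 <= rd (T x) x by have := pT x; rewrite hdot_rd lecE => /andP[].
pose A : op H := fun x => x - ((C + 1)^-1)%:C *: T x.
have lA : linear A.
  by move=> c x y; rewrite /A lT; vec.
have sA x y : rd (A x) y = rd x (A y) by rewrite /A !rdE sT.
have bA : bounded_by 1 A.
  apply: selfadj_bound => // x; rewrite mul1r rn_sq /A rdBl rdZl ger0_norm.
    by rewrite lerBlDr lerDl mulr_ge0// invr_ge0 ltW.
  rewrite subr_ge0 mulrC ler_pdivrMr// -rn_sq.
  have h := rd_le (T x) x; have h' := ler_wpM2r (rn_ge0 x) (CT x).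
  apply: le_trans h (le_trans h' _); rewrite mulrDr mulr1 expr2 -mulrA mulrC.
  by rewrite lerDl mulr_ge0// rn_ge0.
have [L [bL L1 sL LE]] := half_square_fixpoint lA sA bA.
have lL := BH_linear bL.
pose s := Num.sqrt (C + 1).
have s2 : s ^+ 2 = C + 1 by rewrite sqr_sqrtr// ltW.
have s0 : 0 <= s by exact: sqrtr_ge0.
pose p : op H := fun x => s%:C *: (x - L x).
have lp : linear p.
  by move=> c x y; rewrite /p lL; vec.
exists p; split.
- apply/BHP; split=> //; exists (s * 2); first by rewrite mulr_ge0.
  move=> x; rewrite /p rnZr ger0_norm// -mulrA ler_wpM2l//.
  by apply: le_trans (rnB_le _ _) _; have := L1 x; lra.
- apply: selfadj_pos => // [x y|x]; rewrite /p !rdE ?sL//.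
  rewrite mulr_ge0// subr_ge0 -rn_sq expr2.
  by apply: le_trans (rd_le _ _) _; apply: (ler_wpM2l (rn_ge0 _)); rewrite -[leRHS]mul1r.
- apply/funext => x /=; rewrite /p (linZ lL) (linB lL).
  have := LE x; rewrite /A => h.
  apply: rd_inj => w; have := congr1 (fun v => rd v w) h.
  rewrite /= !rdE => {}h.
  have -> : rd (L (L x)) w = rd (L x) w + rd (L x) w - (rd x w - (C + 1)^-1 * rd (T x) w).
    by lra.
  move: (rd (L x) w) (rd x w) (rd (T x) w) => a b c.
  transitivity (s ^+ 2 * ((C + 1)^-1 * c)); first by ring.
  by rewrite s2 mulrA mulfV ?mul1r// gt_eqF.
Qed.

End SquareRoot.

(** * Extension and approximation by density *)

Section Extension.
Context {R : realType} {H : hilbertType R}.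
Implicit Types (x y z : H) (K : set H) (T : op H).

(** The image of [z] is the only vector [v] with [|v - y| <= |z - x|] for all
[(x, y)] in the graph [G]; it is the limit of the images of vectors
approximating [z], and linearity follows from this characterization. *)
Lemma contraction_ext (G : H -> H -> Prop) :
  (forall c x y x' y', G x y -> G x' y' -> G (c *: x + x') (c *: y + y')) ->
  (forall x y, G x y -> rn y <= rn x) ->
  (forall x (e : R), 0 < e -> exists x' y', G x' y' /\ rn (x - x') < e) ->
  exists V : op H, [/\ BH V, bounded_by 1 V & forall x y, G x y -> V x = y].
Proof.
move=> GP Gn Gd.
have GB x y x' y' : G x y -> G x' y' -> rn (y - y') <= rn (x - x').
  move=> g g'; have := GP (-1) _ _ _ _ g' g; rewrite !scaleN1r => /Gn.
  by rewrite ![- _ + _]addrC.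
have /choice[V VP] z : exists v, forall x y, G x y -> rn (v - y) <= rn (z - x).
  have /choice[s sP] n : exists p : H * H, G p.1 p.2 /\ rn (z - p.1) < n.+1%:R^-1.
    have [|x [y [g h]]] := Gd z n.+1%:R^-1; first by rewrite invr_gt0.
    by exists (x, y).
  have near (e : R) : 0 < e -> exists N, forall n, (N <= n)%N -> rn (z - (s n).1) < e.
    move=> e0; have [N HN] := inv_small e0; exists N => n /HN; apply: lt_trans.
    by case: (sP n).
  have [|v vP] := @rn_complete _ _ (fun n => (s n).2).
    move=> e e0; have [|N HN] := near (e / 2); first by rewrite divr_gt0.
    exists N => n m Nn Nm; have [gn _] := sP n; have [gm _] := sP m.
    apply: le_lt_trans (GB _ _ _ _ gn gm) _.
    apply: le_lt_trans (rn_trid _ z _) _; rewrite rn_distC [ltRHS]splitr.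
    by apply: ltrD; apply: HN.
  exists v => x y g; apply: le_eps => e e0.
  have [|N HN] := near (e / 2); first by rewrite divr_gt0.
  have [|M HM] := vP (e / 2); first by rewrite divr_gt0.
  pose n := maxn N M; have [gn _] := sP n.
  have h1 := HN n (leq_maxl _ _); have h2 := HM n (leq_maxr _ _).
  have h3 := GB _ _ _ _ gn g.
  have h4 := rn_trid (s n).1 z x; have h5 := rn_trid v (s n).2 y.
  rewrite (rn_distC _ z) in h4; rewrite (rn_distC v (s n).2) in h5.
  lra.
have V1 : bounded_by 1 V.
  move=> x; rewrite mul1r.
  have [x' [y' [g _]]] := Gd 0 1 ltr01.
  have := GP (-1) _ _ _ _ g g; rewrite !scaleN1r !addNr => /(VP x).
  by rewrite !subr0.
have VE x y : G x y -> V x = y.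
  move=> g; apply/eqP; rewrite -subr_eq0; apply/eqP/rn0_eq/eqP.
  by rewrite eq_le rn_ge0 andbT; have := VP x _ _ g; rewrite subrr rn0.
exists V; split=> //; apply/BHP; split; last by exists 1.
move=> c x y; apply/eqP; rewrite -subr_eq0; apply/eqP/rn_eps => e e0.
have c0 : 0 < complex.Re `|c| + 1 by rewrite ltr_wpDl// Re_norm_ge0.
pose d := e / (2 * (complex.Re `|c| + 1)).
have d0 : 0 < d by rewrite divr_gt0// mulr_gt0.
have [x1 [x2 [gx hx]]] := Gd x d d0; have [y1 [y2 [gy hy]]] := Gd y d d0.
have h := VP (c *: x + y) _ _ (GP c _ _ _ _ gx gy).
have hx' := le_trans (VP x _ _ gx) (ltW hx).
have hy' := le_trans (VP y _ _ gy) (ltW hy).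
have -> : V (c *: x + y) - (c *: V x + V y) =
  (V (c *: x + y) - (c *: x2 + y2)) - (c *: (V x - x2) + (V y - y2)) by vec.
apply: le_trans (rnB_le _ _) _.
have h2 := rnD (c *: (V x - x2)) (V y - y2).
have h3 : rn (c *: x + y - (c *: x1 + y1)) <= complex.Re `|c| * rn (x - x1) + rn (y - y1).
  have -> : c *: x + y - (c *: x1 + y1) = c *: (x - x1) + (y - y1) by vec.
  by rewrite (le_trans (rnD _ _))// rnZ.
rewrite rnZ in h2.
have r0 := Re_norm_ge0 c.
have h4 := ler_wpM2l r0 hx'; have h5 := ler_wpM2l r0 (ltW hx).
have -> : e = d * (2 * (complex.Re `|c| + 1)) by rewrite /d mulfVK// gt_eqF// mulr_gt0.
lra.
Qed.

Lemma ptws_closure (M : set (op H)) T :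
  (forall e : R, 0 < e -> exists2 T', M T' & bounded_by e ((T' : H -> H) - T)) ->
  closure (M : set {ptws H -> H}) T.
Proof.
move=> MT.
have /choice[s sP] n : exists T', M T' /\ bounded_by n.+1%:R^-1 ((T' : H -> H) - T).
  have [|T' ? ?] := MT n.+1%:R^-1; first by rewrite invr_gt0.
  by exists T'.
have sT : {ptws, s @ \oo --> (T : H -> H)}.
  apply/pointwise_cvgP => x; apply/cvgrPdist_lt => e e0.
  have er : e = (complex.Re e)%:C by rewrite RRe_real// gtr0_real.
  rewrite er ltcR in e0.
  have x1 : 0 < rn x + 1 by rewrite ltr_wpDl// rn_ge0.
  have [|N HN] := @inv_small _ (complex.Re e / (rn x + 1)); first by rewrite divr_gt0.
  exists N => // n /= /HN nN; rewrite -rnE er ltcR rn_distC.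
  have [_ h] := sP n; apply: le_lt_trans (h x) _.
  apply: (@le_lt_trans _ _ (complex.Re e / (rn x + 1) * rn x)).
    by rewrite ler_wpM2r ?rn_ge0// ltW.
  by rewrite mulrAC ltr_pdivrMr// ltr_pM2l// ltrDl.
move=> U /sT[N _ HN]; exists (s N); split; first by case: (sP N).
exact: HN (leqnn N).
Qed.

Lemma closure_subspace (D : set H) : D 0 ->
  (forall c x y, D x -> D y -> D (c *: x + y)) -> closed_subspace (closure D).
Proof.
move=> D0 DP; split; first exact: subset_closure.
- move=> c x y /closureP_rn Dx /closureP_rn Dy; apply/closureP_rn => e e0.
  have c0 : 0 < complex.Re `|c| + 1 by rewrite ltr_wpDl// Re_norm_ge0.
  have d0 : 0 < e / (complex.Re `|c| + 1) by exact: divr_gt0.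
  have [x' Dx' hx] := Dx _ d0; have [y' Dy' hy] := Dy _ d0.
  exists (c *: x' + y'); first exact: DP.
  have -> : c *: x + y - (c *: x' + y') = c *: (x - x') + (y - y') by vec.
  apply: le_lt_trans (rnD _ _) _; rewrite rnZ.
  have := ler_wpM2l (Re_norm_ge0 c) (ltW hx).
  rewrite [ltRHS](_ : e = e / (complex.Re `|c| + 1) * (complex.Re `|c| + 1)); last first.
    by rewrite mulfVK// gt_eqF.
  move: (e / _) d0 hx hy => d d0 hx hy h; nra.
- move=> x /closureP_rn Dx; apply/closureP_rn => e e0.
  have e2 : 0 < e / 2 by rewrite divr_gt0.
  have [y /closureP_rn/(_ _ e2)[z Dz yz] xy] := Dx _ e2.
  by exists z => //; apply: le_lt_trans (rn_trid _ y _) _; lra.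
Qed.

End Extension.

(** * Von Neumann algebras *)

Section VonNeumann.
Context {R : realType} {H : hilbertType R} (M : set (op H)).
Hypothesis vM : is_vN M.
Implicit Types (T : op H).

Lemma vN_BH T : M T -> BH T. Proof. by case: vM => h _ _; exact: h. Qed.
Lemma vN_adj T : M T -> M (adj T). Proof. by case: vM => _ h _; exact: h. Qed.
Lemma vN_mem T : BH T -> (forall T', commutant M T' -> T \o T' = T' \o T) -> M T.
Proof. by case: vM => _ _ e bT h; rewrite -e; split. Qed.
Lemma vN_comm T T' : M T -> commutant M T' -> T \o T' = T' \o T.
Proof. by move=> MT [_ /(_ T MT)]. Qed.

Lemma vN_id : M idfun.
Proof. by apply: vN_mem => //; exact: BH_id. Qed.

Lemma vN_comp T T' : M T -> M T' -> M (T \o T').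
Proof.
move=> MT MT'; apply: vN_mem; first by apply: BH_comp; exact: vN_BH.
move=> S cS; rewrite -compA (vN_comm MT' cS) compA (vN_comm MT cS) compA.
by [].
Qed.

Lemma vN_lc (c : R[i]) T T' : M T -> M T' -> M (c *: (T : H -> H) + T').
Proof.
move=> MT MT'; apply: vN_mem; first by apply: BH_lc; exact: vN_BH.
move=> S cS; apply/funext => x /=; rewrite !fctE.
have lS : linear S by case: cS => /BH_linear.
by rewrite lS; congr (_ *: _ + _); [have := vN_comm MT cS|have := vN_comm MT' cS];
  move/(congr1 (fun f => f x)).
Qed.

Lemma vN_sub T T' : M T -> M T' -> M ((T : H -> H) - T').
Proof. by move=> MT MT'; rewrite addrC -scaleN1r; apply: vN_lc. Qed.
Lemma vN_add T T' : M T -> M T' -> M ((T : H -> H) + T').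
Proof. by move=> MT MT'; rewrite -[X in M (X + _)]scale1r; apply: vN_lc. Qed.
Lemma vN_0 : M (0 : H -> H).
Proof. by have := vN_sub vN_id vN_id; rewrite subrr. Qed.

End VonNeumann.

(** * Iterates of a symmetric operator *)

Section Growth.
Context {R : realType} {H : hilbertType R}.

(** Bernoulli's inequality for [r / Q]. *)
Lemma geometric_unbounded (r Q C : R) : 0 < Q -> Q < r -> ~ (forall n,
  r ^+ n <= C * Q ^+ n).
Proof.
move=> Q0 Qr h; pose d := r / Q - 1.
have d0 : 0 < d by rewrite subr_gt0 ltr_pdivlMr// mul1r.
have be n : 1 + n%:R * d <= (1 + d) ^+ n.
  elim: n => [|n IH]; first by rewrite mul0r addr0.
  rewrite exprS -natr1; have := ler_wpM2l (ltW (ltr_wpDl (ler01 : 0 <= (1:R)) d0)) IH.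
  have : 0 <= n%:R * d * d by rewrite !mulr_ge0// ltW.
  nra.
have dn n : (1 + d) ^+ n <= C.
  have := h n; rewrite -ler_pdivrMr ?exprn_gt0// -expr_div_n.
  by rewrite /d addrC subrK.
have := dn (Num.truncn (C / d)).+1; apply/negP; rewrite -ltNge.
apply: lt_le_trans (be _).
have := truncnS_gt (C / d); rewrite ltr_pdivrMr// => /lt_trans; apply.
by rewrite ltrDr.
Qed.

(** By Cauchy-Schwarz [|T^(n+1) x|^2 <= |T^n x| |T^(n+2) x|], so the successive
ratios of the norms of the iterates increase.  If the first ratio exceeded [Q],
the norms would grow faster than [Q^n]. *)
Lemma selfadj_growth (T : op H) (x : H) (Q C : R) : 0 <= Q ->
  (forall x y, rd (T x) y = rd x (T y)) ->
  (forall n, rn (iter n T x) <= C * Q ^+ n) -> rn (T x) <= Q * rn x.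
Proof.
move=> Q0 sT hC; have [//|lt] := leP (rn (T x)) (Q * rn x).
have [/eqP x0|x0] := boolP (rn x == 0).
  have : rn (T x) ^+ 2 <= 0 by rewrite rn_sq sT (le_trans (rd_le _ _))// x0 mul0r.
  move: lt; rewrite x0 mulr0 => lt; rewrite leNgt exprn_gt0//.
have xp : 0 < rn x by rewrite lt_neqAle eq_sym x0 rn_ge0.
pose r := rn (T x) / rn x.
have Qr : Q < r by rewrite ltr_pdivlMr.
have r0 : 0 < r by exact: le_lt_trans Qr.
have grow n : 0 < rn (iter n T x) /\ r * rn (iter n T x) <= rn (iter n.+1 T x).
  elim: n => [|n [IH1 IH2]]; first by rewrite /= /r mulfVK ?gt_eqF.
  have p : 0 < rn (iter n.+1 T x) by apply: lt_le_trans IH2; rewrite mulr_gt0.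
  split=> //; have lc : rn (iter n.+1 T x) ^+ 2 <= rn (iter n T x) * rn (iter n.+2 T x).
    by rewrite rn_sq {1}iterS sT -iterS rd_le.
  rewrite -(ler_pM2l IH1); apply: le_trans lc; rewrite expr2 mulrCA mulrA.
  by rewrite ler_pM2r.
have gn n : r ^+ n * rn x <= rn (iter n T x).
  elim: n => [|n IH]; first by rewrite mul1r.
  have [_ h] := grow n; apply: le_trans h; rewrite exprS -mulrA.
  by rewrite ler_pM2l.
have [Q00|Qp] := leP Q 0.
  exfalso.
  have := gn 1%N; have := hC 1%N; rewrite expr1.
  have -> : Q = 0 by apply/eqP; rewrite eq_le Q0 Q00.
  rewrite mulr0 => h1 h2; have := mulr_gt0 (exprn_gt0 1 r0) xp.
  by move/lt_le_trans/(_ (le_trans h2 h1)); rewrite ltxx.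
exfalso; apply: (@geometric_unbounded r Q (C / rn x) Qp Qr) => n.
by rewrite mulrAC ler_pdivlMr// (le_trans (gn n)).
Qed.

End Growth.

(** * Conditional expectations and the commutant *)

Section ProbSpace.
Context {R : realType} (P : prob_space R).
Local Notation A := (@alg R P).
Local Notation Om := (Omega P).
Implicit Types (x y z : op P).

Lemma A_BH x : A x -> BH x. Proof. exact: (vN_BH (@alg_vN R P)). Qed.

Lemma Omega_inj x y : A x -> A y -> x Om = y Om -> x = y.
Proof.
move=> Ax Ay xy; apply/eqP; rewrite -subr_eq0; apply/eqP.
apply: Omega_separating; first exact: (vN_sub (@alg_vN R P)).
by rewrite !fctE xy subrr.
Qed.

Lemma psiE x y : A y -> psi (adj y \o x) = hdot P (x Om) (y Om).
Proof.
move=> /A_BH bT; rewrite /psi /=.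
have <- : is_adj (adj y) y by rewrite -{2}(adjK bT); apply/adjP/BH_adj.
by [].
Qed.

Section CondExp.
Variables (Bs : set (op P)) (E : op P -> op P).
Hypotheses (vB : is_vN Bs) (BA : Bs `<=` A) (cE : is_condexp Bs E).

Lemma condexp_in x : A x -> Bs (E x).
Proof. by case: cE => -[h _ _ _ _ _]; exact: h. Qed.

(** The module property [E(b^* x c) = b^* E(x) c] and the invariance of the state. *)
Lemma condexp_dot x b c : A x -> Bs b -> Bs c ->
  hdot P (E x (c Om)) (b Om) = hdot P (x (c Om)) (b Om).
Proof.
move=> Ax Bb Bc; case: cE => _ _ h hp.
have Bb' := vN_adj vB Bb.
have vA := @alg_vN R P.
rewrite -[E x (c Om)]/((E x \o c) Om) -psiE; last exact: BA.
rewrite compA -h// hp.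
  by rewrite -compA psiE//; exact: BA.
by apply: (vN_comp vA); [apply: (vN_comp vA) => //|]; exact: BA.
Qed.

(** The vector [(z - E x) Omega] is orthogonal to [B Omega], to which it belongs. *)
Lemma condexp_unique x z : A x -> Bs z ->
  (forall b, Bs b -> rd (z Om) (b Om) = rd (x Om) (b Om)) -> z = E x.
Proof.
move=> Ax Bz h; have BEx := condexp_in Ax.
apply: Omega_inj; [exact: BA|exact: BA|].
apply/eqP; rewrite -subr_eq0; apply/eqP/rn0_eq/eqP; rewrite -sqrf_eq0 rn_sq.
have Bd := vN_sub vB Bz BEx.
rewrite -[z Om - E x Om]/(((z : P -> P) - E x) Om)
  {1}[((z : P -> P) - E x) Om]/(z Om - E x Om).
rewrite rdBl h//; have := condexp_dot Ax Bd (vN_id vB).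
by move=> /(congr1 (@complex.Re R)); rewrite -!/(rd _ _) => ->; rewrite subrr.
Qed.

End CondExp.

(** The projection onto the closure of [A' Omega] commutes with [A'], hence lies
in the bicommutant [A].  It fixes [Omega], which separates [A], and so it is the
identity. *)
Lemma commutant_cyclic (xi : P) (e : R) : 0 < e ->
  exists x', commutant A x' /\ rn (xi - x' Om) < e.
Proof.
pose D := [set x' Om | x' in commutant A].
have vA := @alg_vN R P.
have cBH x' : commutant A x' -> BH x' by case.
have cadj x' : commutant A x' -> commutant A (adj x').
  move=> [bx' cx']; split; first exact: BH_adj.
  move=> T AT; have bT := A_BH AT.
  rewrite -{1}(adjK bT) -adj_comp//; last exact: BH_adj.
  rewrite -cx'; last exact: vN_adj vA _ _.
  by rewrite adj_comp//; [rewrite adjK|exact: BH_adj].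
have ccomp x' y' : commutant A x' -> commutant A y' -> commutant A (x' \o y').
  move=> [bx cx] [by' cy]; split; first exact: BH_comp.
  by move=> T AT; rewrite -compA cy// compA cx.
have clc c x' y' : commutant A x' -> commutant A y' -> 
   commutant A (c *: (x' : P -> P) + y').
  move=> [bx cx] [by' cy]; split; first exact: BH_lc.
  move=> T AT; apply/funext => w /=; rewrite !fctE /=.
  rewrite -[x' (T w)]/((x' \o T) w) cx// -[y' (T w)]/((y' \o T) w) cy//=.
  by have [l _] := A_BH AT; rewrite l.
have cid : commutant A idfun by split=> //; exact: BH_id.
have D0 : D 0 by exists (0 : P -> P) => //; have := clc (-1) _ _ cid cid;
  rewrite scaleN1r addNr.
have DP c u v : D u -> D v -> D (c *: u + v).
  move=> [x' cx <-] [y' cy <-]; exists (c *: (x' : P -> P) + y') => //; exact: clc.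
have [p [bp pp sp rp]] := projection (closure_subspace D0 DP).
have lp := BH_linear bp.
have pK u : closure D u -> p u = u.
  by rewrite -rp => -[w _ <-]; rewrite -[p (p w)]/((p \o p) w) pp.
have pin u : closure D (p u) by rewrite -rp; exists u.
have inv x' u : commutant A x' -> closure D u -> closure D (x' u).
  move=> cx /closureP_rn Du; apply/closureP_rn => d d0.
  have [l [C C0 CT]] : linear x' /\ exists2 C, 0 <= C & bounded_by C x'.
    by apply/BHP; case: cx.
  have C1 : 0 < C + 1 by rewrite ltr_wpDl.
  have [|_ [y' cy <-] h] := Du (d / (C + 1)); first exact: divr_gt0.
  exists (x' (y' Om)); first by exists (x' \o y') => //; exact: ccomp.
  rewrite -(linB l); apply: le_lt_trans (CT _) _.
  have r0 := rn_ge0 (u - y' Om); rewrite ltr_pdivlMr// in h; nra.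
have Ap : A p.
  apply: (vN_mem vA) => // T' cT'; apply/funext => u /=.
  have bT' := cBH _ cT'.
  apply: rd_inj => w; rewrite (is_adjP sp) rd_adj//.
  rewrite -(pK _ (inv _ _ (cadj _ cT') (pin w))) -(is_adjP sp) -rd_adj//.
  by rewrite -(is_adjP sp) pK//; exact: inv.
have p1 : p = idfun.
  apply: Omega_inj => //; first exact: vN_id vA.
  by apply: pK; apply: subset_closure; exists idfun.
move=> e0; have /closureP_rn/(_ _ e0)[_ [x' cx <-] h] := pin xi.
by exists x'; split=> //; move: h; rewrite p1.
Qed.

End ProbSpace.

(** * Passing to the closure of a set of vectors *)

Section Density.
Context {R : realType} {H : hilbertType R}.
Implicit Types (x y z : H) (D : set H) (T : op H).

Lemma bound_closure D T (q : R) : BH T -> 0 <= q ->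
  (forall d, D d -> rn (T d) <= q * rn d) ->
  forall k, closure D k -> rn (T k) <= q * rn k.
Proof.
move=> /BHP[l [C C0 CT]] q0 h k /closureP_rn Dk; apply: le_eps => e e0.
have s0 : 0 < C + q + 1 by rewrite ltr_wpDl// addr_ge0.
have [|d Dd kd] := Dk (e / (C + q + 1)); first exact: divr_gt0.
have h1 := h _ Dd; have h2 := CT (k - d); rewrite (linB l) in h2.
have h3 := rn_trid (T k) (T d) 0; rewrite !subr0 in h3.
have h4 := rn_trid d k 0; rewrite !subr0 (rn_distC d) in h4.
have h5 := ler_wpM2l q0 h4; have h6 := ler_wpM2l C0 (ltW kd).
have h7 := ler_wpM2l q0 (ltW kd).
have -> : e = e / (C + q + 1) * (C + q + 1) by rewrite mulfVK// gt_eqF.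
move: (e / _) (divr_gt0 e0 s0) kd h6 h7 => d' d0 kd h6 h7.
lra.
Qed.

Lemma eq_closure D T T' : BH T -> BH T' -> (forall d, D d -> T d = T' d) ->
  forall k, closure D k -> T k = T' k.
Proof.
move=> bT bT' h k Dk; apply/eqP; rewrite -subr_eq0; apply/eqP/rn0_eq/eqP.
rewrite eq_le rn_ge0 andbT.
have := @bound_closure D ((T : H -> H) - T') 0 (BH_sub bT bT') (lexx _) _ _ Dk.
rewrite mul0r; apply=> d Dd; rewrite !fctE h// subrr rn0 mul0r//.
Qed.

Lemma rd0_closure D x : (forall d, D d -> rd x d = 0) ->
  forall k, closure D k -> rd x k = 0.
Proof.
move=> h k /closureP_rn Dk; apply/eqP; rewrite -normr_eq0 eq_le normr_ge0 andbT.
apply: le_eps => e e0; rewrite add0r.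
have x1 : 0 < rn x + 1 by rewrite ltr_wpDl// rn_ge0.
have [|d Dd kd] := Dk (e / (rn x + 1)); first exact: divr_gt0.
have -> : rd x k = rd x (k - d) by rewrite rdBr (h d)// subr0.
apply: le_trans (rd_abs _ _) _.
apply: le_trans (ler_wpM2l (rn_ge0 x) (ltW kd)) _.
by rewrite mulrC mulrAC ler_pdivrMr// ler_wpM2l ?lerDl//; exact: ltW.
Qed.

Lemma proj_bound (K : set H) p : is_proj K p -> bounded_by 1 p.
Proof.
move=> [bp pp sp _] x; rewrite mul1r; apply: rn_le_rd; first exact: rn_ge0.
move=> y; have h : rd (p x) y = rd (p x) (p y).
  by rewrite -[in LHS]pp /= (is_adjP sp).
have hy : rn (p y) <= rn y.
  have := rd_le (p y) y; rewrite -{1}pp /= (is_adjP sp) -rn_sq expr2.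
  have [y0|+ _] := ltP 0 (rn (p y)); first by rewrite ler_pM2l.
  by move/le_trans; apply; exact: rn_ge0.
rewrite (is_adjP sp); apply: le_trans (rd_le _ _) _.
by rewrite ler_wpM2l ?rn_ge0.
Qed.

End Density.

(** * The projection onto the closure of A0 Omega *)

Section Bernoulli.
Context {R : realType} (B : bernoulli_shift R).
Local Notation A := (@alg R B).
Local Notation A0 := (@A0 R B).
Local Notation Om := (Omega B).
Local Notation E0 := (@E0 R B).
Local Notation e0 := (e0 (B := B)).
Implicit Types (x y z : op B) (t : R).

Lemma A_vN : is_vN A. Proof. exact: alg_vN. Qed.
Lemma A0_vN : is_vN A0. Proof. by case: (@A0_subalg R B). Qed.
Lemma A0_A x : A0 x -> A x. Proof. by case: (@A0_subalg R B) => _ h _; exact: h. Qed.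
Lemma filt_vN I : is_interval I -> is_vN (@filt R B I).
Proof. by case/(@filt_subalg R B). Qed.
Lemma filt_A I x : is_interval I -> filt I x -> A x.
Proof. by case/(@filt_subalg R B) => _ h _; exact: h. Qed.

Lemma E0_in x : A x -> A0 (E0 x). Proof. exact: (condexp_in (@E0_condexp R B)). Qed.

Lemma E0_dot x b c : A x -> A0 b -> A0 c ->
  hdot B (E0 x (c Om)) (b Om) = hdot B (x (c Om)) (b Om).
Proof. by apply: condexp_dot; [exact: A0_vN|exact: A0_A|exact: E0_condexp]. Qed.

Definition A0_orbit : set B := [set x Om | x in A0].

Lemma A0_orbit_closed : closed_subspace (closure A0_orbit).
Proof.
apply: closure_subspace; first by exists (0 : B -> B) => //; exact: vN_0 A0_vN.
move=> c _ _ [x Ax <-] [y Ay <-]; exists (c *: (x : B -> B) + y) => //.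
exact: (vN_lc A0_vN).
Qed.

Lemma e0P : is_proj (closure A0_orbit) e0.
Proof. by have := projection A0_orbit_closed; exact: xgetPex. Qed.

Lemma e0_BH : BH e0. Proof. by case: e0P. Qed.
Lemma e0_e0 v : e0 (e0 v) = e0 v.
Proof. by case: e0P => _ h _ _; rewrite -[LHS]/((e0 \o e0) v) h. Qed.
Lemma e0_adj u v : rd (e0 u) v = rd u (e0 v).
Proof. by case: e0P => _ _ h _; exact: is_adjP. Qed.
Lemma e0_in v : closure A0_orbit (e0 v).
Proof. by case: e0P => _ _ _ <-; exists v. Qed.
Lemma e0_id v : closure A0_orbit v -> e0 v = v.
Proof. by case: e0P => _ pp _ <- -[w _ <-]; exact: e0_e0. Qed.
Lemma e0_bound v : rn (e0 v) <= rn v.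
Proof. by have := proj_bound e0P v; rewrite mul1r. Qed.
Lemma e0_A0_orbit a : A0 a -> e0 (a Om) = a Om.
Proof. by move=> Aa; apply/e0_id/subset_closure; exists a. Qed.

(** Both sides lie in the closure of [A0 Omega] and have the same inner products
with the vectors of [A0 Omega]. *)
Lemma e0_E0 x a : A x -> A0 a -> e0 (x (a Om)) = E0 x (a Om).
Proof.
move=> Ax Aa; apply: rd_inj => w; rewrite e0_adj.
have Az : A0_orbit (E0 x (a Om)) by exists (E0 x \o a) => //;
  apply: (vN_comp A0_vN) => //; exact: E0_in.
rewrite -(e0_id (subset_closure Az)) e0_adj.
apply/eqP; rewrite -subr_eq0 -rdBl; apply/eqP.
apply: (@rd0_closure _ _ A0_orbit); last exact: e0_in.
by move=> _ [b Ab <-]; rewrite rdBl /rd E0_dot// subrr.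
Qed.

(** Let [T = c^* c].  The bound on [A0 Omega] gives [|T^n Omega| <= q^(2n)], which
passes to the vectors [x' Omega] with [x'] in the commutant of [A], up to the
factor [|x'|].  Then [selfadj_growth] gives [|T x' Omega| <= q^2 |x' Omega|], and
such vectors are dense. *)
Lemma A0_bound (c : op B) (q : R) : A0 c -> 0 <= q ->
  (forall a, A0 a -> rn (c (a Om)) <= q * rn (a Om)) -> bounded_by q c.
Proof.
move=> Ac q0 h; have bc := A_BH (A0_A Ac); have v0 := A0_vN.
have Ac' := vN_adj v0 Ac.
(* The vector [c^* a Omega] is fixed by [e0], so only the values of [c] on the
   closure of [A0 Omega] matter for its norm. *)
have h' a : A0 a -> rn (adj c (a Om)) <= q * rn (a Om).
  move=> Aa; apply: rn_le_rd; first by rewrite mulr_ge0// rn_ge0.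
  move=> y; have Aca : A0 (adj c \o a) by exact: (vN_comp v0).
  rewrite -[adj c (a Om)]/((adj c \o a) Om) -(e0_A0_orbit Aca) e0_adj /=.
  rewrite -rd_adjr//; apply: le_trans (rd_le _ _) _.
  rewrite -mulrA mulrCA; apply: (ler_wpM2l (rn_ge0 _)).
  have hk : forall k, closure A0_orbit k -> rn (c k) <= q * rn k.
    by apply: bound_closure => // _ [b Ab <-]; exact: h.
  apply: le_trans (hk _ (@e0_in y)) _.
  by rewrite ler_wpM2l// e0_bound.
pose T : op B := adj c \o c.
have sT (v w : B) : rd (T v) w = rd v (T w) by rewrite /T /= -rd_adjr// -rd_adj.
have TO n : exists2 a, A0 a & iter n T Om = a Om.
  elim: n => [|n [a Aa e]]; first by exists idfun => //; exact: vN_id v0.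
  exists (T \o a) => /=; last by rewrite e.
  by apply: (vN_comp v0) => //; apply: (vN_comp v0).
have Tn n : rn (iter n T Om) <= (q ^+ 2) ^+ n * rn Om.
  elim: n => [|n IH]; first by rewrite mul1r.
  have [a Aa e] := TO n; rewrite iterS /T /= e.
  apply: le_trans (h' (c \o a) (vN_comp v0 Ac Aa)) _.
  apply: le_trans (ler_wpM2l q0 (h a Aa)) _.
  rewrite mulrA -expr2 [(q ^+ 2) ^+ n.+1]exprS -mulrA -e.
  by apply: ler_wpM2l IH; exact: exprn_ge0.
have Tq x' : commutant A x' -> rn (T (x' Om)) <= q ^+ 2 * rn (x' Om).
  move=> [bx' cx']; have [C C0 CT] : exists2 C, 0 <= C & bounded_by C x' by case/BHP: bx'.
  have AT : A T by apply: (vN_comp A_vN); exact: A0_A.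
  have com n : iter n T (x' Om) = x' (iter n T Om).
    elim: n => // n IH; rewrite !iterS IH.
    by rewrite -[T (x' _)]/((T \o x') _) -cx'.
  apply: (@selfadj_growth _ _ T _ _ (C * rn Om)) => // [|n]; first exact: exprn_ge0.
  rewrite com; apply: le_trans (CT _) _; rewrite -mulrA ler_wpM2l//.
  by rewrite mulrC.
have cq x' : commutant A x' -> rn (c (x' Om)) <= q * rn (x' Om).
  move=> cx'; rewrite -(@ler_pXn2r _ 2%N)// ?nnegrE ?rn_ge0 ?mulr_ge0 ?rn_ge0//.
  rewrite rn_sq rd_adjr// exprMn; apply: le_trans (rd_le _ _) _.
  by rewrite [rn _ ^+ 2]expr2 mulrA ler_wpM2r ?rn_ge0//; exact: Tq.
move=> v; apply: (@bound_closure _ _ [set x' Om | x' in commutant A]) => //.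
- by move=> _ [x' cx' <-]; exact: cq.
apply/closureP_rn => e /(commutant_cyclic v)[x' [cx' hx']].
by exists (x' Om) => //; exists x'.
Qed.

(** For the positive square root [p] of [x^* x], [|p v|^2 = <x^* x v, v> = |x v|^2]. *)
Lemma norm0E (x : op B) : BH x -> norm0 x = opnorm x.
Proof.
move=> bx.
have bxx : BH (ip0 x x) by apply: BH_comp => //; exact: BH_adj.
have pxx : pos_op (ip0 x x).
  move=> v; rewrite /ip0 /=.
  have -> : is_adj (adj x) x by rewrite -{2}(adjK bx); apply/adjP/BH_adj.
  by rewrite hdotE -rnE -rmorphXn /= ler0c exprn_ge0// rn_ge0.
have [bp pp ep] : [/\ BH (abs0 x), pos_op (abs0 x) & abs0 x \o abs0 x = ip0 x x].
  exact: (@xgetPex _ _ [set p | [/\ BH p,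
    pos_op p & p \o p = ip0 x x]] (sqrt_exists bxx pxx)).
rewrite /norm0; apply: opnorm_eq => v; apply/eqP; rewrite -(@eqrXn2 _ 2%N) ?rn_ge0//.
rewrite !rn_sq (pos_selfadj (BH_linear bp) pp)
  -[abs0 x (abs0 x v)]/((abs0 x \o abs0 x) v) ep.
by rewrite /ip0 /= -rd_adj.
Qed.

End Bernoulli.

(** * Algebras of intervals *)

Section IntervalAlgebras.
Context {R : realType} {B : bernoulli_shift R}.
Local Notation A0 := (@A0 R B).
Local Notation flow := (@flow R B).
Local Notation filt := (@filt R B).
Implicit Types (x : op B).

Lemma itvP (a b : R) : is_interval [set` `[a, b]].
Proof. exact: interval_is_interval. Qed.

Lemma A0_filt (s t : R) a : A0 a -> filt [set` `[s, t]] a.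
Proof.
have [|h _ _] := @filt_indep R B _ _ (@itvP s t) (@itvP (t + 1) (t + 1)); last exact: h.
by apply/seteqP; split=> // r [/=]; rewrite !in_itv /= => /andP[_ h1] /andP[h2 _]; lra.
Qed.

Lemma filt_le (s t t' : R) x : t <= t' -> filt [set` `[s, t]] x -> filt [set` `[s, t']] x.
Proof.
move=> tt'; apply: filt_mono => //; try exact: itvP.
by move=> r /=; rewrite !in_itv /= => /andP[-> /le_trans]; apply.
Qed.

Lemma filt_ge (s s' t : R) x : s' <= s -> filt [set` `[s, t]] x -> filt [set` `[s', t]] x.
Proof.
move=> ss'; apply: filt_mono => //; try exact: itvP.
by move=> r /=; rewrite !in_itv /= => /andP[h ->]; rewrite (le_trans ss' h).
Qed.

Lemma filt_flow (s t r : R) x : filt [set` `[s, t]] x ->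
  filt [set` `[s + r, t + r]] (flow r x).
Proof.
move=> fx; have : (flow r @` filt [set` `[s, t]]) (flow r x) by exists x.
rewrite flow_filt; last exact: itvP.
congr filt; apply/seteqP; split=> [_ [q /= + <-]|q /=].
  by rewrite !in_itv /= !lerD2r.
by rewrite !in_itv /= => rst; exists (q - r); rewrite ?subrK//= in_itv /= lerBrDr lerBlDr.
Qed.

End IntervalAlgebras.

(** * The flow and independence *)

Section Flow.
Context {R : realType} (B : bernoulli_shift R).
Local Notation A := (@alg R B).
Local Notation A0 := (@A0 R B).
Local Notation Om := (Omega B).
Local Notation E0 := (@E0 R B).
Local Notation e0 := (e0 (B := B)).
Local Notation flow := (@flow R B).
Local Notation filt := (@filt R B).
Implicit Types (x y z m : op B) (t s : R).

Lemma flow_in t x : A x -> A (flow t x).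
Proof. by case: (@flow_aut R B t) => -[h _ _] _ _ _ _ Ax; apply: h. Qed.
Lemma flow_lc t c x y : A x -> A y ->
  flow t (c *: (x : B -> B) + y) = c *: (flow t x : B -> B) + flow t y.
Proof. by case: (@flow_aut R B t) => _ h _ _ _; exact: h. Qed.
Lemma flow_comp t x y : A x -> A y -> flow t (x \o y) = flow t x \o flow t y.
Proof. by case: (@flow_aut R B t) => _ _ h _ _; exact: h. Qed.
Lemma flow_adj t x : A x -> flow t (adj x) = adj (flow t x).
Proof. by case: (@flow_aut R B t) => _ _ _ h _; exact: h. Qed.
Lemma flow_psi t x : A x -> psi (flow t x) = psi x.
Proof. by case: (@flow_aut R B t) => _ _ _ _ h; exact: h. Qed.
Lemma flow_A0 t a : A0 a -> flow t a = a.
Proof. by rewrite (@flow_fixed R B) => -[_]; apply. Qed.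
Lemma flow_sub t x y : A x -> A y -> flow t ((x : B -> B) - y) =
  (flow t x : B -> B) - flow t y.
Proof. by move=> Ax Ay; rewrite addrC -scaleN1r flow_lc// scaleN1r addrC. Qed.
Lemma flow_id t : flow t idfun = idfun.
Proof. by apply: flow_A0; exact: (vN_id (A0_vN B)). Qed.

Lemma flow_dot t x y : A x -> A y ->
  hdot B (flow t x Om) (flow t y Om) = hdot B (x Om) (y Om).
Proof.
move=> Ax Ay; rewrite -!psiE//; last exact: flow_in.
have Ay' := vN_adj (A_vN B) Ay.
by rewrite -flow_adj// -flow_comp// flow_psi//; exact: (vN_comp (A_vN B)).
Qed.

Lemma rn_flow t x : A x -> rn (flow t x Om) = rn (x Om).
Proof.
by move=> Ax; apply/eqP; rewrite -(@eqrXn2 _ 2%N) ?rn_ge0// !rn_sq /rd flow_dot.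
Qed.

Lemma AO_dense v : closure [set x Om | x in A] v.
Proof. by rewrite Omega_cyclic. Qed.

Definition flow_op t : op B := gns_ext (flow t).

(** The automorphism preserves the state, so [x Omega |-> S_t(x) Omega] is an
isometry with dense domain. *)
Lemma flow_opP t : BH (flow_op t) /\ forall x, A x -> flow_op t (x Om) = flow t x Om.
Proof.
apply: (@xgetPex _ _ [set V | BH V /\ forall x, A x -> V (x Om) = flow t x Om]).
have [||v e e0'|V [bV _ VP]] := @contraction_ext _ B (fun v w => exists2 x,
  A x & v = x Om /\ w = flow t x Om).
- move=> c _ _ _ _ [x Ax [-> ->]] [y Ay [-> ->]].
  exists (c *: (x : B -> B) + y); first exact: (vN_lc (A_vN B)).
  by rewrite flow_lc.
- by move=> _ _ [x Ax [-> ->]]; rewrite rn_flow.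
- have /closureP_rn/(_ _ e0')[_ [x Ax <-] h] := @AO_dense v.
  by exists (x Om), (flow t x Om); split=> //; exists x.
by exists V; split=> // x Ax; apply: VP; exists x.
Qed.

Lemma flow_op_BH t : BH (flow_op t). Proof. by case: (flow_opP t). Qed.
Lemma flow_opE t x : A x -> flow_op t (x Om) = flow t x Om. Proof.
  by case: (flow_opP t) => _; apply. Qed.
Lemma flow_op_bound t v : rn (flow_op t v) <= rn v.
Proof.
rewrite -[leRHS]mul1r; apply: (@bound_closure _ _ [set x Om | x in A]) => //.
- exact: flow_op_BH.
- by move=> _ [x Ax <-]; rewrite flow_opE// rn_flow// mul1r.
- exact: AO_dense.
Qed.

(** The automorphism fixes [A0]: [S_t(x a) Omega = S_t(x) a Omega]. *)
Lemma flowE_emb t x : A x -> flowE t (emb x) = emb (flow t x).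
Proof.
move=> Ax; apply/funext => v; rewrite /flowE /emb /= -/(flow_op t).
apply: (@eq_closure _ _ (@A0_orbit R B) (flow_op t \o x) (flow t x)).
- by apply: BH_comp; [exact: flow_op_BH|exact: A_BH].
- by apply: A_BH; exact: flow_in.
- move=> _ [a Aa <-] /=; have Aa' := A0_A Aa.
  rewrite -[x (a Om)]/((x \o a) Om) flow_opE; last exact: (vN_comp (A_vN B)).
  by rewrite flow_comp// (flow_A0 _ Aa).
- exact: e0_in.
Qed.

Lemma E0_flow t m : A m -> E0 (flow t m) = E0 m.
Proof.
move=> Am; have Ef := flow_in t Am; symmetry.
apply: (condexp_unique (A0_vN B) (@A0_A _ B) (@E0_condexp R B)) => //.
  exact: E0_in.
move=> b Ab; have Ab' := A0_A Ab.
have := E0_dot Am Ab (vN_id (A0_vN B)); rewrite /rd /= => ->.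
by rewrite -{2}(flow_A0 t Ab) flow_dot.
Qed.

Lemma E0_id a : A0 a -> E0 a = a.
Proof. by case: (@E0_condexp R B) => -[_ h _ _ _ _]; exact: h. Qed.

Section Disjoint.
Variables (I J : set R).
Hypotheses (iI : is_interval I) (iJ : is_interval J) (IJ : I `&` J = set0).

(** The conditional expectation onto the algebra of [I] agrees with [E0] on the
algebra of [J]: the factorization of [E0 (z m)] for [z] in the algebra of [I]
gives [psi(z m) = psi(E0(z) E0(m)) = psi(z E0(m))]. *)
Lemma indep_dot m x y : filt J m -> filt I x -> filt I y ->
  hdot B (m (x Om)) (y Om) = hdot B (E0 m (x Om)) (y Om).
Proof.
move=> Jm Ix Iy; have [A0I _ ind] := @filt_indep R B I J iI iJ IJ.
have [vI IA [E cE]] := @filt_subalg R B I iI.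
have Am := filt_A iJ Jm.
have AEm := E0_in Am.
suff -> : E0 m = E m by rewrite (condexp_dot vI IA cE).
apply: (condexp_unique vI IA cE) => //; first exact: A0I.
move=> b Ib; have Ab := IA _ Ib; have Ib' := vN_adj vI Ib; have Ab' := IA _ Ib'.
have v0 := A0_vN B; have vA := A_vN B.
have [_ _ hE hp] := @E0_condexp R B.
suff : psi (adj b \o E0 m) = psi (adj b \o m) by rewrite !psiE// => h; rewrite /rd h.
rewrite -[RHS]hp; last exact: (vN_comp vA).
rewrite ind// -[LHS]hp; last by apply: (vN_comp vA) => //; exact: A0_A.
by congr psi; apply: (hE idfun (adj b) (E0 m)) => //; exact: vN_id.
Qed.

End Disjoint.

Lemma square_summable_single (v : B) :
  square_summable (fun n => if n == 0%N then v else 0).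
Proof.
apply: (@is_cvg_near_cst _ _ (`|v| ^+ 2)); exists 1%N => // -[//|n] _.
rewrite /series /= big_mkord big_ord_recl /= big1 ?addr0// => i _.
by rewrite normr0 expr0n.
Qed.

Lemma vector_predual (v w : B) : predual A (fun z => hdot B (z v) w).
Proof.
exists (fun n => if n == 0%N then v else 0), (fun n => if n == 0%N then w else 0).
split; [exact: square_summable_single|exact: square_summable_single|].
move=> x Ax; apply: cvg_near_cst; exists 1%N => // -[//|n] _.
rewrite /series /= big_mkord big_ord_recl /= big1 ?addr0// => i _.
by rewrite linear0r.
Qed.

(** The flow pushes the interval of [m] to the right by [e > 0], away from the
interval of [x] and [y], without changing [E0 m]; then [e] tends to 0 by
weak* continuity. *)
Lemma touching_dot (s t : R) m x y : filt [set` `[s, t]] m ->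
  filt [set` `[0, s]] x -> filt [set` `[0, s]] y ->
  hdot B (m (x Om)) (y Om) = hdot B (E0 m (x Om)) (y Om).
Proof.
move=> fm fx fy.
have iv (a b : R) : is_interval [set` `[a, b]] by exact: interval_is_interval.
have Am := filt_A (iv _ _) fm.
pose phi z : R[i]^o := hdot B (z (x Om)) (y Om).
have shift e : 0 < e -> phi (flow e m) = phi (E0 m).
  move=> e0; rewrite -(E0_flow e Am);
    apply: (@indep_dot [set` `[0, s]] [set` `[s + e, t + e]]) => //.
    apply/seteqP; split=> // r [/=]; rewrite !in_itv /= => /andP[_ h1] /andP[h2 _]; lra.
  by have := filt_flow e fm.
have c0 : (phi (flow r m) : R[i]^o) @[r --> (0 : R)] --> phi (flow 0 m).
  exact: (@flow_cont R B m Am _ (vector_predual (x Om) (y Om)) 0).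
apply/eqP; rewrite -/(phi m) -/(phi (E0 m)) -subr_eq0 -normr_eq0; apply/eqP.
apply/eqP; rewrite eq_le normr_ge0 andbT.
apply/ler_addgt0Pr => e e0; rewrite add0r.
move/cvgrPdist_lt : c0 => /(_ e e0); rewrite flow0// => /nbhs_ballP[d /= d0 h].
have d2 : 0 < d / 2 by rewrite divr_gt0.
rewrite -(shift _ d2) ltW//; apply: h; rewrite -ball_normE /= sub0r normrN gtr0_norm//.
by rewrite ltr_pdivrMr// ltr_pMr// ltr1n.
Qed.

End Flow.

(** * Norm continuous contraction semigroups *)

Section SemigroupRate.
Context {R : realType} {H : hilbertType R}.

(** Let [|a_s - 1| <= 1/4] for [s <= tau], and let [n h <= tau].  The terms
[a_(kh) (a_h - 1)] for [k < n] add up to [a_(nh) - 1]; replacing each [a_(kh)]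
by 1 gives [n |(a_h - 1) v| <= |v| / 4 + n |(a_h - 1) v| / 4]. *)
Lemma semigroup_rate (a : R -> op H) :
  (forall r : R, 0 <= r -> linear (a r)) -> (forall r : R,
    0 <= r -> bounded_by 1 (a r)) ->
  a 0 = idfun -> (forall s t : R, 0 <= s -> 0 <= t -> a (s + t) = a s \o a t) ->
  (forall e : R, 0 < e -> exists2 d : R, 0 < d &
     forall r : R, 0 <= r -> r < d -> bounded_by e ((a r : H -> H) - idfun)) ->
  exists2 C : R, 0 < C & forall h : R,
    0 <= h -> bounded_by (C * h) ((a h : H -> H) - idfun).
Proof.
move=> al a1 a0 aD ac.
have [|d d0 da] := ac (1 / 4); first by rewrite divr_gt0.
pose tau := d / 2; have t0 : 0 < tau by rewrite divr_gt0.
have {}da r : 0 <= r -> r <= tau -> bounded_by (1 / 4) ((a r : H -> H) - idfun).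
  by move=> r0 rt; apply: da => //; rewrite /tau in rt t0; lra.
exists (2 / tau); first by rewrite divr_gt0.
move=> h h0 v; rewrite !fctE /=; set w := a h v - v.
have [h00|hp] := leP h 0.
  have e : h = 0 by apply/eqP; rewrite eq_le h0 h00.
  by rewrite /w e a0 /= subrr rn0 mulr0 mul0r.
have [ht|th] := leP h tau; last first.
  apply: le_trans (rnB_le _ _) _; have := a1 _ h0 v => h1.
  have : 2 * rn v <= 2 / tau * h * rn v.
    rewrite ler_wpM2r ?rn_ge0// mulrAC ler_pdivlMr//; lra.
  by lra.
have telescope n : n%:R * h <= tau ->
    rn ((n%:R)%:C *: w - (a (n%:R * h) v - v)) <= n%:R * (1 / 4) * rn w.
  elim: n => [|n IH] nh.
    by rewrite !mul0r a0 /= subrr subr0 rnZr normr0 mul0r.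
  have nh' : n%:R * h <= tau by apply: le_trans nh; rewrite ler_wpM2r// ler_nat.
  have n0 : 0 <= n%:R * h by rewrite mulr_ge0.
  have -> : n.+1%:R * h = n%:R * h + h by rewrite -natr1 mulrDl mul1r.
  rewrite aD//= -natr1.
  have -> : (n%:R + 1)%:C *: w - (a (n%:R * h) (a h v) - v) =
    (n%:R%:C *: w - (a (n%:R * h) v - v)) - (a (n%:R * h) w - w).
    by rewrite /w (linB (al _ n0)); move: (a (n%:R * h) _) (a (n%:R * h) _) => p q; vec.
  apply: le_trans (rnB_le _ _) _.
  by have := IH nh'; have := da _ n0 nh' w; rewrite !fctE /=; lra.
pose n := Num.truncn (tau / h).
have n1 : n%:R * h <= tau.
  by rewrite -ler_pdivlMr//; have /andP[] // := truncn_itv (divr_ge0 (ltW t0) h0).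
have n2 : tau < n.+1%:R * h by rewrite -ltr_pdivrMr//; exact: truncnS_gt.
have nn : 1 <= n%:R :> R.
  rewrite ler1n /n truncn_gt0.
  by rewrite ler_pdivlMr// mul1r.
have h1 := telescope n n1.
have h2 : rn (a (n%:R * h) v - v) <= 1 / 4 * rn v.
  by have := da _ (mulr_ge0 (ler0n _ n) h0) n1 v.
have h3 := rnD ((n%:R)%:C *: w - (a (n%:R * h) v - v)) (a (n%:R * h) v - v).
rewrite subrK rnZr ger0_norm// in h3.
have h4 : n%:R * rn w <= 1 / 3 * rn v by lra.
have h5 : tau <= 2 * (n%:R * h).
  rewrite -natr1 in n2; have : h <= n%:R * h by rewrite ler_peMl.
  lra.
rewrite mulrAC -[leRHS]mulrA -ler_pdivrMl ?divr_gt0// invf_div.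
have h6 := ler_wpM2r (rn_ge0 w) h5.
have h7 := ler_wpM2r h0 h4.
have := mulr_ge0 (rn_ge0 v) h0.
lra.
Qed.

End SemigroupRate.

(** * Unitary cocycles and their means *)

(** Times range over [R], which keeps them in an ordered field; the values at
negative times are arbitrary. *)
Record cocycle {R : realType} (B : bernoulli_shift R) (U : R -> op B) : Prop := Cocycle {
  cocycle_filt : forall r : R, 0 <= r -> @filt R B [set` `[0, r]] (U r);
  cocycle_isom : forall r : R, 0 <= r -> forall v w, rd (U r v) (U r w) = rd v w;
  cocycleD : forall s t : R, 0 <= s -> 0 <= t -> U (s + t) = flow t (U s) \o U t;
  cocycle_cont : forall e : R, 0 < e -> exists2 d : R, 0 < d &
    forall r : R, 0 <= r -> r < d -> forall a, @A0 R B a ->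
      rn (U r (a (Omega B)) - a (Omega B)) <= e * rn (a (Omega B)) }.

Section Increments.
Context {R : realType} {B : bernoulli_shift R}.
Local Notation A := (@alg R B).
Local Notation A0 := (@A0 R B).
Local Notation Om := (Omega B).
Local Notation E0 := (@E0 R B).
Local Notation e0 := (e0 (B := B)).
Local Notation flow := (@flow R B).
Local Notation filt := (@filt R B).
Implicit Types (x y z m : op B) (t s r : R).

Lemma E0_sub x y : A x -> A y -> E0 ((x : B -> B) - y) = (E0 x : B -> B) - E0 y.
Proof.
move=> Ax Ay; case: (@E0_condexp R B) => -[_ _ h] _ _ _.
by rewrite addrC -scaleN1r h// scaleN1r addrC.
Qed.

(** The compression [e0 z^* z e0] is symmetric with quadratic form [|z e0 v|^2],
and it acts as [E0(z^* z)] on [A0 Omega]; [A0_bound] extends the bound to all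
vectors. *)
Lemma E0_gram_bound z (q : R) : A z -> 0 <= q ->
  (forall a, A0 a -> rn (z (a Om)) ^+ 2 <= q * rn (a Om) ^+ 2) ->
  bounded_by q (E0 (adj z \o z)).
Proof.
move=> Az q0 h; have bz := A_BH Az.
have Azz : A (adj z \o z) by apply: (vN_comp (A_vN B)) => //; exact: (vN_adj (A_vN B)).
apply: A0_bound => //; first exact: E0_in.
move=> a Aa; rewrite -e0_E0//=.
pose T : op B := e0 \o ((adj z \o z) \o e0).
have bT : BH T.
  by apply: BH_comp; [exact: e0_BH|apply: BH_comp; [exact: A_BH|exact: e0_BH]].
have TE v w : rd (T v) w = rd (z (e0 v)) (z (e0 w)).
  by rewrite /T /= e0_adj -rd_adjr.
have sT v w : rd (T v) w = rd v (T w) by rewrite [RHS]rdC !TE rdC.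
have hz v : closure (@A0_orbit R B) v -> rn (z v) <= Num.sqrt q * rn v.
  move: v; apply: bound_closure => // _ [b Ab <-].
  rewrite -(@ler_pXn2r _ 2%N)// ?nnegrE ?rn_ge0 ?mulr_ge0 ?rn_ge0 ?sqrtr_ge0//.
  by rewrite exprMn sqr_sqrtr// h.
have := @selfadj_bound _ _ T q (BH_linear bT) sT _ (a Om).
rewrite /T /= e0_A0_orbit//; apply => v.
rewrite TE -rn_sq ger0_norm ?exprn_ge0 ?rn_ge0//.
have := hz _ (@e0_in R B v).
rewrite -(@ler_pXn2r _ 2%N)// ?nnegrE ?rn_ge0 ?mulr_ge0 ?rn_ge0 ?sqrtr_ge0//.
rewrite exprMn sqr_sqrtr// => /le_trans; apply; rewrite ler_wpM2l//.
by rewrite ler_pXn2r ?nnegrE ?rn_ge0// e0_bound.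
Qed.

Variables (U : R -> op B).
Hypothesis cU : cocycle U.

Lemma cocycle_A r : 0 <= r -> A (U r).
Proof. by move=> /(cocycle_filt cU); apply: filt_A; exact: itvP. Qed.

Lemma rn_cocycle r v : 0 <= r -> rn (U r v) = rn v.
Proof.
move=> r0; apply/eqP; rewrite -(@eqrXn2 _ 2%N) ?rn_ge0// !rn_sq.
by rewrite (cocycle_isom cU).
Qed.

Lemma cocycle_lin r : 0 <= r -> linear (U r).
Proof. by move=> /cocycle_A/A_BH[]. Qed.

Lemma cocycle0 : U 0 = idfun.
Proof.
apply/funext => v /=; apply/eqP; rewrite -subr_eq0; apply/eqP/rn0_eq.
have u0 : A (U 0) by apply: cocycle_A.
rewrite -(rn_cocycle _ (lexx 0)) (linB (cocycle_lin (lexx 0))).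
have := cocycleD cU (lexx 0) (lexx 0); rewrite addr0 flow0// => e.
by rewrite -[U 0 (U 0 v)]/((U 0 \o U 0) v) -e subrr rn0.
Qed.

Lemma mean_bound r : 0 <= r -> bounded_by 1 (E0 (U r)).
Proof.
move=> r0; apply: A0_bound => //; first exact/E0_in/cocycle_A.
move=> a Aa; rewrite -e0_E0//; last exact: cocycle_A.
by rewrite mul1r (le_trans (e0_bound _))// rn_cocycle.
Qed.

(** The factors of [U_(s+t) = S_t(U_s) U_t] belong to intervals that share the
point [t]. *)
Lemma mean_semigroup s t : 0 <= s -> 0 <= t -> E0 (U (s + t)) = E0 (U s) \o E0 (U t).
Proof.
move=> s0 t0; have st0 := addr_ge0 s0 t0; symmetry.
have [As At] := (cocycle_A s0, cocycle_A t0); have v0 := A0_vN B.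
apply: (condexp_unique v0 (@A0_A _ B) (@E0_condexp R B)); first exact: cocycle_A.
  by apply: (vN_comp v0); exact: E0_in.
move=> b Ab; rewrite cocycleD//= .
have h : filt [set` `[t, s + t]] (flow t (U s)).
  by have := filt_flow t (cocycle_filt cU s0); rewrite add0r.
have -> : rd (flow t (U s) (U t Om)) (b Om) = rd (E0 (flow t (U s)) (U t Om)) (b Om).
  by rewrite /rd (touching_dot h (cocycle_filt cU t0))//; exact: A0_filt.
rewrite E0_flow//.
have As' := E0_in As; have bs := A_BH (A0_A As').
have Ab' : A0 (adj (E0 (U s)) \o b) by apply: (vN_comp v0) => //; exact: (vN_adj v0).
rewrite rd_adj// [RHS]rd_adj//.
by have := E0_dot At Ab' (vN_id v0); rewrite /rd /= => ->.
Qed.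

Lemma mean_rate : exists2 C : R, 0 < C & forall h : R, 0 <= h ->
  bounded_by (C * h) (E0 ((U h : B -> B) - idfun)).
Proof.
have v0 := A0_vN B; have vA := A_vN B.
have E0W h : 0 <= h -> E0 ((U h : B -> B) - idfun) = (E0 (U h) : B -> B) - idfun.
  by move=> h0; rewrite E0_sub ?(E0_id (vN_id v0))//; [exact: cocycle_A|exact: vN_id].
have [|||||C C0 CP] := @semigroup_rate _ _ (fun r => E0 (U r)).
- by move=> r /cocycle_A/E0_in/A0_A/A_BH[].
- exact: mean_bound.
- by rewrite cocycle0 E0_id//; exact: vN_id.
- exact: mean_semigroup.
- move=> e ep; have [d d0 hd] := cocycle_cont cU ep; exists d => // r r0 rd.
  have AW : A ((U r : B -> B) - idfun) by apply: (vN_sub vA);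
    [exact: cocycle_A|exact: vN_id].
  rewrite -E0W//; apply: A0_bound => //; [exact: E0_in|exact: ltW|].
  by move=> a Aa; rewrite -e0_E0// (le_trans (e0_bound _))//; exact: hd.
- by exists C => // h h0; rewrite E0W//; exact: CP.
Qed.

End Increments.

(** * Increments and refinement of partitions *)

Section Refinement.
Context {R : realType} {B : bernoulli_shift R}.
Local Notation A := (@alg R B).
Local Notation A0 := (@A0 R B).
Local Notation Om := (Omega B).
Local Notation E0 := (@E0 R B).
Local Notation e0 := (e0 (B := B)).
Local Notation flow := (@flow R B).
Local Notation filt := (@filt R B).
Implicit Types (x y m : op B) (s k : R).

Variables (U : R -> op B) (C : R).
Hypothesis cU : cocycle U.
Hypothesis C0 : 0 < C.
Hypothesis rate : forall h : R,
  0 <= h -> bounded_by (C * h) (E0 ((U h : B -> B) - idfun)).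

Definition incr (h : R) : op B := (U h : B -> B) - idfun.
Definition incr_at s k : op B := flow s (incr k).
Definition mart_at s k : op B := (incr_at s k : B -> B) - E0 (incr k).

Lemma incr_filt h : 0 <= h -> filt [set` `[0, h]] (incr h).
Proof.
move=> h0; have vI := filt_vN B (@itvP _ 0 h).
by apply: (vN_sub vI); [exact: cocycle_filt|exact: (vN_id vI)].
Qed.

Lemma incr_A h : 0 <= h -> A (incr h).
Proof. by move=> h0; apply: filt_A (incr_filt h0); exact: itvP. Qed.

(** [U_h] is isometric, so [|(U_h - 1) xi|^2 = - 2 Re <(U_h - 1) xi, xi>], where
[e0] replaces [U_h - 1] by its mean. *)
Lemma incr_bound h b : 0 <= h -> A0 b ->
  rn (incr h (b Om)) ^+ 2 <= 2 * C * h * rn (b Om) ^+ 2.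
Proof.
move=> h0 Ab; rewrite /incr !fctE /= rn_sqB rn_cocycle//.
have h1 : - rd (incr h (b Om)) (b Om) <= C * h * rn (b Om) ^+ 2.
  rewrite -{2}(e0_A0_orbit Ab) -e0_adj e0_E0//; last exact: incr_A.
  rewrite lerNl; apply: le_trans (rd_ge _ _).
  by rewrite lerN2 expr2 mulrA ler_wpM2r ?rn_ge0//; exact: rate.
rewrite /incr !fctE /= rdBl -rn_sq in h1; lra.
Qed.

Lemma incr_at_filt s k : 0 <= k -> filt [set` `[s, s + k]] (incr_at s k).
Proof.
by move=> k0; have := filt_flow s (incr_filt k0); rewrite add0r (addrC k).
Qed.

Lemma incr_at_A s k : 0 <= k -> A (incr_at s k).
Proof. by move=> k0; apply/flow_in/incr_A. Qed.

Lemma E0_incr_at s k : 0 <= k -> E0 (incr_at s k) = E0 (incr k).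
Proof. by move=> k0; rewrite E0_flow//; exact: incr_A. Qed.

Lemma incr_at0 s : incr_at s 0 = 0 :> (B -> B).
Proof.
rewrite /incr_at /incr cocycle0// subrr; apply: flow_A0; exact: (vN_0 (A0_vN B)).
Qed.

Lemma incr_at_bound s k b : 0 <= k -> A0 b ->
  rn (incr_at s k (b Om)) ^+ 2 <= 2 * C * k * rn (b Om) ^+ 2.
Proof.
move=> k0 Ab; have Ab' := A0_A Ab.
rewrite -{1}(flow_A0 s Ab) /incr_at
  -[flow s (incr k) _]/((flow s (incr k) \o flow s b) Om).
rewrite -flow_comp//; last exact: incr_A.
rewrite rn_flow; first exact: incr_bound.
by apply: (vN_comp (A_vN B)) => //; exact: incr_A.
Qed.

Lemma mart_at_filt s k : 0 <= k -> filt [set` `[s, s + k]] (mart_at s k).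
Proof.
move=> k0; apply: (vN_sub (filt_vN B (@itvP _ _ _))); first exact: incr_at_filt.
by apply: A0_filt; apply/E0_in/incr_A.
Qed.

Lemma mart_at_A s k : 0 <= k -> A (mart_at s k).
Proof. by move=> k0; apply: filt_A (mart_at_filt s k0); exact: itvP. Qed.

Lemma E0_mart_at s k : 0 <= k -> E0 (mart_at s k) = 0 :> (B -> B).
Proof.
move=> k0; have AEW := E0_in (incr_A k0).
rewrite /mart_at E0_sub; [|exact: incr_at_A|exact: A0_A].
by rewrite E0_incr_at// (E0_id AEW) subrr.
Qed.

(** Orthogonality of a martingale difference to the past. *)
Lemma mart_at_orth s k x y : 0 <= k -> filt [set` `[0, s]] x -> filt [set` `[0, s]] y ->
  rd (mart_at s k (x Om)) (y Om) = 0.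
Proof.
by move=> k0 fx fy; rewrite /rd (touching_dot (mart_at_filt s k0) fx fy) E0_mart_at//
  linear0l.
Qed.

(** Independence replaces [m^* m] by [E0(m^* m)], which is estimated on
[A0 Omega]; there, subtracting the mean is an orthogonal projection and only
decreases the norm. *)
Lemma mart_at_bound s k y : 0 <= k -> filt [set` `[0, s]] y ->
  rn (mart_at s k (y Om)) ^+ 2 <= 2 * C * k * rn (y Om) ^+ 2.
Proof.
move=> k0 fy; have Am := mart_at_A s k0; have bm := A_BH Am.
have vI := filt_vN B (@itvP _ s (s + k)).
have fmm : filt [set` `[s, s + k]] (adj (mart_at s k) \o mart_at s k).
  by apply: (vN_comp vI); [apply: (vN_adj vI)|]; exact: mart_at_filt.
have q0 : 0 <= 2 * C * k by rewrite !mulr_ge0// ltW.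
have -> : rn (mart_at s k (y Om)) ^+ 2 =
  rd ((adj (mart_at s k) \o mart_at s k) (y Om)) (y Om).
  by rewrite rn_sq rd_adjr.
have -> : rd ((adj (mart_at s k) \o mart_at s k) (y Om)) (y Om)
   = rd (E0 (adj (mart_at s k) \o mart_at s k) (y Om)) (y Om).
  by rewrite /rd (touching_dot fmm fy fy).
apply: le_trans (rd_le _ _) _.
rewrite expr2 mulrA ler_wpM2r ?rn_ge0//.
apply: E0_gram_bound => // b Ab.
apply: le_trans (incr_at_bound s k0 Ab).
rewrite /mart_at [X in rn X]/(incr_at s k (b Om) - E0 (incr k) (b Om)) rn_sqB.
have -> : rd (incr_at s k (b Om)) (E0 (incr k) (b Om)) = rn (E0 (incr k) (b Om)) ^+ 2.
  have AW := E0_in (incr_A k0).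
  have hE : e0 (E0 (incr k) (b Om)) = E0 (incr k) (b Om).
    exact: e0_A0_orbit (vN_comp (A0_vN B) AW Ab).
  rewrite rn_sq -{1}hE -e0_adj e0_E0//.
    by rewrite E0_incr_at.
  exact: incr_at_A.
have := exprn_ge0 2 (rn_ge0 (E0 (incr k) (b Om))); lra.
Qed.

Fixpoint incr_sum (s : R) (f : seq R) : B -> B :=
  if f is s' :: f' then (incr_at s (s' - s) : B -> B) + incr_sum s' f' else 0.

Definition mesh_step (dl : R) : rel R := fun a b => (a < b) && (b - a <= dl).

Lemma mesh_step_lt dl s f : path (mesh_step dl) s f -> path <%R s f.
Proof. by apply: sub_path => a b /andP[]. Qed.

Lemma path_last s (f : seq R) : path <%R s f -> s <= last s f.
Proof.
elim: f s => [|s' f IH] s //= /andP[ss' /IH]; apply: le_trans; exact: ltW.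
Qed.

(** In terms of [1 + x]: the cocycle identity
[U_(s'-c) = S_(s-c)(U_(s'-s)) U_(s-c)], transported by [S_c]. *)
Lemma incr_at_split c s s' : 0 <= c -> c <= s -> s <= s' ->
  incr_at c (s' - c) = (incr_at c (s - c) : B -> B) + incr_at s (s' - s)
    + (incr_at s (s' - s) \o incr_at c (s - c)).
Proof.
move=> c0 cs ss'; have sc : 0 <= s - c by rewrite subr_ge0.
have s's : 0 <= s' - s by rewrite subr_ge0.
have s'c : 0 <= s' - c by rewrite subr_ge0 (le_trans cs).
have FW r h : 0 <= h -> incr_at r h = (flow r (U h) : B -> B) - idfun.
  move=> h0; rewrite /incr_at /incr flow_sub ?flow_id//; first exact: cocycle_A.
  exact: (vN_id (A_vN B)).
rewrite !FW//; apply/funext => v; rewrite !fctE /=.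
have -> : U (s' - c) = flow (s - c) (U (s' - s)) \o U (s - c).
  by rewrite -(cocycleD cU)// addrA subrK.
have As's := cocycle_A cU s's; have Asc := cocycle_A cU sc.
rewrite flow_comp//; last exact: flow_in.
rewrite -flowD// (_ : c + (s - c) = s) /=; last by rewrite addrC subrK.
have lf : linear (flow s (U (s' - s))) by have [] := A_BH (flow_in s As's).
rewrite (linB lf).
by vec.
Qed.

(** Here [f] is the rest of the fine partition after the point [s], and [z] the
rest of the coarse one after its last point [c <= s].  Each fine step contributes
the product of two increments: the one over the step, split into a martingale
difference (collected in [Mt]) and a mean (collected in [Dt]), and the one from
[c] to [s].  The past [M0] in the second clause makes the induction work: the
squared norms of successive martingale differences add up. *)
Lemma refinement_difference (dl : R) (f : seq R) : forall c s (z : seq R),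
  0 <= c -> c <= s -> s - c <= dl ->
  path <%R s f -> path (mesh_step dl) c z -> {subset z <= f} -> last s f = last c z ->
  (forall (z1 : R) (z' : seq R), z = z1 :: z' -> s < z1) ->
  exists Mt Dt : B -> B,
  [/\ incr_sum c z = (incr_at c (s - c) : B -> B) + incr_sum s f + (Mt + Dt),
      forall M0 a, filt [set` `[0, s]] M0 -> A0 a ->
        rn ((M0 : B -> B) (a Om) + Mt (a Om)) ^+ 2 <= rn (M0 (a Om)) ^+ 2
          + 2 * C * (last s f - s) * (2 * C * dl) * rn (a Om) ^+ 2,
      forall a, A0 a -> rn (Dt (a Om)) <=
        C * (last s f - s) * Num.sqrt (2 * C * dl) * rn (a Om) &
      forall a b, A0 a -> A0 b -> rd (Mt (a Om)) (b Om) = 0].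
Proof.
elim: f => [|s' f IH] c s z c0 cs scd /= pf pz zf lst hz.
  have zn : z = [::].
    by case: z {pz hz lst} zf => // z1 z' /(_ z1); rewrite inE eqxx => /(_ isT).
  move: lst; rewrite zn /= => sc; exists 0, 0; split.
  - by rewrite sc subrr incr_at0 !addr0.
  - by move=> M0 a _ _; rewrite fun0E addr0 subrr !(mulr0, mul0r) addr0.
  - by move=> a _; rewrite fun0E rn0 subrr !(mulr0, mul0r).
  - by move=> a b _ _; rewrite fun0E rd0l.
case/andP: pf => ss' pf.
have s0 : 0 <= s := le_trans c0 cs.
have cs' : c <= s' := le_trans cs (ltW ss').
have k0 : 0 <= s' - s by rewrite subr_ge0 ltW.
have sc0 : 0 <= s - c by rewrite subr_ge0.
have s'T := path_last pf.
have dl0 : 0 <= dl := le_trans sc0 scd.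
have [Mt [Dt [e1 e2 e3 e4]]] : exists Mt Dt : B -> B,
  [/\ incr_sum c z = (incr_at c (s' - c) : B -> B) + incr_sum s' f + (Mt + Dt),
      forall M0 a, filt [set` `[0, s']] M0 -> A0 a ->
        rn ((M0 : B -> B) (a Om) + Mt (a Om)) ^+ 2 <= rn (M0 (a Om)) ^+ 2
          + 2 * C * (last s' f - s') * (2 * C * dl) * rn (a Om) ^+ 2,
      forall a, A0 a -> rn (Dt (a Om)) <=
        C * (last s' f - s') * Num.sqrt (2 * C * dl) * rn (a Om) &
      forall a b, A0 a -> A0 b -> rd (Mt (a Om)) (b Om) = 0].
  case: z pz zf lst hz => [_ _ /= lst _|z1 z' /= /andP[/andP[cz1 z1d] pz] zf lst hz].
    by exfalso; move: s'T; rewrite lst leNgt (le_lt_trans cs ss').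
  have minf : all (fun r => s' < r) f by rewrite order_path_min//; exact: lt_trans.
  have z1s' : s' <= z1.
    have := zf z1; rewrite !inE eqxx => /(_ isT) /orP[/eqP ->//|].
    by move/(allP minf)/ltW.
  have minz : all (fun r => z1 < r) z'.
    by apply: order_path_min; [exact: lt_trans|exact: mesh_step_lt pz].
  have zf' : {subset z' <= f}.
    move=> r rz'; have := zf r; rewrite !inE rz' orbT => /(_ isT) /orP[/eqP re|//].
    by have := allP minz _ rz'; rewrite re ltNge z1s'.
  (* Either the fine step ends at the next coarse point, which becomes the new
     [c], or it stays inside the coarse interval. *)
  have [e|ne] := eqVneq z1 s'.
    subst z1; have [||||||||Mt [Dt [e1 e2 e3 e4]]] := IH s' s' z' => //.
    - exact: le_trans cs'.
    - by rewrite subrr.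
    - by move=> z2 z'' ez; move: minz; rewrite ez /= => /andP[].
    exists Mt, Dt; split=> //.
    by rewrite e1 subrr incr_at0 add0r addrA.
  have s'z1 : s' < z1 by rewrite lt_neqAle eq_sym ne.
  have [||||||||Mt [Dt [e1 e2 e3 e4]]] := IH c s' (z1 :: z') => //.
  - by apply: le_trans z1d; rewrite lerD2r ltW.
  - by rewrite /= /mesh_step cz1 z1d.
  - move=> r; rewrite inE => /orP[/eqP ->|/zf'//].
    have := zf z1; rewrite !inE eqxx => /(_ isT) /orP[/eqP e|//].
    by move: ne; rewrite e eqxx.
  - by move=> z2 z'' [<- _].
  by exists Mt, Dt.
pose x : op B := incr_at s (s' - s); pose y : op B := incr_at c (s - c).
pose m : op B := mart_at s (s' - s); pose d : op B := E0 (incr (s' - s)).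
have fy : filt [set` `[0, s]] y.
  by have := incr_at_filt c sc0; rewrite addrC subrK; exact: filt_ge.
have Ay : A y by exact: incr_at_A.
have fy' : filt [set` `[0, s']] y by apply: filt_le fy; exact: ltW.
have fm : filt [set` `[0, s']] m.
  by have := mart_at_filt s k0; rewrite addrC subrK; exact: filt_ge.
have ybound a : A0 a -> rn (y (a Om)) ^+ 2 <= 2 * C * dl * rn (a Om) ^+ 2.
  move=> Aa; apply: le_trans (incr_at_bound _ sc0 Aa) _.
  by rewrite ler_wpM2r ?exprn_ge0 ?rn_ge0// ler_wpM2l// mulr_ge0// ltW.
have vI := filt_vN B (@itvP _ 0 s); have vI' := filt_vN B (@itvP _ 0 s').
exists ((m \o y : B -> B) + Mt), ((d \o y : B -> B) + Dt); split.
- rewrite e1 (incr_at_split c0 cs (ltW ss')) -/x -/y.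
  have h (v1 v2 v3 v4 v5 v6 v7 : B) : v1 + v2 + (v3 + v4) + v5 + (v6 + v7)
      = v1 + (v2 + v5) + (v3 + v6 + (v4 + v7)) by vec.
  apply/funext => v.
  have e : x (y v) = m (y v) + d (y v) by rewrite /m /mart_at !fctE subrK.
  pose g w := y v + x v + w + incr_sum s' f v + (Mt v + Dt v).
  exact: etrans (congr1 g e) (h _ _ _ _ _ _ _).
- move=> M0 a fM Aa.
  have fM' : filt [set` `[0, s']] ((M0 : B -> B) + (m \o y)).
    apply: (vN_add vI'); first by apply: filt_le fM; exact: ltW.
    exact: (vN_comp vI').
  have := e2 _ a fM' Aa.
  rewrite !fctE /= -addrA => /le_trans; apply.
  have -> : rn (M0 (a Om) + m (y (a Om))) ^+ 2 = rn (M0 (a Om)) ^+ 2 +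
    rn (m (y (a Om))) ^+ 2.
    rewrite rn_sqD [rd _ _]rdC.
    rewrite (@mart_at_orth s _ (y \o a) (M0 \o a))// ?mulr0 ?addr0//.
      by apply: (vN_comp vI) => //; exact: A0_filt.
    by apply: (vN_comp vI) => //; exact: A0_filt.
  have h1 : rn (m (y (a Om))) ^+ 2 <= 2 * C * (s' - s) * rn (y (a Om)) ^+ 2.
    apply: (@mart_at_bound s _ (y \o a)) => //; apply: (vN_comp vI) => //; exact: A0_filt.
  have q0 : 0 <= 2 * C * (s' - s) by rewrite !mulr_ge0// ltW.
  have h2 := ler_wpM2l q0 (ybound a Aa).
  have -> : last s' f - s = (last s' f - s') + (s' - s) by rewrite addrA subrK.
  lra.
- move=> a Aa; rewrite !fctE /=.
  apply: le_trans (rnD _ _) _; apply: le_trans (lerD (lexx _) (e3 a Aa)) _.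
  have h1 : rn (d (y (a Om))) <= C * (s' - s) * rn (y (a Om)) by exact: rate.
  have h2 : rn (y (a Om)) <= Num.sqrt (2 * C * dl) * rn (a Om).
    rewrite -(@ler_pXn2r _ 2%N)// ?nnegrE ?rn_ge0 ?mulr_ge0 ?rn_ge0 ?sqrtr_ge0//.
    by rewrite exprMn sqr_sqrtr ?ybound// !mulr_ge0// ltW.
  have h3 : 0 <= C * (s' - s) by rewrite mulr_ge0// ltW.
  have h4 := ler_wpM2l h3 h2.
  have -> : last s' f - s = (last s' f - s') + (s' - s) by rewrite addrA subrK.
  lra.
- move=> a b Aa Ab; rewrite !fctE /= rdDl e4// addr0.
  apply: (@mart_at_orth s _ (y \o a) b) => //; last exact: A0_filt.
  by apply: (vN_comp vI) => //; exact: A0_filt.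
Qed.

End Refinement.

(** * Partitions of an interval *)

Section Partitions.
Context {R : realType}.
Implicit Types (s t dl : R) (f z : seq R).

Lemma path_le_last s f x : path <%R s f -> x \in f -> x <= last s f.
Proof.
elim: f s => [|s' f IH] s //= /andP[ss' pf]; rewrite inE => /orP[/eqP ->|];
  last exact: IH.
exact: path_last pf.
Qed.

Lemma common_refinement t z1 z2 : path <%R 0 z1 -> path <%R 0 z2 ->
  last 0 z1 = t -> last 0 z2 = t ->
  exists f, [/\ path <%R 0 f, last 0 f = t, {subset z1 <= f} & {subset z2 <= f}].
Proof.
move=> p1 p2 l1 l2; pose f := sort <=%R (undup (z1 ++ z2)).
have mf x : (x \in f) = (x \in z1) || (x \in z2).
  by rewrite mem_sort mem_undup mem_cat.
have gt0 x : x \in f -> 0 < x.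
  rewrite mf => /orP[] h; [move: p1|move: p2];
    by move=> /(order_path_min lt_trans)/allP/(_ x h).
have pf : path <%R 0 f.
  rewrite path_min_sorted; last by apply/allP => x /gt0.
  by rewrite lt_sorted_uniq_le sort_uniq undup_uniq/= sort_le_sorted.
have ft x : x \in f -> x <= t.
  rewrite mf => /orP[] h; first by rewrite -l1 path_le_last.
  by rewrite -l2 path_le_last.
exists f; split=> //; last 2 first.
- by move=> x h; rewrite mf h.
- by move=> x h; rewrite mf h orbT.
have [z1n|z1n] := eqVneq z1 [::].
  have t0 : t = 0 by rewrite -l1 z1n.
  have h : last 0 f \in 0 :: f := mem_last _ _.
  move: h; rewrite inE => /orP[/eqP ->//|h].
  by have := lt_le_trans (gt0 _ h) (ft _ h); rewrite t0 ltxx.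
have tf : t \in f.
  rewrite mf -l1; case: z1 z1n {p1 l1 pf ft gt0 mf f} => // x z _ /=.
  by rewrite mem_last.
apply/eqP; rewrite eq_le path_le_last// andbT.
have : last 0 f \in 0 :: f := mem_last _ _.
by rewrite inE => /orP[/eqP ->|/ft//]; rewrite ltW// gt0.
Qed.

Lemma fine_partition t dl : 0 <= t -> 0 < dl ->
  exists z, path (mesh_step dl) 0 z /\ last 0 z = t.
Proof.
move=> t0 d0.
have gen n s : s <= t -> t <= s + n%:R * dl ->
    exists z, path (mesh_step dl) s z /\ last s z = t.
  elim: n s => [|n IH] s st ts.
    exists [::]; split=> //=; apply/eqP; rewrite eq_le st.
    by rewrite mul0r addr0 in ts.
  have [h|h] := leP t (s + dl).
    have [e|ne] := eqVneq s t; first by exists [::].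
    exists [:: t]; split=> //=; rewrite /mesh_step andbT lt_neqAle ne st /=.
    by rewrite lerBlDr addrC.
  have [|z [pz lz]] := IH (s + dl) (ltW h).
    by move: ts; rewrite -natr1 mulrDl mul1r => ts; lra.
  by exists (s + dl :: z); split=> //=; apply/andP; split=> //;
    rewrite /mesh_step ltrDl d0 /= addrC addKr.
apply: (gen (Num.truncn (t / dl)).+1 0 t0).
by rewrite add0r -ler_pdivrMr// ltW// truncnS_gt.
Qed.

End Partitions.

(** * Convergence of the sums *)

Section Limit.
Context {R : realType} {B : bernoulli_shift R}.
Local Notation A := (@alg R B).
Local Notation A0 := (@A0 R B).
Local Notation Om := (Omega B).
Local Notation E0 := (@E0 R B).
Local Notation e0 := (e0 (B := B)).
Local Notation filt := (@filt R B).

Variables (U : R -> op B) (C : R).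
Hypothesis cU : cocycle U.
Hypothesis C0 : 0 < C.
Hypothesis rate : forall h : R,
  0 <= h -> bounded_by (C * h) (E0 ((U h : B -> B) - idfun)).
Local Notation S := (incr_sum U 0).

Lemma emb_BH (x : op B) : A x -> BH (emb x).
Proof. by move=> Ax; apply: BH_comp; [exact: A_BH|exact: e0_BH]. Qed.

Lemma emb_bound (x : op B) (q : R) : A x -> 0 <= q ->
  (forall a, A0 a -> rn (x (a Om)) <= q * rn (a Om)) -> bounded_by q (emb x).
Proof.
move=> Ax q0 h v.
have hx : forall k, closure (@A0_orbit R B) k -> rn (x k) <= q * rn k.
  by apply: bound_closure => // [|_ [a Aa <-]]; [exact: A_BH|exact: h].
apply: le_trans (hx _ (@e0_in R B v)) _.
by rewrite ler_wpM2l// e0_bound.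
Qed.

Lemma emb_sub (x y : op B) : emb ((x : B -> B) - y) = (emb x : B -> B) - emb y.
Proof. by []. Qed.

Lemma incr_sum_filt s f : 0 <= s -> path <%R s f ->
  filt [set` `[0, last s f]] (incr_sum U s f).
Proof.
elim: f s => [|s' f IH] s s0 /=; first by move=> _;
  exact: (vN_0 (filt_vN B (@itvP _ _ _))).
move=> /andP[ss' pf]; apply: (vN_add (filt_vN B (@itvP _ _ _))); last first.
  by apply: IH => //; exact: le_trans (ltW ss').
have k0 : 0 <= s' - s by rewrite subr_ge0 ltW.
have := incr_at_filt cU s k0; rewrite addrC subrK => h.
by apply: filt_le (path_last pf) (filt_ge s0 h).
Qed.

Lemma incr_sum_A f : path <%R 0 f -> A (S f).
Proof. by move=> pf; apply: filt_A (incr_sum_filt (lexx _) pf); exact: itvP. Qed.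

(** The factor of the square root of the mesh in the effect of refining a
partition of [[0, t]]: the martingale part gives the first term and the drift
the second one. *)
Definition mesh_const (t : R) : R := 2 * C * Num.sqrt t + C * t * Num.sqrt (2 * C).

Lemma mesh_const_ge0 t : 0 <= t -> 0 <= mesh_const t.
Proof. by move=> t0; rewrite /mesh_const addr_ge0// !mulr_ge0 ?sqrtr_ge0// ltW. Qed.

(** The second estimate is of a higher order in [t] than the first one, because
the martingale part is orthogonal to [A0 Omega]. *)
Lemma refine_bound (t dl : R) z f : 0 <= t -> 0 < dl -> path (mesh_step dl) 0 z ->
  path <%R 0 f ->
  {subset z <= f} -> last 0 z = t -> last 0 f = t ->
  (forall a, A0 a -> rn ((S z - S f) (a Om)) <= mesh_const t * Num.sqrt dl * rn (a Om)) /\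
  (forall a b, A0 a -> A0 b -> `|rd ((S z - S f) (a Om)) (b Om)| <=
     C * t * Num.sqrt (2 * C) * Num.sqrt dl * rn (a Om) * rn (b Om)).
Proof.
move=> t0 d0 pz pf zf lz lf.
have dl0 := ltW d0; have C00 := ltW C0.
have [|||Mt [Dt [e1 e2 e3 e4]]] :=
  @refinement_difference _ _ U C cU C0 rate dl f 0 0 z (lexx _) (lexx _) _ pf pz zf.
- by rewrite subrr.
- by rewrite lz.
- by move=> z1 z' e; move: pz; rewrite e /= => /andP[/andP[]].
have SE v : (S z - S f) v = Mt v + Dt v.
  by rewrite e1 subrr (incr_at0 cU) add0r addrAC subrr add0r.
have sE : Num.sqrt (2 * C * dl) = Num.sqrt (2 * C) * Num.sqrt dl
  by rewrite sqrtrM// mulr_ge0.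
rewrite lf subr0 in e2 e3.
have D1 a : A0 a -> rn (Dt (a Om)) <= C * t * Num.sqrt (2 * C) * Num.sqrt dl * rn (a Om).
  by move=> Aa; apply: le_trans (e3 a Aa) _; rewrite sE !mulrA.
split=> [a Aa|a b Aa Ab]; rewrite SE; last first.
  rewrite rdDl e4// add0r; apply: le_trans (rd_abs _ _) _.
  by rewrite ler_wpM2r ?rn_ge0// D1.
apply: le_trans (rnD _ _) _; rewrite /mesh_const mulrDl mulrDl; apply: lerD;
  last exact: D1.
have := e2 0 a (vN_0 (filt_vN B (@itvP _ _ _))) Aa.
rewrite fun0E add0r rn0 expr0n add0r => h.
rewrite -(@ler_pXn2r _ 2%N)// ?nnegrE ?rn_ge0 ?mulr_ge0 ?rn_ge0 ?sqrtr_ge0//.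
apply: le_trans h _; rewrite !exprMn !sqr_sqrtr//.
by rewrite le_eqVlt; apply/orP; left; apply/eqP; ring.
Qed.

Lemma compare_bound (t dl : R) z z' : 0 <= t -> 0 < dl ->
  path (mesh_step dl) 0 z -> path (mesh_step dl) 0 z' -> last 0 z = t -> last 0 z' = t ->
  (forall a, A0 a -> rn ((S z - S z') (a Om)) <= 2 * mesh_const t * Num.sqrt dl *
    rn (a Om)) /\
  (forall a b, A0 a -> A0 b -> `|rd ((S z - S z') (a Om)) (b Om)| <=
     2 * C * t * Num.sqrt (2 * C) * Num.sqrt dl * rn (a Om) * rn (b Om)).
Proof.
move=> t0 d0 pz pz' lz lz'.
have [f [pf lf zf zf']] := common_refinement (mesh_step_lt pz) (mesh_step_lt pz') lz lz'.
have [h1 h2] := refine_bound t0 d0 pz pf zf lz lf.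
have [h1' h2'] := refine_bound t0 d0 pz' pf zf' lz' lf.
have e v : (S z - S z') v = (S z - S f) v - (S z' - S f) v.
  by rewrite !fctE; vec.
split=> [a Aa|a b Aa Ab]; rewrite e.
  by apply: le_trans (rnB_le _ _) _; have := h1 a Aa; have := h1' a Aa; lra.
rewrite rdBl; apply: le_trans (ler_normB _ _) _.
by have := h2 a b Aa Ab; have := h2' a b Aa Ab; lra.
Qed.

Lemma sqrt_small (q e : R) : 0 <= q -> 0 < e -> exists2 dl, 0 < dl & q * Num.sqrt dl < e.
Proof.
move=> q0 e0; have q1 : 0 < q + 1 by rewrite ltr_wpDl.
exists ((e / (q + 1)) ^+ 2); first by rewrite exprn_gt0// divr_gt0.
rewrite sqrtr_sqr ger0_norm; last by rewrite divr_ge0// ltW.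
by rewrite mulrA ltr_pdivrMr// mulrC ltr_pM2l// ltrDl.
Qed.

(** Besides convergence this records how far [b] is from each single sum, also
for coarse partitions; the partition with one interval matters for
injectivity. *)
Definition Ln_limit (t : R) (b : op B) :=
  [/\ BH b,
    forall (dl : R) z, 0 < dl -> path (mesh_step dl) 0 z -> last 0 z = t ->
      bounded_by (2 * mesh_const t * Num.sqrt dl) ((emb (S z) : B -> B) - b) &
    forall (dl : R) z, 0 < dl -> path (mesh_step dl) 0 z -> last 0 z = t ->
      forall a c, A0 a -> A0 c -> `|rd (S z (a Om) - b (a Om)) (c Om)| <=
     2 * C * t * Num.sqrt (2 * C) * Num.sqrt dl * rn (a Om) * rn (c Om)].

Lemma Ln_limit_exists t : 0 <= t -> exists b, Ln_limit t b.
Proof.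
move=> t0; have k0 : 0 <= 2 * mesh_const t by rewrite mulr_ge0// mesh_const_ge0.
have cmp (dl : R) z z' : 0 < dl -> path (mesh_step dl) 0 z -> path (mesh_step dl) 0 z' ->
    last 0 z = t -> last 0 z' = t ->
    bounded_by (2 * mesh_const t * Num.sqrt dl) ((emb (S z) : B -> B) - emb (S z')).
  move=> d0 pz pz' lz lz'; rewrite -emb_sub; apply: emb_bound.
  - by apply: (vN_sub (A_vN B));
    [exact: incr_sum_A (mesh_step_lt pz)|exact: incr_sum_A (mesh_step_lt pz')].
  - by rewrite mulr_ge0 ?sqrtr_ge0.
  - by case: (compare_bound t0 d0 pz pz' lz lz').
have /choice[Z ZP] n : exists z, path (mesh_step n.+1%:R^-1) 0 z /\ last 0 z = t.
  by apply: fine_partition => //; rewrite invr_gt0.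
have Zfine (dl : R) : 0 < dl -> exists N, forall n,
  (N <= n)%N -> path (mesh_step dl) 0 (Z n).
  move=> d0; have [N HN] := inv_small d0; exists N => n /HN nd.
  have [+ _] := ZP n; apply: sub_path => x y /andP[xy h]; apply/andP; split=> //.
  exact: le_trans h (ltW nd).
have [||b bb bP] := @op_complete _ _ (fun n => emb (S (Z n))).
- by move=> n; have [p _] := ZP n; exact: emb_BH (incr_sum_A (mesh_step_lt p)).
- move=> e ep; have [dl d0 hd] := sqrt_small k0 ep; have [N HN] := Zfine _ d0.
  exists N => n m Nn Nm v; have [_ ln] := ZP n; have [_ lm] := ZP m.
  apply: le_trans (cmp _ _ _ d0 (HN _ Nn) (HN _ Nm) ln lm v) _.
  by rewrite ler_wpM2r ?rn_ge0// ltW.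
exists b; split=> // dl z d0 pz lz.
- move=> v; apply: le_eps => e ep.
  have v1 : 0 < rn v + 1 by rewrite ltr_wpDl// rn_ge0.
  have [|N HN] := bP (e / (rn v + 1)); first exact: divr_gt0.
  have [M HM] := Zfine _ d0; pose n := maxn N M.
  have [_ ln] := ZP n.
  have h1 := cmp _ _ _ d0 pz (HM n (leq_maxr _ _)) lz ln v.
  have h2 := HN n (leq_maxl _ _) v.
  apply: le_trans (rn_trid _ (emb (S (Z n)) v) _) _; apply: lerD; first exact: h1.
  apply: le_trans h2 _.
  by rewrite mulrAC ler_pdivrMr// ler_wpM2l ?lerDl//; exact: ltW.
- move=> a c Aa Ac; apply: le_eps => e ep.
  have v1 : 0 < rn (a Om) * rn (c Om) + 1 by rewrite ltr_wpDl// mulr_ge0 ?rn_ge0.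
  have [|N HN] := bP (e / (rn (a Om) * rn (c Om) + 1)); first exact: divr_gt0.
  have [M HM] := Zfine _ d0; pose n := maxn N M.
  have [_ ln] := ZP n.
  have [_ /(_ a c Aa Ac) h1] := compare_bound t0 d0 pz (HM n (leq_maxr _ _)) lz ln.
  have h2 := HN n (leq_maxl _ _) (a Om).
  have e' : S z (a Om) - b (a Om) = (S z - S (Z n)) (a Om) +
    (emb (S (Z n)) (a Om) - b (a Om)).
    by rewrite /emb /= e0_A0_orbit// !fctE addrA subrK.
  rewrite e' rdDl; apply: le_trans (ler_normD _ _) _; apply: lerD; first exact: h1.
  apply: le_trans (rd_abs _ _) _.
  apply: le_trans (ler_wpM2r (rn_ge0 _) h2) _.
  by rewrite -[leLHS]mulrA [leLHS]mulrAC ler_pdivrMr// ler_wpM2l ?lerDl//; exact: ltW.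
Qed.

End Limit.

(** * The limit as an additive cocycle *)

Section LimitProperties.
Context {R : realType} {B : bernoulli_shift R}.
Local Notation A := (@alg R B).
Local Notation A0 := (@A0 R B).
Local Notation Om := (Omega B).
Local Notation E0 := (@E0 R B).
Local Notation e0 := (e0 (B := B)).
Local Notation flow := (@flow R B).
Local Notation filt := (@filt R B).

Variables (U : R -> op B) (C : R).
Hypothesis cU : cocycle U.
Hypothesis C0 : 0 < C.
Hypothesis rate : forall h : R,
  0 <= h -> bounded_by (C * h) (E0 ((U h : B -> B) - idfun)).
Local Notation S := (incr_sum U 0).
Local Notation Ln_limit := (Ln_limit U C).

Lemma Ln_approx t b (e : R) : 0 <= t -> 0 < e -> Ln_limit t b ->
  exists dl z, [/\ 0 < dl, dl < e, path (mesh_step dl) 0 z, last 0 z = t &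
    bounded_by e ((emb (S z) : B -> B) - b)].
Proof.
move=> t0 e0 [_ bP _].
have [|dl d0 hd] := sqrt_small (q := 2 * mesh_const C t) _ e0.
  by rewrite mulr_ge0// mesh_const_ge0.
pose dl' := Num.min dl (e / 2).
have d'0 : 0 < dl' by rewrite lt_min d0 divr_gt0.
have [z [pz lz]] := fine_partition t0 d'0.
exists dl', z; split=> //.
  by rewrite gt_min; apply/orP; right; rewrite ltr_pdivrMr// ltr_pMr// ltr1n.
move=> v; apply: le_trans (bP _ _ d'0 pz lz v) _; rewrite ler_wpM2r ?rn_ge0//.
apply: le_trans (ltW hd); rewrite ler_wpM2l ?mulr_ge0 ?mesh_const_ge0//.
by rewrite ler_sqrt ?(ltW d0)// /dl' ge_min lexx.
Qed.

Lemma Ln_limit_e0 t b v : 0 <= t -> Ln_limit t b -> b (e0 v) = b v.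
Proof.
move=> t0 bL; apply/eqP; rewrite -subr_eq0; apply/eqP/rn_eps => e ep.
have v1 : 0 < 2 * rn v + 1 by rewrite ltr_wpDl// mulr_ge0 ?rn_ge0.
have dp := divr_gt0 ep v1.
have [dl [z [_ _ _ _ h]]] := Ln_approx t0 dp bL.
have h1 := h v; have h2 := h (e0 v).
have -> : b (e0 v) - b v = (emb (S z) v - b v) - (emb (S z) (e0 v) - b (e0 v)).
  by rewrite {2}/emb /= e0_e0 -/(emb (S z) v); vec.
apply: le_trans (rnB_le _ _) _; apply: le_trans (lerD h1 h2) _.
have h3 := @e0_bound R B v.
have : e / (2 * rn v + 1) * (2 * rn v + 1) = e by rewrite mulfVK// gt_eqF.
move: (e / _) dp => d dp eq; nra.
Qed.

Lemma Ln_limit_emod t b : 0 <= t -> Ln_limit t b -> emod_at [set` `[0, t]] b.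
Proof.
move=> t0 bL; split; first by case: bL.
apply: ptws_closure => e ep; have [dl [z [_ _ pz lz h]]] := Ln_approx t0 ep bL.
exists (emb (S z)) => //; exists (S z) => //.
by have := incr_sum_filt cU (lexx 0) (mesh_step_lt pz); rewrite lz.
Qed.

Lemma emod_at_emod (t : R) (b : op B) : emod_at [set` `[0, t]] b -> emod b.
Proof.
move=> [bb cb]; split=> // N nN; have [_ [[x fx <-] Nx]] := cb N nN.
by exists (emb x); split=> //; exists x => //; apply: filt_A fx; exact: itvP.
Qed.

Lemma flow_add t x y : A x -> A y -> flow t ((x : B -> B) + y) = (flow t x : B -> B) +
  flow t y.
Proof. by move=> Ax Ay; rewrite -[X in flow t (X + _)]scale1r flow_lc// scale1r. Qed.

Lemma mesh_step_shift (dl t s : R) (z : seq R) :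
  path (mesh_step dl) (s + t) [seq r + t | r <- z] = path (mesh_step dl) s z.
Proof.
elim: z s => //= s' z IH s; rewrite IH /mesh_step ltrD2r.
by rewrite opprD addrACA subrr addr0.
Qed.

Lemma last_shift (t s : R) (z : seq R) : last (s + t) [seq r + t | r <- z] = last s z + t.
Proof. by elim: z s => //= s' z IH s; rewrite IH. Qed.

Lemma incr_sum_cat s (f f' : seq R) : incr_sum U s (f ++ f') = incr_sum U s f +
  incr_sum U (last s f) f'.
Proof.
elim: f s => [|s' f IH] s /=; first by rewrite add0r.
by rewrite IH addrA.
Qed.

Lemma incr_sum_shift t s (f : seq R) : 0 <= s -> path <%R s f ->
  incr_sum U (s + t) [seq r + t | r <- f] = flow t (incr_sum U s f).
Proof.
elim: f s => [|s' f IH] s s0 /=.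
  by move=> _; rewrite flow_A0//; exact: (vN_0 (A0_vN B)).
move=> /andP[ss' pf]; have s'0 : 0 <= s' := le_trans s0 (ltW ss').
have k0 : 0 <= s' - s by rewrite subr_ge0 ltW.
have AS : A (incr_sum U s' f) by apply: filt_A (incr_sum_filt cU s'0 pf); exact: itvP.
rewrite IH// flow_add//; last exact: incr_at_A.
congr (_ + _); rewrite /incr_at (_ : s' + t - (s + t) = s' - s).
  by rewrite (addrC s t) flowD//; exact: incr_A.
by rewrite opprD addrACA subrr addr0.
Qed.

(** A partition of [[0, t]] followed by the translate of a partition of [[0, s]]
is a partition of [[0, t + s]]. *)
Lemma Ln_limitD t s bt bs bts : 0 <= t -> 0 <= s -> Ln_limit t bt -> Ln_limit s bs ->
  Ln_limit (t + s) bts -> bts = (bt : B -> B) + flowE t bs.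
Proof.
move=> t0 s0 [bbt bP _] [bbs bP' _] [_ bP'' _]; apply/funext => v; rewrite fctE.
apply/eqP; rewrite -subr_eq0; apply/eqP/rn_eps => e ep.
have v1 : 0 < rn v + 1 by rewrite ltr_wpDl// rn_ge0.
have ts0 : 0 <= t + s by exact: addr_ge0.
pose K := 2 * mesh_const C t + 2 * mesh_const C s + 2 * mesh_const C (t + s).
have K0 : 0 <= K by rewrite !addr_ge0 ?mulr_ge0 ?mesh_const_ge0.
have [|dl d0 hd] := @sqrt_small _ K (e / (rn v + 1)) K0; first exact: divr_gt0.
have [z1 [pz1 lz1]] := fine_partition t0 d0.
have [z2 [pz2 lz2]] := fine_partition s0 d0.
pose z := z1 ++ [seq r + t | r <- z2].
have pz : path (mesh_step dl) 0 z.
  by rewrite cat_path pz1 lz1 /= -[X in path _ X _]add0r mesh_step_shift.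
have lz : last 0 z = t + s.
  by rewrite last_cat lz1 -[X in last X _]add0r last_shift lz2 addrC.
have ze : emb (S z) = (emb (S z1) : B -> B) + flowE t (emb (S z2)).
  rewrite /z incr_sum_cat lz1 -[X in incr_sum U X (map _ _)]add0r incr_sum_shift//;
    last exact: mesh_step_lt pz2.
  by rewrite flowE_emb//; exact: incr_sum_A (mesh_step_lt pz2).
have h1 := bP _ _ d0 pz1 lz1 v; have h2 := bP' _ _ d0 pz2 lz2 v.
have h3 := bP'' _ _ d0 pz lz v; rewrite ze in h3.
have lV := BH_linear (flow_op_BH B t).
have h4 := flow_op_bound t (emb (S z2) v - bs v); rewrite (linB lV) in h4.
have -> : bts v - (bt v + flowE t bs v) =
   ((emb (S z1) v - bt v) + (flow_op t (emb (S z2) v) - flow_op t (bs v))) -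
   ((emb (S z1) v + flow_op t (emb (S z2) v)) - bts v).
  by rewrite /flowE /= -/(flow_op t); vec.
apply: le_trans (rnB_le _ _) _.
apply: le_trans (lerD (le_trans (rnD _ _) (lerD h1 (le_trans h4 h2))) h3) _.
rewrite -!mulrDl -/K.
apply: le_trans (ler_wpM2r (rn_ge0 v) (ltW hd)) _.
by rewrite mulrAC ler_pdivrMr// ler_wpM2l ?lerDl//; exact: ltW.
Qed.

Lemma Ln_limit0 b : Ln_limit 0 b -> b = 0 :> (B -> B).
Proof.
move=> bL; have [bb _ _] := bL; apply/funext => v; apply: rn_eps => e ep.
have v1 : 0 < rn v + 1 by rewrite ltr_wpDl// rn_ge0.
have [|dl [z [_ _ pz lz h]]] := @Ln_approx 0 b (e / (rn v + 1)) (lexx _) _ bL.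
  exact: divr_gt0.
have z0 : z = [::].
  case: z pz lz {h} => // x z /= /andP[/andP[x0 _] /mesh_step_lt/path_last h] lz.
  by move: h; rewrite lz leNgt x0.
have := h v; rewrite z0 /= rn_distC => h'.
have -> : b v = b v - emb (0 : B -> B) v by rewrite [emb _ v]/(0 : B) subr0.
apply: le_trans h' _.
by rewrite mulrAC ler_pdivrMr// ler_wpM2l ?lerDl//; exact: ltW.
Qed.

(** The factor of [sqrt h] in the norm of the limit at time [h <= 1]. *)
Definition time_const : R := 2 * mesh_const C 1 + Num.sqrt (2 * C).

Lemma time_const_ge0 : 0 <= time_const.
Proof. by rewrite /time_const addr_ge0 ?mulr_ge0 ?mesh_const_ge0 ?sqrtr_ge0. Qed.

Lemma incr_sum1 h : 0 <= h -> S [:: h] = incr U h.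
Proof. by move=> h0; rewrite /= subr0 addr0 /incr_at flow0//; exact: incr_A. Qed.

Lemma mesh_const_le1 h : 0 <= h -> h <= 1 -> mesh_const C h <= mesh_const C 1 *
  Num.sqrt h.
Proof.
move=> h0 h1; rewrite /mesh_const sqrtr1 !mulr1 [leRHS](mulrDl (2 * C)) lerD2l.
have -> : C * Num.sqrt (2 * C) * Num.sqrt h = C * Num.sqrt h * Num.sqrt (2 * C) by ring.
rewrite ler_wpM2r ?sqrtr_ge0// ler_wpM2l ?(ltW C0)//.
have s0 := sqrtr_ge0 h.
have s1 : Num.sqrt h <= 1 by rewrite -[leRHS]sqrtr1 ler_sqrt.
by rewrite -{1}(sqr_sqrtr h0) expr2 -[leRHS]mulr1 ler_wpM2l.
Qed.

(** The partition of [[0, h]] with a single interval has mesh [h]. *)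
Lemma Ln_limit_incr h b : 0 < h -> h <= 1 -> Ln_limit h b ->
  bounded_by (2 * mesh_const C 1 * h) ((emb (incr U h) : B -> B) - b) /\
  (forall a c, A0 a -> A0 c -> `|rd (incr U h (a Om) - b (a Om)) (c Om)| <=
     2 * C * Num.sqrt (2 * C) * (h * Num.sqrt h) * rn (a Om) * rn (c Om)).
Proof.
move=> h0 h1 [_ bP bQ].
have pz : path (mesh_step h) 0 [:: h] by rewrite /= /mesh_step h0 subr0 lexx.
have E := incr_sum1 (ltW h0).
split=> [v|a c Aa Ac].
  have := bP h [:: h] h0 pz erefl v; rewrite E => /le_trans; apply.
  rewrite ler_wpM2r ?rn_ge0// -!mulrA ler_wpM2l//.
  apply: le_trans (ler_wpM2r (sqrtr_ge0 h) (mesh_const_le1 (ltW h0) h1)) _.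
  by rewrite -mulrA -expr2 sqr_sqrtr// ltW.
have := bQ h [:: h] h0 pz erefl a c Aa Ac; rewrite E => /le_trans; apply.
by rewrite le_eqVlt; apply/orP; left; apply/eqP; ring.
Qed.

Lemma emb_incr_bound h : 0 <= h ->
  bounded_by (Num.sqrt (2 * C) * Num.sqrt h) (emb (incr U h)).
Proof.
move=> h0; apply: emb_bound; [exact: incr_A|by rewrite mulr_ge0 ?sqrtr_ge0|move=> a Aa].
have C2 : 0 <= 2 * C by rewrite mulr_ge0// ltW.
rewrite -(@ler_pXn2r _ 2%N)// ?nnegrE ?rn_ge0 ?mulr_ge0 ?rn_ge0 ?sqrtr_ge0//.
by rewrite !exprMn !sqr_sqrtr// incr_bound.
Qed.

Lemma Ln_limit_small h b : 0 <= h -> h <= 1 -> Ln_limit h b ->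
  bounded_by (time_const * Num.sqrt h) b.
Proof.
move=> h0 h1 bL; have s0 := sqrtr_ge0 h.
move: h0; rewrite le_eqVlt => /orP[/eqP e|h0].
  have b0 : b = 0 :> (B -> B) by apply: Ln_limit0; rewrite e.
  by move=> v; rewrite b0 fun0E rn0 !mulr_ge0 ?rn_ge0// time_const_ge0.
move=> v; have [/(_ v) P1 _] := Ln_limit_incr h0 h1 bL.
have P2 := emb_incr_bound (ltW h0) v.
have -> : b v = emb (incr U h) v - (emb (incr U h) v - b v) by vec.
apply: le_trans (rnB_le _ _) _; apply: le_trans (lerD P2 P1) _.
rewrite -mulrDl ler_wpM2r ?rn_ge0//.
have -> : time_const * Num.sqrt h = Num.sqrt (2 * C) * Num.sqrt h + 2 *
  mesh_const C 1 * Num.sqrt h.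
  by rewrite /time_const; ring.
rewrite lerD2l ler_wpM2l ?mulr_ge0 ?mesh_const_ge0//.
have s1 : Num.sqrt h <= 1 by rewrite -[leRHS]sqrtr1 ler_sqrt.
by rewrite -{1}(sqr_sqrtr (ltW h0)) expr2 -[leRHS]mulr1 ler_wpM2l.
Qed.

(** By orthogonality the squared norms of the martingale parts add up.  For each
step [|m xi|^2 = |(U_k - 1) xi|^2 - |d xi|^2 = - 2 Re <d xi, xi> - |d xi|^2],
where the mean [d] is of the order of the length [k] of the step; what remains
is the sum of the terms [|d xi|^2]. *)
Lemma incr_sum_quad (dl : R) (f : seq R) : forall s, 0 <= s -> path (mesh_step dl) s f ->
  exists M D : op B,
  [/\ forall v, incr_sum U s f v = M v + D v, A0 D,
      forall a b, A0 a -> A0 b -> rd (M (a Om)) (b Om) = 0 &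
      forall M0 a, filt [set` `[0, s]] M0 -> A0 a ->
        `|rn (M0 (a Om) + M (a Om)) ^+ 2 + 2 * rd (D (a Om)) (a Om) - rn (M0 (a Om)) ^+ 2|
        <= C ^+ 2 * dl * (last s f - s) * rn (a Om) ^+ 2].
Proof.
have v0 := A0_vN B.
elim: f => [|s' f IH] s s0 /=.
  move=> _; exists (0 : B -> B), (0 : B -> B); split.
  - by move=> v; rewrite !fun0E addr0.
  - exact: vN_0.
  - by move=> a b _ _; rewrite fun0E rd0l.
  - move=> M0 a _ _; rewrite !fun0E rd0l addr0 mulr0 addr0 subrr normr0 subrr.
    by rewrite mulr0 mul0r.
move=> /andP[/andP[ss' sd] pf].
have s'0 : 0 <= s' := le_trans s0 (ltW ss').
have k0 : 0 <= s' - s by rewrite subr_ge0 ltW.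
have [M [D [e1 e2 e3 e4]]] := IH s' s'0 pf.
pose m : op B := mart_at U s (s' - s); pose d : op B := E0 (incr U (s' - s)).
have Ad : A0 d by apply/E0_in/incr_A.
have vI := filt_vN B (@itvP _ 0 s); have vI' := filt_vN B (@itvP _ 0 s').
exists ((m : B -> B) + M), ((d : B -> B) + D); split.
- move=> v; rewrite [LHS]/(incr_at U s (s' - s) v + incr_sum U s' f v) e1.
  have -> : incr_at U s (s' - s) v = m v + d v by rewrite /m /mart_at !fctE subrK.
  by rewrite !fctE; exact: addrACA.
- exact: (vN_add v0).
- move=> a b Aa Ab; rewrite fctE rdDl e3// addr0.
  by apply: (mart_at_orth cU) => //; exact: A0_filt.
- move=> M0 a fM Aa; rewrite !fctE.
  have fm : filt [set` `[0, s']] m.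
    by have := mart_at_filt cU s k0; rewrite addrC subrK; exact: filt_ge.
  have fM' : filt [set` `[0, s']] ((M0 : B -> B) + m).
    by apply: (vN_add vI') => //; apply: filt_le fM; exact: ltW.
  have h := e4 _ a fM' Aa; rewrite !fctE in h.
  have h1 : rn (M0 (a Om) + m (a Om)) ^+ 2 = rn (M0 (a Om)) ^+ 2 + rn (m (a Om)) ^+ 2.
    rewrite rn_sqD [rd _ _]rdC (mart_at_orth cU k0 (y := M0 \o a))// ?mulr0 ?addr0//.
      exact: A0_filt.
    by apply: (vN_comp vI) => //; exact: A0_filt.
  have dE : e0 (d (a Om)) = d (a Om) by exact: e0_A0_orbit (vN_comp v0 Ad Aa).
  have dWd : rd (incr_at U s (s' - s) (a Om)) (d (a Om)) = rn (d (a Om)) ^+ 2.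
    by rewrite rn_sq -{1}dE -e0_adj e0_E0 ?E0_incr_at//; exact: incr_at_A.
  have h2 : rn (m (a Om)) ^+ 2 =
    rn (incr_at U s (s' - s) (a Om)) ^+ 2 - rn (d (a Om)) ^+ 2.
    rewrite /m /mart_at [X in rn X]/(incr_at U s (s' - s) (a Om) - d (a Om)) rn_sqB dWd.
    by lra.
  have Aa' := A0_A Aa; have AW := incr_A cU k0.
  have h3 : rn (incr_at U s (s' - s) (a Om)) = rn (incr U (s' - s) (a Om)).
    rewrite -{1}(flow_A0 s Aa) /incr_at
      -[flow s (incr U _) _]/((flow s (incr U (s' - s)) \o flow s a) Om).
    by rewrite -flow_comp// rn_flow//; exact: (vN_comp (A_vN B)).
  have h4 : rn (incr U (s' - s) (a Om)) ^+ 2 = - 2 * rd (d (a Om)) (a Om).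
    rewrite /d -e0_E0// e0_adj e0_A0_orbit// /incr !fctE /= rn_sqB (rn_cocycle cU)//
      rdBl -rn_sq; lra.
  have h5 : rn (d (a Om)) ^+ 2 <= C ^+ 2 * dl * (s' - s) * rn (a Om) ^+ 2.
    have Ck : 0 <= C * (s' - s) by rewrite mulr_ge0// ltW.
    have : rn (d (a Om)) <= C * (s' - s) * rn (a Om) by exact: rate.
    rewrite -(@ler_pXn2r _ 2%N)// ?nnegrE ?rn_ge0 ?mulr_ge0 ?rn_ge0//; last exact: ltW.
    move=> /le_trans; apply; rewrite exprMn ler_wpM2r ?exprn_ge0 ?rn_ge0//.
    rewrite exprMn -mulrA ler_wpM2l ?(exprn_ge0 _ (ltW C0))//.
    by rewrite expr2 ler_wpM2r.
  have -> : rn (M0 (a Om) + (m (a Om) + M (a Om))) ^+ 2 +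
      2 * rd (d (a Om) + D (a Om)) (a Om) - rn (M0 (a Om)) ^+ 2 =
    (rn (M0 (a Om) + m (a Om) + M (a Om)) ^+ 2 + 2 * rd (D (a Om)) (a Om)
      - rn (M0 (a Om) + m (a Om)) ^+ 2) - rn (d (a Om)) ^+ 2.
    by rewrite addrA rdDl h1 h2 h3 h4; lra.
  apply: le_trans (ler_normB _ _) _.
  rewrite [`|rn _ ^+ 2|]ger0_norm ?exprn_ge0 ?rn_ge0//.
  apply: le_trans (lerD h h5) _.
  by rewrite -mulrDl -mulrDr addrA subrK.
Qed.

End LimitProperties.

(** * The quadratic identity *)

Section QuadraticIdentity.
Context {R : realType} {B : bernoulli_shift R}.
Local Notation A := (@alg R B).
Local Notation A0 := (@A0 R B).
Local Notation Om := (Omega B).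
Local Notation E0 := (@E0 R B).
Local Notation e0 := (e0 (B := B)).
Local Notation filt := (@filt R B).

Variables (U : R -> op B) (C : R).
Hypothesis cU : cocycle U.
Hypothesis C0 : 0 < C.
Hypothesis rate : forall h : R,
  0 <= h -> bounded_by (C * h) (E0 ((U h : B -> B) - idfun)).
Local Notation S := (incr_sum U 0).
Local Notation Ln_limit := (Ln_limit U C).

Lemma e0_lin : linear e0.
Proof. by have [] := e0_BH B. Qed.

Lemma e0_orth v : (forall a, A0 a -> rd v (a Om) = 0) -> e0 v = 0.
Proof.
move=> h; apply: rn0_eq; apply/eqP; rewrite -sqrf_eq0 rn_sq e0_adj e0_e0; apply/eqP.
by apply: (@rd0_closure _ _ (@A0_orbit R B)); [move=> _ [a Aa <-]; exact: h|exact: e0_in].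
Qed.

(** For [x = b v] with [e0 v = v] this is the quadratic form at [v] of
[<b - E0 b | b - E0 b> + E0 b + (E0 b)^*]. *)
Definition qform (x v : B) : R := rn (x - e0 x) ^+ 2 + 2 * rd x v.

Lemma incr_sum_qform (t dl : R) z a : 0 < dl -> path (mesh_step dl) 0 z -> last 0 z =
  t -> A0 a ->
  `|qform (S z (a Om)) (a Om)| <= C ^+ 2 * dl * t * rn (a Om) ^+ 2.
Proof.
move=> d0 pz lz Aa.
have [M [D [e1 e2 e3 e4]]] := incr_sum_quad cU C0 rate (lexx 0) pz.
have := e4 (0 : B -> B) a (vN_0 (filt_vN B (@itvP _ _ _))) Aa.
rewrite fun0E add0r rn0 expr0n subr0 lz subr0; congr (`|_| <= _).
have eM : e0 (M (a Om)) = 0 by apply: e0_orth => b Ab; exact: e3.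
have eD : e0 (D (a Om)) = D (a Om) by apply: e0_A0_orbit (vN_comp (A0_vN B) e2 Aa).
rewrite /qform e1 (linD e0_lin) eM eD add0r addrK rdDl.
by rewrite e3// add0r.
Qed.

Lemma qform_diff (x y v : B) (eta : R) : rn (x - y) <= eta -> eta <= 1 ->
  `|qform y v| <= `|qform x v| + eta * (4 * (1 + 2 * rn y) + 2 * rn v).
Proof.
move=> xy e1; have eta0 : 0 <= eta := le_trans (rn_ge0 _) xy.
have pb w : rn (w - e0 w) <= 2 * rn w.
  by apply: le_trans (rnB_le _ _) _; have := @e0_bound R B w; lra.
set px := x - e0 x; set py := y - e0 y.
have pxy : rn (px - py) <= 2 * eta.
  have -> : px - py = (x - y) - e0 (x - y) by rewrite (linB e0_lin) /px /py; vec.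
  by apply: le_trans (pb _) _; lra.
have py2 : rn py <= 2 * rn y by exact: pb.
have h1 : `|rn px ^+ 2 - rn py ^+ 2| <= 2 * eta * (2 * eta + 2 * rn py).
  have a1 := rn_trid px py 0; have a2 := rn_trid py px 0.
  rewrite !subr0 in a1 a2; rewrite (rn_distC py) in a2.
  have p0 := rn_ge0 px; have q0 := rn_ge0 py.
  rewrite subr_sqr normrM; apply: ler_pM => //; first by rewrite ler_norml; lra.
  by rewrite ger0_norm ?addr_ge0//; lra.
have h2 : `|rd x v - rd y v| <= eta * rn v.
  by rewrite -rdBl; apply: le_trans (rd_abs _ _) _; rewrite ler_wpM2r ?rn_ge0.
have -> : qform y v = qform x v - ((rn px ^+ 2 - rn py ^+ 2) + 2 * (rd x v - rd y v)).
  by rewrite /qform -/px -/py; lra.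
apply: le_trans (ler_normB _ _) _; rewrite lerD2l.
apply: le_trans (ler_normD _ _) _; rewrite normrM [`|2|]ger0_norm//.
have h3 : 2 * eta * (2 * eta + 2 * rn py) <= 2 * eta * (2 + 4 * rn y).
  by rewrite ler_wpM2l ?mulr_ge0//; lra.
lra.
Qed.

Lemma Ln_limit_qform t b a : 0 <= t -> Ln_limit t b -> A0 a ->
  qform (b (a Om)) (a Om) = 0.
Proof.
move=> t0 bL Aa; set v := a Om.
apply/eqP; rewrite -normr_eq0 eq_le normr_ge0 andbT; apply: le_eps => e ep; rewrite add0r.
pose K := C ^+ 2 * t * rn v ^+ 2 + rn v * (4 * (1 + 2 * rn (b v)) + 2 * rn v).
have r0 := rn_ge0 v; have K0 : 0 <= K.
  by rewrite addr_ge0// !mulr_ge0 ?exprn_ge0// ?(ltW C0)// addr_ge0// mulr_ge0//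
    addr_ge0// mulr_ge0// rn_ge0.
have K1 : 0 < K + 1 by rewrite ltr_wpDl.
have v1 : 0 < rn v + 1 by rewrite ltr_wpDl.
pose eta := Num.min (e / (K + 1)) (rn v + 1)^-1.
have eta0 : 0 < eta by rewrite lt_min divr_gt0//= invr_gt0.
have eta1 : eta <= e / (K + 1) by rewrite /eta ge_min lexx.
have eta2 : eta * rn v <= 1.
  have : eta <= (rn v + 1)^-1 by rewrite /eta ge_min lexx orbT.
  move=> h; have := ler_wpM2r r0 h; move/le_trans; apply.
  by rewrite mulrC ler_pdivrMr// mul1r lerDl.
have [dl [z [d0 de pz lz h]]] := Ln_approx C0 t0 eta0 bL.
have h1 : rn (S z v - b v) <= eta * rn v.
  by have := h v; rewrite !fctE /emb /= /v e0_A0_orbit.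
have h2 := qform_diff v h1 eta2.
have h3 := incr_sum_qform d0 pz lz Aa; rewrite -/v in h3.
have h4 : C ^+ 2 * dl * t * rn v ^+ 2 <= C ^+ 2 * t * rn v ^+ 2 * eta.
  rewrite [leRHS](_ : _ = C ^+ 2 * eta * t * rn v ^+ 2); last by ring.
  do 2 rewrite ler_wpM2r ?exprn_ge0//.
  by rewrite ler_wpM2l ?exprn_ge0 ?(ltW C0) ?(ltW de).
apply: le_trans h2 _; apply: le_trans (lerD (le_trans h3 h4) (lexx _)) _.
have -> : C ^+ 2 * t * rn v ^+ 2 * eta
    + eta * rn v * (4 * (1 + 2 * rn (b v)) + 2 * rn v) = eta * K by rewrite /K; ring.
apply: le_trans (ler_wpM2r K0 eta1) _.
by rewrite mulrAC ler_pdivrMr// ler_wpM2l ?lerDl//; exact: ltW.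
Qed.

(** The operator is symmetric and equal to its compression by [e0], and its
quadratic form vanishes on [A0 Omega]; polarization does the rest. *)
Lemma Ln_limit_identity t b : 0 <= t -> Ln_limit t b ->
  ip0 ((b : B -> B) - E0E b) ((b : B -> B) - E0E b) + E0E b + adj (E0E b) = 0 :> (B -> B).
Proof.
move=> t0 bL; have bb : BH b by case: bL.
have be0 := e0_BH B.
have adje0 : adj e0 = e0 by apply: adj_rd => // x y; exact: e0_adj.
have EE : E0E b = e0 \o b by rewrite /E0E /ip0 (_ : emb idfun = e0) ?adje0.
rewrite EE; set c : op B := (b : B -> B) - (e0 \o b).
have beb : BH (e0 \o b) by exact: BH_comp.
have bc : BH c by exact: BH_sub.
set Q : op B := _ + _ + _.
have bQ : BH Q.
  apply: BH_add; last exact: BH_adj.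
  by apply: BH_add => //; apply: BH_comp => //; exact: BH_adj.
have QE v w : rd (Q v) w = rd (c v) (c w) + rd (b v) (e0 w) + rd (e0 v) (b w).
  have e1 : rd (adj c (c v)) w = rd (c v) (c w) by rewrite -rd_adjr.
  have e2 : rd (adj (e0 \o b) v) w = rd (e0 v) (b w) by rewrite -rd_adjr//= e0_adj.
  by rewrite -e1 -e2 -e0_adj -!rdDl.
have sQ v w : rd (Q v) w = rd v (Q w).
  by rewrite [RHS]rdC !QE (rdC (c w)) (rdC (b w)) (rdC (e0 w)); lra.
have lQ := BH_linear bQ; clearbody Q.
have Qe v w : rd (Q (e0 v)) w = rd (Q v) w.
  by rewrite !QE /c !fctE /= !(Ln_limit_e0 C0 _ t0 bL) e0_e0.
have Qe' v w : rd (Q (e0 v)) (e0 w) = rd (Q v) w.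
  by rewrite Qe sQ -(rdC (Q (e0 w))) Qe rdC -sQ.
have Qa a : A0 a -> rd (Q (a Om)) (a Om) = 0.
  move=> Aa; rewrite QE e0_A0_orbit// -(Ln_limit_qform t0 bL Aa) /qform rn_sq.
  by rewrite /c !fctE /= (rdC (a Om)); lra.
have Qab a a' : A0 a -> A0 a' -> rd (Q (a Om)) (a' Om) = 0.
  move=> Aa Aa'; have := Qa ((a : B -> B) + a') (vN_add (A0_vN B) Aa Aa').
  rewrite -[((a : B -> B) + a') Om]/(a Om + a' Om) (linD lQ) !rdE !Qa//.
  by rewrite (sQ (a' Om)) (rdC (a' Om)) => h; lra.
have Qak a k : A0 a -> closure (@A0_orbit R B) k -> rd (Q (a Om)) k = 0.
  by move=> Aa; apply: rd0_closure => _ [a' Aa' <-]; exact: Qab.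
apply: (quad_form0 sQ lQ) => v; rewrite -Qe' sQ rdC.
apply: (@rd0_closure _ _ (@A0_orbit R B)); last exact: e0_in.
move=> _ [a Aa <-]; rewrite rdC -sQ; apply: Qak => //; exact: e0_in.
Qed.

End QuadraticIdentity.

(** * A cocycle is determined by its limit *)

Section Injectivity.
Context {R : realType} {B : bernoulli_shift R}.
Local Notation A := (@alg R B).
Local Notation A0 := (@A0 R B).
Local Notation Om := (Omega B).
Local Notation E0 := (@E0 R B).
Local Notation e0 := (e0 (B := B)).
Local Notation flow := (@flow R B).
Local Notation filt := (@filt R B).

Variables (U U' : R -> op B) (C : R).
Hypothesis cU : cocycle U.
Hypothesis cU' : cocycle U'.
Hypothesis C0 : 0 < C.
Hypothesis rate : forall h : R,
  0 <= h -> bounded_by (C * h) (E0 ((U h : B -> B) - idfun)).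
Hypothesis rate' : forall h : R,
  0 <= h -> bounded_by (C * h) (E0 ((U' h : B -> B) - idfun)).
Variable b : R -> op B.
Hypothesis bU : forall t : R, 0 <= t -> Ln_limit U C t (b t).
Hypothesis bU' : forall t : R, 0 <= t -> Ln_limit U' C t (b t).

(** Since both cocycles are isometric, this operator determines the distance of
[U t (a Omega)] and [U' t (a Omega)]. *)
Definition correlation (t : R) : op B := E0 (adj (U t) \o U' t).

Lemma correlation_A (t : R) : 0 <= t -> A (adj (U t) \o U' t).
Proof.
move=> t0; apply: (vN_comp (A_vN B)); last exact: cocycle_A.
by apply: (vN_adj (A_vN B)); exact: cocycle_A.
Qed.

Lemma correlation_A0 (t : R) : 0 <= t -> A0 (correlation t).
Proof. by move=> t0; apply/E0_in/correlation_A. Qed.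

Lemma correlation_rd (t : R) a c : 0 <= t -> A0 a -> A0 c ->
  rd (correlation t (a Om)) (c Om) = rd (U' t (a Om)) (U t (c Om)).
Proof.
move=> t0 Aa Ac; transitivity (rd ((adj (U t) \o U' t) (a Om)) (c Om)).
  by rewrite /rd (E0_dot (correlation_A t0) Ac Aa).
by rewrite [RHS]rd_adjr//; exact: A_BH (cocycle_A cU t0).
Qed.

Definition correlation_const : R :=
  4 * C * Num.sqrt (2 * C) + 4 * mesh_const C 1 * Num.sqrt (2 * C).

Lemma correlation_const_ge0 : 0 <= correlation_const.
Proof. by rewrite /correlation_const addr_ge0 ?mulr_ge0 ?sqrtr_ge0 ?mesh_const_ge0//
  ltW. Qed.

(** Write [<U' a, U c> - <U a, U c>] as the inner product of [(U' - U) a] with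
[c] plus its inner product with [(U - 1) c].  Both increments are close to the
common limit: [U' - U] is [O(h)], its compression by [e0] is [O(h^(3/2))], and
[U - 1] is [O(h^(1/2))]. *)
Lemma correlation_rate h : 0 < h -> h <= 1 ->
  bounded_by (correlation_const * (h * Num.sqrt h)) ((correlation h : B -> B) - idfun).
Proof.
move=> hp h1; have h0 := ltW hp; have v0 := A0_vN B; have s0 := sqrtr_ge0 h.
have L0 : 0 <= correlation_const * (h * Num.sqrt h)
  by rewrite !mulr_ge0// correlation_const_ge0.
have Ac := correlation_A0 h0.
apply: A0_bound => //; first by apply: (vN_sub v0) => //; exact: vN_id.
have [P1 P2] := Ln_limit_incr cU C0 hp h1 (bU h0).
have [P1' P2'] := Ln_limit_incr cU' C0 hp h1 (bU' h0).
have key a c : A0 a -> A0 c ->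
    rd (correlation h (a Om) - a Om) (c Om) <= correlation_const * (h * Num.sqrt h) *
      rn (a Om) * rn (c Om).
  move=> Aa Ac'.
  set ua := incr U h (a Om) - b h (a Om); set va := incr U' h (a Om) - b h (a Om).
  have e : rd (correlation h (a Om) - a Om) (c Om) =
     rd va (c Om) - rd ua (c Om) + rd (va - ua) (incr U h (c Om)).
    rewrite rdBl correlation_rd// -(cocycle_isom cU h0 (a Om) (c Om)).
    rewrite /ua /va /incr !fctE /= !rdE; lra.
  have h2 := ler_norml (rd va (c Om)) (2 * C * Num.sqrt (2 * C) * (h * Num.sqrt h) *
    rn (a Om) * rn (c Om)).
  have := P2' a c Aa Ac'; rewrite -/va h2 => /andP[_ q1].
  have := P2 a c Aa Ac'; rewrite -/ua ler_norml => /andP[q2 _].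
  have u1 : rn ua <= 2 * mesh_const C 1 * h * rn (a Om).
    by have := P1 (a Om); rewrite !fctE /emb /= e0_A0_orbit.
  have u2 : rn va <= 2 * mesh_const C 1 * h * rn (a Om).
    by have := P1' (a Om); rewrite !fctE /emb /= e0_A0_orbit.
  have u3 : rn (incr U h (c Om)) <= Num.sqrt (2 * C) * Num.sqrt h * rn (c Om).
    by have := emb_incr_bound cU C0 rate h0 (c Om); rewrite /emb /= e0_A0_orbit.
  have u4 : rn (va - ua) <= 4 * mesh_const C 1 * h * rn (a Om).
    by apply: le_trans (rnB_le _ _) _; lra.
  have u5 : rd (va - ua) (incr U h (c Om)) <=
    4 * mesh_const C 1 * h * rn (a Om) * (Num.sqrt (2 * C) * Num.sqrt h * rn (c Om)).
    by apply: le_trans (rd_le _ _) _; apply: ler_pM => //; exact: rn_ge0.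
  rewrite e [leRHS](_ : _ =
     2 * C * Num.sqrt (2 * C) * (h * Num.sqrt h) * rn (a Om) * rn (c Om)
   + 2 * C * Num.sqrt (2 * C) * (h * Num.sqrt h) * rn (a Om) * rn (c Om)
   + 4 * mesh_const C 1 * h * rn (a Om) *
     (Num.sqrt (2 * C) * Num.sqrt h * rn (c Om))); last first.
    by rewrite /correlation_const; ring.
  by apply: lerD u5; apply: lerD => //; rewrite lerNl.
move=> a Aa; set w := _ (a Om).
have := key a ((correlation h \o a : B -> B) - a) Aa (vN_sub v0 (vN_comp v0 Ac Aa) Aa).
rewrite -[X in rd _ X]/w -[X in rd X _]/w -[X in _ * rn X]/w -rn_sq expr2.
have [wp|] := ltP 0 (rn w); first by rewrite ler_pM2r.
by move=> w0 _; apply: le_trans w0 _; rewrite mulr_ge0 ?rn_ge0.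
Qed.

(** By independence [E0(U_(s+t)^* U'_(s+t)) = E0(U_t^* c_s U'_t)] for the
correlation [c_s], and the outer factors are isometric. *)
Lemma correlationD s t a : 0 <= s -> 0 <= t -> A0 a ->
  forall q, bounded_by q ((correlation s : B -> B) - idfun) -> 0 <= q ->
  rn (correlation (s + t) (a Om) - correlation t (a Om)) <= q * rn (a Om).
Proof.
move=> s0 t0 Aa q hq q0; have v0 := A0_vN B; have st0 := addr_ge0 s0 t0.
have key c : A0 c -> rd (correlation (s + t) (a Om) - correlation t (a Om)) (c Om)
    <= q * rn (a Om) * rn (c Om).
  move=> Ac; rewrite rdBl !correlation_rd// (cocycleD cU)// (cocycleD cU')//=.
  have As := cocycle_A cU s0; have As' := cocycle_A cU' s0.
  have fs (V : R -> op B) : cocycle V -> filt [set` `[t, s + t]] (flow t (V s)).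
    by move=> cV; have := filt_flow t (cocycle_filt cV s0); rewrite add0r.
  have ft (V : R -> op B) d : cocycle V -> A0 d -> filt [set` `[0, t]] (V t \o d).
    move=> cV Ad; apply: (vN_comp (filt_vN B (@itvP _ _ _))); last exact: A0_filt.
    exact: cocycle_filt.
  have vI := filt_vN B (@itvP _ t (s + t)).
  have fm : filt [set` `[t, s + t]] (adj (flow t (U s)) \o flow t (U' s)).
    by apply: (vN_comp vI); [apply: (vN_adj vI)|]; exact: fs.
  have bfs := A_BH (flow_in t As).
  rewrite [X in X - _]rdC rd_adj// [X in X - _]rdC.
  have -> : rd (adj (flow t (U s)) (flow t (U' s) (U' t (a Om)))) (U t (c Om)) =
     rd (correlation s (U' t (a Om))) (U t (c Om)).
    have E0e : E0 (adj (flow t (U s)) \o flow t (U' s)) = correlation s.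
      rewrite -flow_adj// -flow_comp//; last exact: (vN_adj (A_vN B)).
      by rewrite E0_flow//; exact: correlation_A.
    have := touching_dot fm (ft _ _ cU' Aa) (ft _ _ cU Ac); rewrite E0e.
    exact: (congr1 (@complex.Re R)).
  rewrite -rdBl; apply: le_trans (rd_le _ _) _.
  rewrite (rn_cocycle cU _ t0) ler_wpM2r ?rn_ge0//.
  by have := hq (U' t (a Om)); rewrite (rn_cocycle cU' _ t0).
set w := correlation (s + t) _ - _.
have Aw : A0 (((correlation (s + t) \o a : B -> B) - (correlation t \o a))).
  by apply: (vN_sub v0); apply: (vN_comp v0) => //; exact: correlation_A0.
have := key _ Aw; rewrite -[X in rd _ X]/w -/w -[X in _ * rn X]/w -rn_sq expr2.
have [wp|] := ltP 0 (rn w); first by rewrite ler_pM2r.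
by move=> w0 _; apply: le_trans w0 _; rewrite mulr_ge0 ?rn_ge0.
Qed.

(** The [n] steps of length [t / n] contribute at most [n (t / n)^(3/2)] in all,
up to a constant. *)
Lemma correlation1 t : 0 <= t -> correlation t Om = Om.
Proof.
move=> t0; have v0 := A0_vN B; have Aid := vN_id v0.
have c0 : correlation 0 Om = Om.
  rewrite /correlation (cocycle0 cU) (cocycle0 cU') /=.
  have -> : adj (idfun : op B) \o idfun = idfun :> (B -> B).
    apply/funext => v /=; apply: rd_inj => w.
    by rewrite -rd_adjr//; exact: BH_id.
  by rewrite E0_id.
move: t0; rewrite le_eqVlt => /orP[/eqP <-//|tp].
apply/eqP; rewrite -subr_eq0; apply/eqP/rn_eps => e ep.
have Om1 : rn Om = 1 :> R by rewrite /rn Omega_unit.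
have q0 : 0 <= correlation_const * (t * Num.sqrt t).
  by rewrite !mulr_ge0 ?correlation_const_ge0 ?sqrtr_ge0// ltW.
have [dl d0 hd] := sqrt_small q0 ep.
have [N HN] := inv_small d0.
(* At least [t] steps are taken, so that their length is at most 1. *)
pose n := (maxn N (Num.truncn t)).+1; pose h := t / n%:R.
have n0 : 0 < n%:R :> R by rewrite ltr0n.
have hp : 0 < h by rewrite divr_gt0.
have h1 : h <= 1.
  rewrite ler_pdivrMr// mul1r ltW//; apply: lt_le_trans (truncnS_gt t) _.
  by rewrite ler_nat ltnS leq_maxr.
pose q := correlation_const * (h * Num.sqrt h).
have qp : 0 <= q by rewrite !mulr_ge0 ?correlation_const_ge0 ?sqrtr_ge0// ltW.
have iterk k : rn (correlation (k%:R * h) Om - Om) <= k%:R * q.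
  elim: k => [|k IH]; first by rewrite !mul0r c0 subrr rn0.
  have kh : 0 <= k%:R * h by rewrite mulr_ge0// ltW.
  have -> : k.+1%:R * h = h + k%:R * h by rewrite -natr1 mulrDl mul1r addrC.
  have := correlationD (ltW hp) kh Aid (correlation_rate hp h1) qp;
    rewrite /= Om1 mulr1 => hs.
  apply: le_trans (rn_trid _ (correlation (k%:R * h) Om) _) _.
  by rewrite -natr1 mulrDl mul1r addrC; apply: lerD.
have nh : n%:R * h = t by rewrite /h mulrC mulfVK// gt_eqF.
have := iterk n; rewrite nh => /le_trans; apply.
have -> : n%:R * q = correlation_const * (t * Num.sqrt t) * Num.sqrt n%:R^-1.
  have sh : Num.sqrt h = Num.sqrt t * Num.sqrt n%:R^-1 by rewrite /h sqrtrM// ltW.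
  by rewrite -{1}nh /q sh; ring.
apply: le_trans (ltW hd); apply: (ler_wpM2l q0).
by rewrite ler_sqrt ?(ltW d0)// ltW// HN// leq_maxl.
Qed.

Lemma cocycle_inj t : 0 <= t -> U t = U' t.
Proof.
move=> t0; have Aid := vN_id (A0_vN B).
apply: Omega_inj; [exact: cocycle_A|exact: cocycle_A|].
apply/eqP; rewrite -subr_eq0; apply/eqP/rn0_eq/eqP; rewrite -sqrf_eq0 rn_sqB.
have := correlation_rd t0 Aid Aid;
  rewrite /= correlation1// (rn_cocycle cU)// (rn_cocycle cU')// rdC => <-.
by rewrite -rn_sq; apply/eqP; lra.
Qed.

End Injectivity.

(** * Cocycles of the shift *)

Section CocyclesOfShift.
Context {R : realType} (B : bernoulli_shift R).
Local Notation A := (@alg R B).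
Local Notation A0 := (@A0 R B).
Local Notation Om := (Omega B).
Local Notation E0 := (@E0 R B).
Implicit Types (u : {nonneg R} -> B -> B) (t s : {nonneg R}).

Definition nnabs (r : R) : {nonneg R} := (`|r|)%:nng.

Lemma nnabsE (r : R) : 0 <= r -> (nnabs r)%:num = r.
Proof. by move=> r0; rewrite /= ger0_norm. Qed.

Definition real_index u (r : R) : op B := u (nnabs r).

Lemma real_indexE u t : real_index u t%:num = u t.
Proof. by rewrite /real_index; congr u; apply/val_inj; rewrite /= ger0_norm. Qed.

Lemma halfline_nbhs (t : halfline R) (D : set {nonneg R}) :
  (\forall s \near t, D s) <->
  exists2 d : R, 0 < d & forall s, `|(t : {nonneg R})%:num - s%:num| < d -> D s.
Proof.
split.
  move=> [_ [[V oV <-] flow_op] VD].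
  have /nbhs_ballP[d /= d0 dV] : nbhs ((t : {nonneg R})%:num) V by exact: open_nbhs_nbhs.
  by exists d => // s ts; apply: VD; apply: dV.
move=> [d d0 dD].
have : nbhs ((t : {nonneg R})%:num) (ball ((t : {nonneg R})%:num) d)
  by exact: nbhsx_ballx.
move/(@initial_continuous _ _ (fun t : {nonneg R} => t%:num) t).
by move=> h; apply: (@filterS _ (nbhs t) _ _ D _ h) => s ts; exact: dD.
Qed.

Lemma real_index_cocycle u : C00_mul B u -> cocycle (real_index u).
Proof.
move=> [ [uA _ uf uD] uc].
have abs (r : R) : 0 <= r -> `|r| = r by exact: ger0_norm.
have bu r : BH (real_index u r)
  by have [h _] : alg (real_index u r) /\ unitary_op (real_index u r) by [exact: uA];
  exact: A_BH.
have isom (r : R) v w : rd (real_index u r v) (real_index u r w) = rd v w.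
  have [_ [h _]] : alg (real_index u r) /\ unitary_op (real_index u r) by exact: uA.
  by rewrite rd_adj// -[adj _ (real_index u r w)]/((adj (real_index u r) \o real_index
    u r) w) h.
have extD (s t : R) : 0 <= s -> 0 <= t -> real_index u (s + t) =
  flow t (real_index u s) \o real_index u t.
  move=> s0 t0; pose s' := nnabs s; pose t' := nnabs t.
  have et : t'%:num = t by exact: nnabsE.
  transitivity (u (s'%:num + t'%:num)%:nng); last by rewrite uD et.
  rewrite /real_index.
  congr u; apply/val_inj; transitivity (s'%:num + t'%:num) => //.
  by rewrite [LHS]nnabsE ?addr_ge0// /s' /t' !nnabsE.
split=> // [r r0|e e0].
  pose r' := nnabs r.
  by have := uf r'; rewrite nnabsE.
have u0 : real_index u 0 = idfun.
  apply/funext => v /=; apply/eqP; rewrite -subr_eq0; apply/eqP/rn0_eq/eqP.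
  have lu := BH_linear (bu 0).
  rewrite -sqrf_eq0 rn_sq -(isom 0) (linB lu).
  have := extD 0 0 (lexx _) (lexx _); rewrite addr0 flow0; last first.
    by have [] : alg (real_index u 0) /\ unitary_op (real_index u 0) by exact: uA.
  move=> e2; rewrite -[real_index u 0
    (real_index u 0 v)]/((real_index u 0 \o real_index u 0) v) -e2.
  by rewrite subrr rd0l.
have /cvgrPdist_lt/(_ e e0)/halfline_nbhs[d d0 hd] := uc (nnabs 0).
exists d => // r r0 rd a Aa.
have hdr : `|(nnabs 0)%:num - (nnabs r)%:num| < d.
  by rewrite (nnabsE (lexx _)) (nnabsE r0) distrC subr0 abs.
have := hd _ hdr; rewrite sub0r normrN -/(real_index u r) -/(real_index u 0) u0.
have bd : BH ((emb (real_index u r) : B -> B) - emb idfun).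
  by apply: BH_sub; apply: BH_comp; [exact: bu|exact: e0_BH|exact: BH_id|exact: e0_BH].
rewrite norm0E// ger0_norm ?opnorm_ge0// => lt.
have := opnorm_bound bd (a Om); rewrite !fctE /emb /= !e0_A0_orbit// => /le_trans; apply.
by rewrite ler_wpM2r ?rn_ge0// ltW.
Qed.

Lemma Ln_sumE u (Z : seq R) : C00_mul B u -> path <%R 0 Z ->
  Ln_sum u Z = emb (incr_sum (real_index u) 0 Z).
Proof.
move=> /real_index_cocycle cU.
suff gen (s : R) : 0 <= s -> path <%R s Z -> \sum_(p <- zip (s :: Z) Z)
    flowE p.1 (emb (real_index u (p.2 - p.1) - idfun)) =
      emb (incr_sum (real_index u) s Z).
  exact: gen (lexx 0).
elim: Z s => [|s' Z IH] s s0 /=; first by rewrite big_nil.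
move=> /andP[ss' pZ]; rewrite big_cons /= IH//; last exact: le_trans (ltW ss').
have k0 : 0 <= s' - s by rewrite subr_ge0 ltW.
by rewrite flowE_emb//; exact: (incr_A cU k0).
Qed.

Section Rate.
Variables (u : {nonneg R} -> B -> B) (C : R).
Hypothesis uC : C00_mul B u.
Hypothesis C0 : 0 < C.
Hypothesis rate : forall h : R,
  0 <= h -> bounded_by (C * h) (E0 ((real_index u h : B -> B) - idfun)).
Let cU := real_index_cocycle uC.

Lemma is_Ln_limit t b : Ln_limit (real_index u) C t%:num b -> is_Ln u t b.
Proof.
move=> bL; have t0 : 0 <= t%:num by [].
have bb : BH b by case: bL.
split; first exact: emod_at_emod (Ln_limit_emod cU C0 t0 bL).
move=> e e0; have k0 : 0 <= mesh_const C t%:num by exact: mesh_const_ge0.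
have [||dl d0 hd] := @sqrt_small _ (3 * mesh_const C t%:num) e => //;
  first by rewrite mulr_ge0.
have [Z0 [pZ0 lZ0]] := fine_partition t0 d0.
exists Z0; first by split; [exact: mesh_step_lt pZ0|apply/eqP].
move=> Z [pZ /eqP lZ] sub; rewrite Ln_sumE//.
have AS := incr_sum_A cU pZ.
have bS : BH ((emb (incr_sum (real_index u) 0 Z) : B -> B) - b) by apply: BH_sub =>
  //; exact: emb_BH.
rewrite norm0E//; apply: le_lt_trans hd.
apply: opnorm_le; first by rewrite !mulr_ge0// sqrtr_ge0.
have [h1 _] := refine_bound cU C0 rate t0 d0 pZ0 pZ sub lZ0 lZ.
have AS0 := incr_sum_A cU (mesh_step_lt pZ0).
have hb : bounded_by (mesh_const C t%:num * Num.sqrt dl)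
    ((emb (incr_sum (real_index u) 0 Z0) : B -> B) - emb (incr_sum (real_index u) 0 Z)).
  rewrite -emb_sub; apply: emb_bound => //; first exact: (vN_sub (A_vN B)).
  by rewrite mulr_ge0 ?sqrtr_ge0.
move=> v; have [_ /(_ dl Z0 d0 pZ0 lZ0 v) h2 _] := bL.
apply: le_trans (rn_trid _ (emb (incr_sum (real_index u) 0 Z0) v) _) _.
rewrite (rn_distC _ (emb (incr_sum (real_index u) 0 Z0) v)).
by apply: le_trans (lerD (hb v) h2) _; lra.
Qed.

(** Along a common refinement a single sum is close to both candidates. *)
Lemma is_Ln_unique t b b' : is_Ln u t b -> is_Ln u t b' -> b = b'.
Proof.
move=> [ [bb _] h] [ [bb' _] h']; apply/eqP; rewrite -subr_eq0; apply/eqP.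
apply: opnorm_eps; first exact: BH_sub.
move=> e e0; have e2 : 0 < e / 2 by rewrite divr_gt0.
have [Z1 [p1 /eqP l1] h1] := h _ e2; have [Z2 [p2 /eqP l2] h2] := h' _ e2.
have [Z [pZ lZ s1 s2]] := common_refinement p1 p2 l1 l2.
have iZ : itv_partition 0 t%:num Z by split=> //; apply/eqP.
have {}h1 := h1 Z iZ s1; have {}h2 := h2 Z iZ s2.
have bS : BH (Ln_sum u Z) by rewrite Ln_sumE//; apply: emb_BH; exact: incr_sum_A.
have b1 : BH (Ln_sum u Z - b) by exact: BH_sub.
have b2 : BH (Ln_sum u Z - b') by exact: BH_sub.
rewrite norm0E// in h1; rewrite norm0E// in h2.
apply: opnorm_le; first exact: ltW.
move=> v; have v0 := rn_ge0 v.
have k1 := le_trans (opnorm_bound b1 v) (ler_wpM2r v0 (ltW h1)).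
have k2 := le_trans (opnorm_bound b2 v) (ler_wpM2r v0 (ltW h2)).
have -> : (b - b') v = (Ln_sum u Z - b') v - (Ln_sum u Z - b) v.
  by rewrite !fctE; vec.
by apply: le_trans (rnB_le _ _) _; apply: le_trans (lerD k2 k1) _; lra.
Qed.

Lemma is_LnP t : is_Ln u t (Ln B u t).
Proof.
have [b bL] := Ln_limit_exists cU C0 rate (ge0 t).
by apply: (@xgetPex _ _ (is_Ln u t)); exists b; exact: is_Ln_limit.
Qed.

Lemma Ln_limitP t : Ln_limit (real_index u) C t%:num (Ln B u t).
Proof.
have [b bL] := Ln_limit_exists cU C0 rate (ge0 t).
by rewrite (is_Ln_unique (is_LnP t) (is_Ln_limit bL)).
Qed.

Lemma Ln_D t s : Ln B u (t%:num + s%:num)%:nng = Ln B u t + flowE t%:num (Ln B u s).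
Proof.
by apply: (Ln_limitD cU C0 _ _ (Ln_limitP t) (Ln_limitP s)) => //; exact: Ln_limitP.
Qed.

Lemma Ln_diff t s (h : R) : h <= 1 -> `|t%:num - s%:num| <= h ->
  bounded_by (time_const C * Num.sqrt h) (Ln B u s - Ln B u t).
Proof.
move=> h1; wlog ts : t s / t%:num <= s%:num.
  move=> wl; have [ts|st] := leP t%:num s%:num; first exact: wl.
  move=> tsh v; have := wl s t (ltW st).
  by rewrite distrC => /(_ tsh v); rewrite !fctE rn_distC.
rewrite distrC ger0_norm ?subr_ge0// => sh.
have st0 : 0 <= s%:num - t%:num by rewrite subr_ge0.
pose r : {nonneg R} := NngNum st0.
have -> : s = (t%:num + r%:num)%:nng by apply/val_inj; rewrite /= addrC subrK.
rewrite Ln_D addrC addKr => v; apply: le_trans (flow_op_bound _ _) _.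
have := Ln_limit_small cU C0 rate st0 (le_trans sh h1) (Ln_limitP r) v.
move/le_trans; apply; rewrite ler_wpM2r ?rn_ge0// ler_wpM2l ?time_const_ge0//.
by rewrite ler_sqrt// (le_trans st0).
Qed.

Lemma Ln_additive : C00_add B (Ln B u).
Proof.
split; last first.
  by move=> t; exact: (Ln_limit_identity cU C0 rate (ge0 t) (Ln_limitP t)).
split; [|by move=> t; exact: (Ln_limit_emod cU C0 (ge0 t) (Ln_limitP t))
  |by move=> s t; exact: Ln_D].
move=> t; have FF : Filter (nbhs t) := nbhs_filter t.
apply/cvgrPdist_lt => e e0; apply/halfline_nbhs.
have [dl d0 hd] := sqrt_small (time_const_ge0 C0) e0.
exists (Num.min dl 1); first by rewrite lt_min d0 ltr01.
move=> s ts; rewrite sub0r normrN.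
have bd : BH (Ln B u s - Ln B u t).
  by apply: BH_sub; [case: (Ln_limitP s)|case: (Ln_limitP t)].
rewrite norm0E// ger0_norm ?opnorm_ge0//; apply: le_lt_trans hd.
have m1 : Num.min dl 1 <= 1 by rewrite ge_min lexx orbT.
have m0 : 0 <= Num.min dl 1 by rewrite le_min ltW//= ler01.
apply: (@le_trans _ _ (time_const C * Num.sqrt (Num.min dl 1))).
  apply: opnorm_le; first by rewrite mulr_ge0 ?time_const_ge0 ?sqrtr_ge0.
  exact: Ln_diff m1 (ltW ts).
by rewrite ler_wpM2l ?time_const_ge0// ler_sqrt ?(ltW d0)// ge_min lexx.
Qed.

End Rate.

Lemma rate_exists u : C00_mul B u -> exists2 C : R, 0 < C & forall h : R, 0 <= h ->
  bounded_by (C * h) (E0 ((real_index u h : B -> B) - idfun)).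
Proof. by move=> /real_index_cocycle/mean_rate. Qed.

(** The two cocycles come with their own Lipschitz constants, and the larger one
serves for both. *)
Lemma Ln_inj u v : C00_mul B u -> C00_mul B v -> Ln B u = Ln B v -> u = v.
Proof.
move=> uC vC uv.
have [C1 C10 r1] := rate_exists uC; have [C2 C20 r2] := rate_exists vC.
pose C := Num.max C1 C2.
have C0 : 0 < C by rewrite lt_max C10.
have le_maxl : C1 <= C by rewrite /C le_max lexx.
have le_maxr : C2 <= C by rewrite /C le_max lexx orbT.
have mono (D h : R) (T : op B) : D <= C -> 0 <= h -> bounded_by (D * h) T ->
  bounded_by (C * h) T.
  move=> DC h0 hT w; apply: le_trans (hT w) _.
  by rewrite ler_wpM2r ?rn_ge0// ler_wpM2r.
have r1' h : 0 <= h -> bounded_by (C * h) (E0 ((real_index u h : B -> B) - idfun)).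
  by move=> h0; exact: mono (le_maxl) h0 (r1 h h0).
have r2' h : 0 <= h -> bounded_by (C * h) (E0 ((real_index v h : B -> B) - idfun)).
  by move=> h0; exact: mono (le_maxr) h0 (r2 h h0).
have lim w : C00_mul B w ->
    (forall h : R, 0 <= h -> bounded_by (C * h)
      (E0 ((real_index w h : B -> B) - idfun))) ->
    forall t : R, 0 <= t -> Ln_limit (real_index w) C t (Ln B w (nnabs t)).
  move=> wC rw t t0; pose t' := nnabs t.
  by have := Ln_limitP wC C0 rw t'; rewrite /= ger0_norm.
have limu := lim u uC r1'.
have limv : forall t : R, 0 <= t -> Ln_limit (real_index v) C t (Ln B u (nnabs t)).
  by rewrite uv; exact: lim v vC r2'.
have t0 (t : {nonneg R}) : 0 <= t%:num :> R by [].
apply/funext => t; rewrite -(real_indexE u) -(real_indexE v).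
have E := cocycle_inj (real_index_cocycle uC) (real_index_cocycle vC) C0 r1' limu limv
  (t0 t).
exact: E.
Qed.

End CocyclesOfShift.

Theorem theorem6p5p1 (R : realType) (B : bernoulli_shift R) :
  [/\ forall u, C00_mul B u -> forall t, is_Ln u t (Ln B u t),
      Ln B @` C00_mul B `<=` C00_add B &
      set_bij (C00_mul B) (Ln B @` C00_mul B) (Ln B)].
Proof.
split.
- move=> u uC t; have [C C0 rate] := rate_exists uC.
  exact: is_LnP uC C0 rate t.
- move=> _ [u uC <-]; have [C C0 rate] := rate_exists uC.
  exact: Ln_additive uC C0 rate.
- split.
  + by move=> u uC; exists u.
  + by move=> u v; rewrite !inE; exact: Ln_inj.
  + by move=> _ [u uC <-]; exists u.
Qed.
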